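(* Let $w\in W$, let $B_w$ be the (meromorphically continued) Borel transform defined in the context and let $\theta_j$ be a direction such that the ray $\mathbb R_+^{\theta_j}$ meets poles of $B_w$. Assume there exists $\epsilon>0$ such that $\mathcal L_\theta(B_w)$ is well defined for all $\theta\in[\theta_j-\epsilon,\theta_j)\cup(\theta_j,\theta_j+\epsilon]$. Assume further that the poles of $B_w$ in the sector $\arg\xi\in[\theta_j-\epsilon,\theta_j+\epsilon]$ all lie on the ray $\mathbb R_+^{\theta_j}$, and that there exists a sequence $R_n\in\mathbb R_+$, converging to infinity as $n\to\infty$, such that $R_ne^{i\theta_j}$ is not a pole of $B_w$ and $$\lim_{n\to\infty}R_n\sup_{\xi\in\Gamma_n}\left|e^{-\xi/\gamma}B_w(\xi)\right|=0,\qquad \Gamma_n=\{R_ne^{i\theta}\mid\theta\in[\theta_j-\epsilon,\theta_j+\epsilon]\}.$$ Then $$\Delta_{\theta_j}(\mathcal L_\theta(B_w))=2\pi i\sum_{p\in P_{B_w}\cap\mathbb R_+^{\theta_j}}\operatorname{Res}_{\xi=p}\left(e^{-\xi/\gamma}B_w(\xi)\right).$$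
   Context: Setting. $W\subset\mathbb C$ is open and connected; $K$ is a meromorphic function on $W\times\mathbb C$ such that no $\{w\}\times\mathbb C$ lies in its pole divisor, $K_w(z)=K(w,z)$; $(\Gamma_w)_{w\in W}$ is a continuous family of curves in $\mathbb C$ avoiding the poles of $K_w$; $h_m(w)=\int_{\Gamma_w}K(w,z)z^m\,dz$ are assumed to exist and be holomorphic on $W$; $k_0\in\mathbb Z_{\ge0}$ is the pole order of $K_w$ at $0$, assumed independent of $w$. $f$ is meromorphic on $\mathbb C$ with Laurent series $\sum_{m\ge-n_0}a_mz^m$ at $0$. Put $g^+_\gamma(w)=\sum_{m=k_0}^\infty a_mh_m(w)\gamma^m$ (formal series in $\gamma$). The formal Borel transform is the linear map with $\mathcal B(\gamma^m)=\xi^{m-1}/(m-1)!$, and $B_w(\xi)=\mathcal B(g^+_\gamma(w))(\xi)$, assumed convergent near $\xi=0$ and continued meromorphically to a neighbourhood of the closed sector $\arg\xi\in[\theta_j-\epsilon,\theta_j+\epsilon]$; $P_{B_w}$ is its set of poles. $\mathbb R_+^\theta=e^{i\theta}\mathbb R_+$ and $\mathcal L_\theta(\psi)(\gamma)=\int_{\mathbb R_+^\theta}e^{-\xi/\gamma}\psi(\xi)\,d\xi$, with $\gamma$ the fixed parameter at which all transforms are evaluated. $\mathcal L_\theta(B_w)$ is constant in $\theta$ on sectors where $B_w$ has no poles. The jump at $\theta_j$ is $\Delta_{\theta_j}(\mathcal L_\theta(B_w))=\mathcal L_{\theta'}(B_w)(\gamma)-\mathcal L_{\theta''}(B_w)(\gamma)$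 for $\theta'\in[\theta_j-\epsilon,\theta_j)$ and $\theta''\in(\theta_j,\theta_j+\epsilon]$. If there are infinitely many poles on the ray, the sum of residues is the limit of the partial sums over poles with $|p|<R_n$. *)

(* Defs.v *)
(** Stdlib reals with Coquelicot's complex numbers [C]. *)
From Stdlib Require Import Reals List ZArith.
From Coquelicot Require Import Coquelicot.

Set Implicit Arguments.

Open Scope C_scope.

(** * Complex analysis *)

Definition Cexp (z : C) : C :=
  ((exp (fst z) * cos (snd z))%R, (exp (fst z) * sin (snd z))%R).

(** The point [r e^(i theta)]. *)
Definition polar (r theta : R) : C := r * Cexp (Ci * theta).

Definition connected_set (W : C -> Prop) : Prop :=
  forall A B : C -> Prop,
    open (T := C_UniformSpace) A -> open (T := C_UniformSpace) B ->
    (forall z, W z -> A z \/ B z) ->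
    (exists z, W z /\ A z) -> (exists z, W z /\ B z) ->
    exists z, W z /\ A z /\ B z.

Definition holomorphic_at (f : C -> C) (p : C) : Prop :=
  locally (T := C_UniformSpace) p
    (fun z => ex_derive (K := C_AbsRing) (V := C_NormedModule) f z).

(** Near [p], except perhaps at [p], [f z = g z / (z - p)^n] with [g]
    holomorphic at [p], and [g p <> 0] unless [n = 0].  Order [0] means that
    [f] is holomorphic at [p], possibly after removing a singularity. *)
Definition has_pole_order (f : C -> C) (p : C) (n : nat) : Prop :=
  exists g : C -> C,
    holomorphic_at g p /\ (n = 0%nat \/ g p <> 0) /\
    locally' (T := C_UniformSpace) p (fun z => f z = g z / (z - p) ^ n).

Definition is_pole (f : C -> C) (p : C) : Prop :=
  exists n : nat, (0 < n)%nat /\ has_pole_order f p n.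

(** Meromorphic functions are total functions on [C]; their values at poles
    are irrelevant, and they carry no removable singularities. *)
Definition meromorphic_on (D : C -> Prop) (f : C -> C) : Prop :=
  forall p, D p -> holomorphic_at f p \/ is_pole f p.

(** [f z = sum_(m >= - n0) a m (z - p)^m] on a punctured neighbourhood of [p],
    stated after multiplication by [(z - p)^n0]. *)
Definition is_laurent (f : C -> C) (p : C) (n0 : nat) (a : Z -> C) : Prop :=
  (forall m : Z, (m < - Z.of_nat n0)%Z -> a m = 0) /\
  locally' (T := C_UniformSpace) p (fun z =>
    is_pseries (K := C_AbsRing) (V := C_NormedModule)
      (fun j : nat => a (Z.of_nat j - Z.of_nat n0)%Z) (z - p)
      ((z - p) ^ n0 * f z)).

Definition is_residue (f : C -> C) (p r : C) : Prop :=
  exists (n0 : nat) (a : Z -> C), is_laurent f p n0 a /\ r = a (-1)%Z.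

Definition Residue (f : C -> C) (p : C) : C :=
  iota (T := C_CompleteNormedModule) (is_residue f p).

(** * Meromorphic functions of two variables *)

Definition C2 : NormedModule C_AbsRing :=
  prod_NormedModule C_AbsRing C_NormedModule C_NormedModule.

Definition holomorphic2_at (F : C2 -> C) (p : C2) : Prop :=
  locally p (fun q => ex_filterdiff (V := C_NormedModule) F (locally q)).

(** [F = G] near [p] off the zero set of a nonzero holomorphic germ. *)
Definition generically_eq (F G : C2 -> C) (p : C2) : Prop :=
  exists d : C2 -> C,
    holomorphic2_at d p /\ ~ locally p (fun q => d q = 0) /\
    locally p (fun q => d q <> 0 -> F q = G q).

(** Locally a quotient of holomorphic functions; the second clause says that
    [F] has its regular value wherever it extends holomorphically. *)
Definition meromorphic2_on (D : C2 -> Prop) (F : C2 -> C) : Prop :=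
  forall p, D p ->
    (exists g h : C2 -> C,
       holomorphic2_at g p /\ holomorphic2_at h p /\
       ~ locally p (fun q => h q = 0) /\
       locally p (fun q => h q <> 0 -> F q = g q / h q)) /\
    (forall G : C2 -> C,
       holomorphic2_at G p -> generically_eq F G p ->
       locally p (fun q => F q = G q)).

(** Support of the pole divisor of a meromorphic function (it contains the
    points of indeterminacy). *)
Definition polar_set2 (F : C2 -> C) (p : C2) : Prop := ~ holomorphic2_at F p.

(** * Curves *)

(** Curves are parametrised by the whole real line.  Unbounded curves and curves
    without endpoints are reparametrised to [R]; a curve on a compact interval
    is extended by constants, which does not change integrals along it. *)

Definition velocity (c : R -> C) (t : R) : C :=
  (Derive (fun s => fst (c s)) t, Derive (fun s => snd (c s)) t).

Definition C1_at (c : R -> C) (t : R) : Prop :=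
  locally t (fun s =>
    ex_derive (K := R_AbsRing) (V := C_R_NormedModule) c s /\
    continuous (U := C_UniformSpace) (velocity c) s).

(** At every parameter the curve is a junction of two [C^1] pieces; hence there
    are finitely many corners on each compact interval. *)
Definition piecewise_C1 (c : R -> C) : Prop :=
  forall t : R, exists c1 c2 : R -> C,
    C1_at c1 t /\ C1_at c2 t /\
    locally t (fun s =>
      ((s <= t)%R -> c s = c1 s) /\ ((t <= s)%R -> c s = c2 s)).

Definition continuous_family_of_curves (W : C -> Prop) (Gam : C -> R -> C)
  : Prop :=
  (forall w, W w -> piecewise_C1 (Gam w)) /\
  (forall (w : C) (t : R), W w ->
     continuous (T := prod_UniformSpace C_UniformSpace R_UniformSpace)
       (U := C_UniformSpace) (fun q => Gam (fst q) (snd q)) (w, t)).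

(** The (possibly improper) integral of [f] along [c] exists and equals [l]. *)
Definition is_curve_integral (f : C -> C) (c : R -> C) (l : C) : Prop :=
  is_RInt_gen (V := C_R_NormedModule) (fun t => f (c t) * velocity c t)
    (Rbar_locally m_infty) (Rbar_locally p_infty) l.

(** * Formal Borel transform *)

(** A formal power series is its sequence of coefficients. *)
Definition gplus (a : Z -> C) (h : nat -> C -> C) (k0 : nat) (w : C)
  : nat -> C :=
  fun m => if Nat.leb k0 m then a (Z.of_nat m) * h m w else 0.

(** [gamma^m |-> xi^(m-1) / (m-1)!].  The constant term is sent to [0],
    in accordance with [1/(-1)! = 1/Gamma(0) = 0]. *)
Definition formal_Borel (c : nat -> C) : nat -> C :=
  fun n => c (S n) / RtoC (INR (fact n)).

(** * Laplace transforms *)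

Definition ray (theta : R) (xi : C) : Prop :=
  exists r : R, (0 <= r)%R /\ xi = polar r theta.

Definition closed_sector (theta1 theta2 : R) (xi : C) : Prop :=
  exists r theta : R,
    (0 <= r)%R /\ (theta1 <= theta <= theta2)%R /\ xi = polar r theta.

Definition Laplace_integrand (gamma : C) (psi : C -> C) (xi : C) : C :=
  Cexp (- xi / gamma) * psi xi.

Definition Laplace_ray_integrand (theta : R) (gamma : C) (psi : C -> C)
  : R -> C :=
  fun r => Laplace_integrand gamma psi (polar r theta) * polar 1 theta.

Definition ex_Laplace (theta : R) (psi : C -> C) (gamma : C) : Prop :=
  ex_RInt_gen (V := C_R_NormedModule) (Laplace_ray_integrand theta gamma psi)
    (at_point 0%R) (Rbar_locally p_infty).

Definition Laplace (theta : R) (psi : C -> C) (gamma : C) : C :=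
  RInt_gen (V := C_R_CompleteNormedModule)
    (Laplace_ray_integrand theta gamma psi)
    (at_point 0%R) (Rbar_locally p_infty).

(** [Delta] is the jump at [thetaj]: the difference of the transforms on the two
    sides, whatever the chosen directions. *)
Definition is_Laplace_jump (psi : C -> C) (gamma : C) (thetaj eps : R)
    (Delta : C) : Prop :=
  forall theta' theta'' : R,
    (thetaj - eps <= theta' < thetaj)%R ->
    (thetaj < theta'' <= thetaj + eps)%R ->
    Laplace theta' psi gamma - Laplace theta'' psi gamma = Delta.

(** [M] is the supremum of [|F|] on the arc of radius [r]. *)
Definition is_arc_sup (F : C -> C) (r theta1 theta2 M : R) : Prop :=
  is_lub (fun x => exists theta : R,
    (theta1 <= theta <= theta2)%R /\ x = Cmod (F (polar r theta))) M.

(** Sum of the residues of [F] over [P], as the limit of the sums over the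
    finite sets of [p] in [P] with [|p| < Rn n].  If [P] is finite and [Rn] tends
    to infinity this is the ordinary sum. *)
Definition is_residue_sum (F : C -> C) (P : C -> Prop) (Rn : nat -> R) (s : C)
  : Prop :=
  exists l : nat -> list C,
    (forall n, NoDup (l n) /\
       forall p, In p (l n) <-> P p /\ (Cmod p < Rn n)%R) /\
    filterlim (fun n => fold_right Cplus 0 (map (Residue F) (l n)))
      eventually (locally (T := C_UniformSpace) s).

(* Main.v *)
Require Import Defs.
From Stdlib Require Import Reals List ZArith.
From Stdlib Require Import Lra Lia Classical
  ClassicalEpsilon FunctionalExtensionality.
From Coquelicot Require Import Coquelicot.

Set Implicit Arguments.
Open Scope C_scope.

Local Notation is_Cderive :=
  (is_derive (K := C_AbsRing) (V := C_NormedModule)).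
Local Notation ex_Cderive :=
  (ex_derive (K := C_AbsRing) (V := C_NormedModule)).
Local Notation Clocally := (locally (T := C_UniformSpace)).
Local Notation Clocally' := (locally' (T := C_UniformSpace)).
Local Notation Ccontinuous := (continuous (U := C_UniformSpace)).
Local Notation is_RCderive :=
  (is_derive (K := R_AbsRing) (V := C_R_NormedModule)).
Local Notation is_CRInt := (is_RInt (V := C_R_NormedModule)).
Local Notation ex_CRInt := (ex_RInt (V := C_R_NormedModule)).
Local Notation CRInt := (RInt (V := C_R_CompleteNormedModule)).
Local Notation is_Cpseries :=
  (is_pseries (K := C_AbsRing) (V := C_NormedModule)).

(** The boundary integral of a holomorphic function over the image of a rectangle
    under [(x, y) |-> w + x v(y)] vanishes (Goursat's bisection argument); no
    continuity of the derivative is needed.  With [v] a circle this gives Cauchy's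
    formula, hence Taylor expansions and residues at poles.  With [w = 0] and
    [v(t) = e^(it)] it gives the theorem of Cauchy on circular sectors;
      subtracting
    the principal parts at the poles on the ray [thetaj] reduces the residue
    theorem to the functions [1 / (z - p)^k],
      where the sector can be opened to a
    full disk without meeting [p] again.  Applied to sectors of radius [R_n],
    whose arcs contribute at most [2 eps R_n sup |F|], this is the claim in the
    limit.  The opening of the sector is less than [2 pi] on each side, since
    otherwise the ray [thetaj] itself would be a direction where the Laplace
    integral exists, although its integrand is unbounded near a pole. *)

(** * Complex differentiability *)

(** Even with [eps < 2 PI] the sector can have an opening close to 4 PI and cover part of the plane
    twice, so no step may treat it as a plane domain with an inside. This is why bisection acts on
    the rectangle of parameters and not on its image: overlaps and the collapse of a side to the
    apex are then harmless, and the index of a pole is found from additivity in the angle. For a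
    closed [v] the two radial sides cancel, so the same theorem compares loops. The rays start at
    the apex, so [B] must have no pole at 0; this comes from the convergence of the Borel series
    there. [Residue] is a definite description and has a known value only through uniqueness of
    Laurent coefficients. The Taylor expansion of the numerator of a pole supplies both that value
    and the principal part to be subtracted. The conclusion contains the convergence of the residue
    sums and the independence of the jump from the directions. Both follow from one estimate, valid
    for every pair of directions, in which the residue sum does not depend on the pair. *)

Lemma Clocally_iff (z : C) (P : C -> Prop) :
  Clocally z P <->
  exists d : R, (0 < d)%R /\ forall y, (Cmod (y - z)%C < d)%R -> P y.
Proof.
split.
- intros [d Hd]; exists d; split; [apply cond_pos|].
  intros y Hy; apply Hd; now apply C_NormedModule_mixin_compat1.
- intros [d [Hd H]].
  (* Balls of [C_UniformSpace] are squares; half the radius is enough because sqrt 2 < 2. *)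
  assert (Hd2 : (0 < d / 2)%R) by lra.
  exists (mkposreal _ Hd2); intros y [H1 H2]; apply H.
  apply Rle_lt_trans with (1 := Cmod_2Rmax _).
  assert (Rmax (Rabs (fst (y - z)%C)) (Rabs (snd (y - z)%C)) < d / 2)%R.
  { apply Rmax_lub_lt; assumption. }
  assert (0 <= Rmax (Rabs (fst (y - z)%C)) (Rabs (snd (y - z)%C)))%R.
  { eapply Rle_trans; [apply Rabs_pos | apply Rmax_l]. }
  assert (sqrt 2 < 2)%R.
  { rewrite <- (sqrt_square 2) at 2 by lra; apply sqrt_lt_1; lra. }
  assert (0 <= sqrt 2)%R by apply sqrt_pos.
  nra.
Qed.

Lemma Clocally'_iff (z : C) (P : C -> Prop) :
  Clocally' z P <->
  exists d : R, (0 < d)%R /\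
    forall y, (Cmod (y - z)%C < d)%R -> y <> z -> P y.
Proof. apply (Clocally_iff z (fun y => y <> z -> P y)). Qed.

Lemma is_Cderive_iff (f : C -> C) (z l : C) :
  is_Cderive f z l <->
  forall e : R, (0 < e)%R -> exists d : R, (0 < d)%R /\
    forall y, (Cmod (y - z)%C < d)%R ->
      (Cmod (f y - f z - l * (y - z)) <= e * Cmod (y - z))%R.
Proof.
split.
- intros [_ H] e He.
  specialize (H z (fun P HP => HP) (mkposreal e He)).
  destruct H as [d Hd]; exists d; split; [apply cond_pos|].
  intros y Hy; specialize (Hd y Hy).
  change (Cmod (f y - f z - (y - z) * l) <= e * Cmod (y - z))%R in Hd.
  now rewrite (Cmult_comm l).
- intros H; split.
  + apply (is_linear_scal_l (K := C_AbsRing) (V := C_NormedModule)).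
  + intros x Hx e.
    assert (x = z) by (symmetry;
      apply (is_filter_lim_locally_unique (V :=
        AbsRing_NormedModule C_AbsRing)); exact Hx).
    subst x.
    destruct (H e (cond_pos e)) as [d [Hd Hy]].
    exists (mkposreal d Hd); intros y Hby; specialize (Hy y Hby).
    change (Cmod (f y - f z - (y - z) * l) <= e * Cmod (y - z))%R.
    now rewrite (Cmult_comm _ l).
Qed.

Lemma Rabs_fst_le (z : C) : (Rabs (fst z) <= Cmod z)%R.
Proof. apply re_le_Cmod. Qed.

Lemma Cnorm_Cmod (z : C) : norm (V := C_R_NormedModule) z = Cmod z.
Proof.
unfold Cmod; cbn; unfold prod_norm; cbn -[pow].
change (sqrt (Rabs (fst z) ^ 2 + Rabs (snd z) ^ 2) =
  sqrt (fst z ^ 2 + snd z ^ 2)).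
now rewrite !pow2_abs.
Qed.

Lemma is_RCderive_iff (g : R -> C) (t : R) (l : C) :
  is_RCderive g t l <->
  forall e : R, (0 < e)%R -> exists d : R, (0 < d)%R /\
    forall y, (Rabs (y - t) < d)%R ->
      (Cmod (g y - g t - l * RtoC (y - t)) <= e * Rabs (y - t))%R.
Proof.
assert (E : forall y, norm (K := R_AbsRing) (V := C_R_NormedModule)
   (minus (minus (g y) (g t)) (scal (minus y t) l))
   = Cmod (g y - g t - l * RtoC (y - t))).
{ intros y; rewrite Cnorm_Cmod; f_equal.
  apply injective_projections; cbn; unfold minus, plus, opp, scal, mult; cbn;
  unfold mult; cbn; ring. }
split.
- intros [_ H] e He.
  specialize (H t (fun P HP => HP) (mkposreal e He)).
  destruct H as [d Hd]; exists d; split; [apply cond_pos|].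
  intros y Hy; rewrite <- E; exact (Hd y Hy).
- intros H; split.
  + apply (is_linear_scal_l (K := R_AbsRing) (V := C_R_NormedModule)).
  + intros x Hx e.
    assert (x = t) by (symmetry;
      apply (is_filter_lim_locally_unique (V := R_NormedModule)); exact Hx).
    subst x.
    destruct (H e (cond_pos e)) as [d [Hd Hy]].
    exists (mkposreal d Hd); intros y Hby; specialize (Hy y Hby).
    rewrite <- E in Hy; exact Hy.
Qed.

Lemma Ccontinuous_pair (T : UniformSpace) (f : T -> C) (x : T) :
  continuous (fun t => fst (f t)) x -> continuous (fun t => snd (f t)) x ->
  Ccontinuous f x.
Proof.
intros H1 H2.
apply filterlim_locally; intros e.
generalize (proj1 (filterlim_locally _ _) H1 e); intros H1'.
generalize (proj1 (filterlim_locally _ _) H2 e); intros H2'.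
apply (filter_imp _ _ (fun t (H : _ /\ _) => conj (proj1 H) (proj2 H))
  (filter_and _ _ H1' H2')).
Qed.

Lemma Ccontinuous_fst (T : UniformSpace) (f : T -> C) (x : T) :
  Ccontinuous f x -> continuous (fun t => fst (f t)) x.
Proof.
intros H; apply (continuous_comp f fst); [exact H | apply continuous_fst].
Qed.

Lemma Ccontinuous_snd (T : UniformSpace) (f : T -> C) (x : T) :
  Ccontinuous f x -> continuous (fun t => snd (f t)) x.
Proof.
intros H; apply (continuous_comp f snd); [exact H | apply continuous_snd].
Qed.

Lemma Ccontinuous_plus (T : UniformSpace) (f g : T -> C) (x : T) :
  Ccontinuous f x -> Ccontinuous g x -> Ccontinuous (fun t => f t + g t) x.
Proof.
intros Hf Hg; apply Ccontinuous_pair; cbn.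
- apply (continuous_plus (V := R_NormedModule)); now apply Ccontinuous_fst.
- apply (continuous_plus (V := R_NormedModule)); now apply Ccontinuous_snd.
Qed.

Lemma Ccontinuous_mult (T : UniformSpace) (f g : T -> C) (x : T) :
  Ccontinuous f x -> Ccontinuous g x -> Ccontinuous (fun t => f t * g t) x.
Proof.
intros Hf Hg.
assert (F1 := Ccontinuous_fst Hf); assert (F2 := Ccontinuous_snd Hf).
assert (G1 := Ccontinuous_fst Hg); assert (G2 := Ccontinuous_snd Hg).
apply Ccontinuous_pair; cbn.
- apply (continuous_minus (V := R_NormedModule));
    apply (continuous_mult (K := R_AbsRing)); assumption.
- apply (continuous_plus (V := R_NormedModule));
    apply (continuous_mult (K := R_AbsRing)); assumption.
Qed.

Lemma Ccontinuous_const (T : UniformSpace) (c : C) (x : T) :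
  Ccontinuous (fun _ => c) x.
Proof. apply continuous_const. Qed.

Lemma Ccontinuous_minus (T : UniformSpace) (f g : T -> C) (x : T) :
  Ccontinuous f x -> Ccontinuous g x -> Ccontinuous (fun t => f t - g t) x.
Proof.
intros Hf Hg.
apply continuous_ext with (fun t => f t + RtoC (-1) * g t).
{ intros t; change (f t + RtoC (-1) * g t = f t - g t :> C); ring. }
apply Ccontinuous_plus; [exact Hf|].
apply Ccontinuous_mult; [apply Ccontinuous_const | exact Hg].
Qed.

Lemma ex_Cderive_continuous (f : C -> C) (z : C) :
  ex_Cderive f z -> continuous (T := C_UniformSpace) (U := C_UniformSpace) f z.
Proof.
intros [l Hl]; rewrite is_Cderive_iff in Hl.
destruct (Hl 1%R Rlt_0_1) as [d [Hd H]].
intros P HP; apply Clocally_iff in HP; destruct HP as [e [He HP]].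
apply Clocally_iff.
assert (Hl0 := Cmod_ge_0 l).
exists (Rmin d (e / (2 + Cmod l))); split.
{ apply Rmin_glb_lt; [exact Hd|]; apply Rdiv_lt_0_compat; lra. }
intros y Hy; apply HP.
specialize (H y (Rlt_le_trans _ _ _ Hy (Rmin_l _ _))).
assert (Hy2 := Rlt_le_trans _ _ _ Hy (Rmin_r _ _)).
replace (f y - f z) with ((f y - f z - l * (y - z)) + l * (y - z)) by ring.
eapply Rle_lt_trans; [apply Cmod_triangle|]; rewrite Cmod_mult.
assert (0 <= Cmod (y - z))%R by apply Cmod_ge_0.
apply (Rmult_lt_compat_r (2 + Cmod l)) in Hy2; [|lra].
unfold Rdiv in Hy2; rewrite Rmult_assoc, Rinv_l in Hy2 by lra.
nra.
Qed.

Lemma Ccontinuous_comp (T : UniformSpace) (f : C -> C) (g : T -> C) (x : T) :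
  Ccontinuous g x -> ex_Cderive f (g x) -> Ccontinuous (fun t => f (g t)) x.
Proof.
intros Hg Hf; apply (continuous_comp g f); [exact Hg|].
now apply ex_Cderive_continuous.
Qed.

Lemma is_Cderive_const (c z : C) : is_Cderive (fun _ => c) z (RtoC 0).
Proof.
apply is_Cderive_iff; intros e He; exists 1%R; split; [lra|].
intros y _; replace (c - c - 0 * (y - z)) with (RtoC 0) by ring.
rewrite Cmod_0; apply Rmult_le_pos; [lra | apply Cmod_ge_0].
Qed.

Lemma is_Cderive_id (z : C) : is_Cderive (fun y => y) z (RtoC 1).
Proof.
apply is_Cderive_iff; intros e He; exists 1%R; split; [lra|].
intros y _; replace (y - z - 1 * (y - z)) with (RtoC 0) by ring.
rewrite Cmod_0; apply Rmult_le_pos; [lra | apply Cmod_ge_0].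
Qed.

Lemma is_Cderive_plus (f g : C -> C) (z a b : C) :
  is_Cderive f z a -> is_Cderive g z b ->
  is_Cderive (fun y => f y + g y)%C z (a + b)%C.
Proof. exact (is_derive_plus (K := C_AbsRing) (V :=
  C_NormedModule) f g z a b). Qed.

Lemma is_Cderive_mult (f g : C -> C) (z a b : C) :
  is_Cderive f z a -> is_Cderive g z b ->
  is_Cderive (fun y => f y * g y)%C z (a * g z + f z * b)%C.
Proof.
rewrite !is_Cderive_iff; intros Hf Hg e He.
assert (Cf : exists d, (0 < d)%R /\ forall y, (Cmod (y - z)%C < d)%R ->
    (Cmod (f y - f z) <= (1 + Cmod a) * Cmod (y - z))%R).
{ destruct (Hf 1%R Rlt_0_1) as [d [Hd H]]; exists d; split; [exact Hd|].
  intros y Hy; specialize (H y Hy).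
  replace (f y - f z) with ((f y - f z - a * (y - z)) + a * (y - z)) by ring.
  eapply Rle_trans; [apply Cmod_triangle|]; rewrite Cmod_mult; lra. }
destruct Cf as [d0 [Hd0 H0]].
set (A := Cmod a) in *; assert (HA : (0 <= A)%R) by apply Cmod_ge_0.
set (B := Cmod b); assert (HB : (0 <= B)%R) by apply Cmod_ge_0.
set (F := Cmod (f z)); assert (HF : (0 <= F)%R) by apply Cmod_ge_0.
set (G := Cmod (g z)); assert (HG : (0 <= G)%R) by apply Cmod_ge_0.
(* The four error terms below are at most [e' * h] times [G], [F], [1 + A] and [1], which add up to
   [e * h]. *)
set (e' := (e / (1 + F + G + (1 + A)))%R).
assert (He' : (0 < e')%R) by (apply Rdiv_lt_0_compat; lra).
assert (E6 : e = (e' * (1 + F + G + (1 + A)))%R) by (unfold e'; field; lra).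
clearbody e'.
destruct (Hf e' He') as [d1 [Hd1 H1]].
destruct (Hg e' He') as [d2 [Hd2 H2]].
set (d3 := (e' / ((1 + A) * (1 + B)))%R).
assert (Hd3 : (0 < d3)%R) by (apply Rdiv_lt_0_compat; nra).
exists (Rmin 1 (Rmin (Rmin d0 d3) (Rmin d1 d2))); split.
{ repeat apply Rmin_glb_lt; lra. }
intros y Hy.
assert (L1 := Rlt_le_trans _ _ _ Hy (Rmin_l _ _)).
assert (L := Rlt_le_trans _ _ _ Hy (Rmin_r _ _)).
assert (L2 := Rlt_le_trans _ _ _ L (Rmin_l _ _)).
assert (L3 := Rlt_le_trans _ _ _ L (Rmin_r _ _)).
specialize (H0 y (Rlt_le_trans _ _ _ L2 (Rmin_l _ _))).
assert (L4 := Rlt_le_trans _ _ _ L2 (Rmin_r _ _)).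
specialize (H1 y (Rlt_le_trans _ _ _ L3 (Rmin_l _ _))).
specialize (H2 y (Rlt_le_trans _ _ _ L3 (Rmin_r _ _))).
replace (f y * g y - f z * g z - (a * g z + f z * b) * (y - z)) with
 ((f y - f z - a * (y - z)) * g z + f z * (g y - g z - b * (y - z))
  + (f y - f z) * (g y - g z - b * (y - z)) + (f y - f z) * (b * (y - z))) by ring.
set (h := Cmod (y - z)) in *; assert (Hh : (0 <= h)%R) by apply Cmod_ge_0.
eapply Rle_trans; [apply Cmod_triangle|].
eapply Rle_trans; [apply Rplus_le_compat_r, Cmod_triangle|].
eapply Rle_trans; [apply Rplus_le_compat_r, Rplus_le_compat_r, Cmod_triangle|].
rewrite !Cmod_mult.
fold h F G B.
set (p := Cmod (f y - f z - a * (y - z))) in *.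
set (q := Cmod (g y - g z - b * (y - z))) in *.
set (k := Cmod (f y - f z)) in *.
assert (0 <= p)%R by apply Cmod_ge_0.
assert (0 <= q)%R by apply Cmod_ge_0.
assert (0 <= k)%R by apply Cmod_ge_0.
assert (E1 : (p * G <= e' * h * G)%R) by (apply Rmult_le_compat_r; lra).
assert (E2 : (F * q <= F * (e' * h))%R) by (apply Rmult_le_compat_l; lra).
assert (E3 : (k * q <= (1 + A) * h * (e' * h))%R) by (apply Rmult_le_compat;
  lra).
assert (E3' : ((1 + A) * h * (e' * h) <= (1 + A) * (e' * h))%R).
{ assert (0 <= (1 + A) * (e' * h))%R by (repeat apply Rmult_le_pos; lra).
  replace ((1 + A) * h * (e' * h))%R with (h * ((1 + A) * (e' * h)))%R by ring.
  rewrite <- (Rmult_1_l ((1 + A) * (e' * h))) at 2.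
  apply Rmult_le_compat_r; lra. }
assert (E4 : (k * (B * h) <= (1 + A) * h * (B * h))%R).
{ apply Rmult_le_compat_r; [|lra]. apply Rmult_le_pos; lra. }
assert (Q : (h * ((1 + A) * (1 + B)) <= e')%R).
{ apply Rlt_le, (Rmult_lt_reg_r (/ ((1 + A) * (1 + B)))).
  - apply Rinv_0_lt_compat; nra.
  - rewrite Rmult_assoc, Rinv_r, Rmult_1_r by nra. exact L4. }
assert (E5 : ((1 + A) * h * (B * h) <= e' * h)%R).
{ replace ((1 + A) * h * (B * h))%R with ((h * ((1 + A) * B)) * h)%R by ring.
  apply Rmult_le_compat_r; [lra|].
  assert (0 <= h * (1 + A))%R by (apply Rmult_le_pos; lra).
  replace (h * ((1 + A) * (1 + B)))%R
    with (h * ((1 + A) * B) + h * (1 + A))%R in Q by ring.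
  lra. }
rewrite E6; lra.
Qed.

Lemma is_Cderive_ext_loc (f g : C -> C) (z l : C) :
  Clocally z (fun y => f y = g y) -> is_Cderive f z l -> is_Cderive g z l.
Proof.
rewrite Clocally_iff, !is_Cderive_iff; intros [d [Hd E]] H e He.
destruct (H e He) as [d' [Hd' H']].
exists (Rmin d d'); split; [now apply Rmin_glb_lt|].
intros y Hy.
rewrite <- (E y) by (eapply Rlt_le_trans; [exact Hy | apply Rmin_l]).
rewrite <- (E z).
- apply H'; eapply Rlt_le_trans; [exact Hy | apply Rmin_r].
- replace (z - z) with (RtoC 0) by ring; now rewrite Cmod_0.
Qed.

Lemma is_Cderive_ext (f g : C -> C) (z l : C) :
  (forall y, f y = g y) -> is_Cderive f z l -> is_Cderive g z l.
Proof.
intros E; apply is_Cderive_ext_loc, filter_forall, E.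
Qed.

Lemma ex_Cderive_ext_loc (f g : C -> C) (z : C) :
  Clocally z (fun y => f y = g y) -> ex_Cderive f z -> ex_Cderive g z.
Proof.
intros H [l Hl]; exists l; now apply is_Cderive_ext_loc with f.
Qed.

Lemma is_Cderive_inv (z : C) : z <> 0 -> is_Cderive Cinv z (- (/ (z * z)))%C.
Proof.
intros Hz; rewrite is_Cderive_iff; intros e He.
assert (Hm : (0 < Cmod z)%R) by now apply Cmod_gt_0.
set (m := Cmod z) in *.
(* The error is h^2 / (m^2 |y|) with h = |y - z|; the first bound keeps |y| >= m / 2, the second
   then makes the error at most e h. *)
exists (Rmin (m / 2) (e * (m * m * m / 2))); split.
{ apply Rmin_glb_lt; [lra|]; apply Rmult_lt_0_compat; [lra|].
  apply Rdiv_lt_0_compat; [|lra]; repeat apply Rmult_lt_0_compat; lra. }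
intros y Hy.
assert (L1 := Rlt_le_trans _ _ _ Hy (Rmin_l _ _)).
assert (L2 := Rlt_le_trans _ _ _ Hy (Rmin_r _ _)).
assert (Hym : (m / 2 <= Cmod y)%R).
{ assert (T := Cmod_triangle (y - z) (- y)).
  replace (y - z + - y) with (- z) in T by ring.
  rewrite !Cmod_opp in T; fold m in T; lra. }
assert (Hy0 : y <> 0) by (apply Cmod_gt_0; lra).
replace (/ y - / z - - / (z * z) * (y - z)) with
  ((y - z) * (y - z) * / (z * z * y)) by (field; split; assumption).
assert (Hzz : z * z * y <> 0) by (repeat apply Cmult_neq_0; assumption).
rewrite !Cmod_mult, Cmod_inv, !Cmod_mult by assumption; fold m.
set (h := Cmod (y - z)) in *; assert (0 <= h)%R by apply Cmod_ge_0.
set (n := Cmod y) in *.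
assert (Hmm : (0 < m * m)%R) by nra.
assert (0 < m * m * n)%R by (apply Rmult_lt_0_compat; lra).
apply (Rmult_le_reg_r (m * m * n)); [assumption|].
rewrite Rmult_assoc, Rinv_l, Rmult_1_r by lra.
assert (h <= e * (m * m * n))%R.
{ apply Rlt_le, Rlt_le_trans with (1 := L2).
  apply Rmult_le_compat_l; [lra|].
  replace (m * m * m / 2)%R with (m * m * (m / 2))%R by field.
  apply Rmult_le_compat_l; lra. }
nra.
Qed.

(** One estimate serves two chain rules: [k y] is the increment of the variable, either complex or a
    real one viewed in [C]. *)
Lemma chain_rule_estimate (T : Type) (x : T) (k g : T -> C) (f : C -> C)
    (a b : C) :
  (forall e : R, (0 < e)%R -> exists d : R, (0 < d)%R /\
    forall u, (Cmod (u - g x) < d)%R ->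
      (Cmod (f u - f (g x) - a * (u - g x)) <= e * Cmod (u - g x))%R) ->
  (forall e : R, (0 < e)%R -> exists d : R, (0 < d)%R /\
    forall y, (Cmod (k y) < d)%R ->
      (Cmod (g y - g x - b * k y) <= e * Cmod (k y))%R) ->
  forall e : R, (0 < e)%R -> exists d : R, (0 < d)%R /\
    forall y, (Cmod (k y) < d)%R ->
      (Cmod (f (g y) - f (g x) - a * b * k y) <= e * Cmod (k y))%R.
Proof.
intros Hf Hg e He.
set (A := Cmod a); assert (HA : (0 <= A)%R) by apply Cmod_ge_0.
set (B := Cmod b); assert (HB : (0 <= B)%R) by apply Cmod_ge_0.
assert (H1 : (0 < e / (2 * (1 + B)))%R) by (apply Rdiv_lt_0_compat; lra).
assert (H2 : (0 < Rmin 1 (e / (2 * (1 + A))))%R).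
{ apply Rmin_glb_lt; [lra|]. apply Rdiv_lt_0_compat; lra. }
destruct (Hf _ H1) as [d1 [Hd1 F]].
destruct (Hg _ H2) as [d2 [Hd2 G]].
exists (Rmin d2 (d1 / (1 + B))); split.
{ apply Rmin_glb_lt; [lra|]. apply Rdiv_lt_0_compat; lra. }
intros y Hy.
assert (L1 := Rlt_le_trans _ _ _ Hy (Rmin_l _ _)).
assert (L2 := Rlt_le_trans _ _ _ Hy (Rmin_r _ _)).
specialize (G y L1).
set (h := Cmod (k y)) in *; assert (Hh : (0 <= h)%R) by apply Cmod_ge_0.
assert (K : (Cmod (g y - g x) <= (1 + B) * h)%R).
{ replace (g y - g x) with ((g y - g x - b * k y) + b * k y) by ring.
  eapply Rle_trans; [apply Cmod_triangle|]; rewrite Cmod_mult; fold B h.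
  assert (M := Rmin_l 1 (e / (2 * (1 + A)))).
  assert (Rmin 1 (e / (2 * (1 + A))) * h <= 1 * h)%R
    by (apply Rmult_le_compat_r; lra).
  lra. }
assert (L3 : (Cmod (g y - g x) < d1)%R).
{ apply Rle_lt_trans with (1 := K).
  apply (Rmult_lt_compat_r (1 + B)) in L2; [|lra].
  unfold Rdiv in L2; rewrite Rmult_assoc, Rinv_l in L2 by lra; lra. }
specialize (F _ L3).
replace (f (g y) - f (g x) - a * b * k y) with
  ((f (g y) - f (g x) - a * (g y - g x)) + a * (g y - g x - b * k y)) by ring.
eapply Rle_trans; [apply Cmod_triangle|]; rewrite Cmod_mult; fold A.
assert (E1 : (Cmod (f (g y) - f (g x) - a * (g y - g x)) <= e / 2 * h)%R).
{ eapply Rle_trans; [exact F|].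
  eapply Rle_trans; [apply Rmult_le_compat_l; [lra | exact K]|].
  right; field; lra. }
assert (E2 : (A * Cmod (g y - g x - b * k y) <= e / 2 * h)%R).
{ eapply Rle_trans; [apply Rmult_le_compat_l; [lra | exact G]|].
  assert (M := Rmin_r 1 (e / (2 * (1 + A)))).
  set (m := Rmin _ _) in *.
  rewrite <- Rmult_assoc; apply Rmult_le_compat_r; [lra|].
  apply Rle_trans with ((1 + A) * m)%R; [nra|].
  apply Rle_trans with ((1 + A) * (e / (2 * (1 + A))))%R.
  - apply Rmult_le_compat_l; lra.
  - right; field; lra. }
lra.
Qed.

Lemma is_Cderive_comp (f g : C -> C) (z a b : C) :
  is_Cderive f (g z) a -> is_Cderive g z b ->
  is_Cderive (fun y => f (g y)) z (a * b)%C.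
Proof.
rewrite !is_Cderive_iff.
exact (@chain_rule_estimate C z (fun y => y - z) g f a b).
Qed.

Lemma is_RCderive_comp (f : C -> C) (g : R -> C) (t : R) (a b : C) :
  is_Cderive f (g t) a -> is_RCderive g t b ->
  is_RCderive (fun y => f (g y)) t (a * b)%C.
Proof.
rewrite is_Cderive_iff, !is_RCderive_iff; intros Hf Hg e He.
destruct (@chain_rule_estimate R t (fun y => RtoC (y - t)) g f a b) with e
  as [d [Hd H]]; [exact Hf | | exact He |].
- intros e' He'; destruct (Hg e' He') as [d [Hd H]].
  exists d; split; [exact Hd|]; intros y; rewrite Cmod_R; apply H.
- exists d; split; [exact Hd|]; intros y; generalize (H y).
  now rewrite Cmod_R.
Qed.

Lemma Cmod_Ci : Cmod Ci = 1%R.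
Proof.
unfold Cmod, Ci; cbn -[pow].
replace (0 ^ 2 + 1 ^ 2)%R with 1%R by ring; apply sqrt_1.
Qed.

Lemma is_Cderive_affine (a b z : C) :
  is_Cderive (fun y => a + b * y)%C z b.
Proof.
assert (H := is_Cderive_plus (is_Cderive_const a z)
  (is_Cderive_mult (is_Cderive_const b z) (is_Cderive_id z))).
cbv beta in H.
now replace (RtoC 0 + (RtoC 0 * z + b * RtoC 1)) with b in H by ring.
Qed.

Lemma is_Cderive_minus_const (p z : C) :
  is_Cderive (fun y => y - p)%C z (RtoC 1).
Proof.
apply is_Cderive_ext with (fun u => - p + 1 * u).
- intros u; change (- p + 1 * u = u - p :> C); ring.
- apply is_Cderive_affine.
Qed.

Lemma is_Cderive_inv_minus (p z : C) : z <> p ->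
  is_Cderive (fun y => / (y - p))%C z (- (/ (z - p) * / (z - p)))%C.
Proof.
intros Hz.
replace (- (/ (z - p) * / (z - p))) with (- / ((z - p) * (z - p)) * 1)
  by (field; now apply Cminus_eq_contra).
apply (is_Cderive_comp (f := Cinv) (g := fun y => y - p)).
- apply is_Cderive_inv; exact (@Cminus_eq_contra z p Hz).
- apply is_Cderive_minus_const.
Qed.

Lemma is_Cderive_pow (g : C -> C) (z l : C) (n : nat) :
  is_Cderive g z l ->
  is_Cderive (fun y => g y ^ S n)%C z (RtoC (INR (S n)) * g z ^ n * l)%C.
Proof.
intros Hg; induction n as [|n IH].
- replace (RtoC (INR 1) * g z ^ 0 * l) with l by (cbn; ring).
  apply is_Cderive_ext with g; [|exact Hg].
  intros y; change (g y = g y * 1 :> C); ring.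
- replace (RtoC (INR (S (S n))) * g z ^ S n * l)
    with (l * g z ^ S n + g z * (RtoC (INR (S n)) * g z ^ n * l)).
  + exact (is_Cderive_mult Hg IH).
  + rewrite (S_INR (S n)), RtoC_plus; cbn [Cpow]; ring.
Qed.

Lemma ex_Cderive_const (c z : C) : ex_Cderive (fun _ => c) z.
Proof. eexists; apply is_Cderive_const. Qed.

Lemma ex_Cderive_plus (f g : C -> C) (z : C) :
  ex_Cderive f z -> ex_Cderive g z -> ex_Cderive (fun y => f y + g y)%C z.
Proof. intros [a Ha] [b Hb]; eexists; exact (is_Cderive_plus Ha Hb). Qed.

Lemma ex_Cderive_mult (f g : C -> C) (z : C) :
  ex_Cderive f z -> ex_Cderive g z -> ex_Cderive (fun y => f y * g y)%C z.
Proof. intros [a Ha] [b Hb]; eexists; exact (is_Cderive_mult Ha Hb). Qed.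

Lemma ex_Cderive_inv_minus (p z : C) :
  z <> p -> ex_Cderive (fun y => / (y - p))%C z.
Proof. intros Hz; eexists; exact (is_Cderive_inv_minus Hz). Qed.

Lemma ex_Cderive_minus_const (p z : C) : ex_Cderive (fun y => y - p)%C z.
Proof. eexists; apply is_Cderive_minus_const. Qed.

Lemma ex_Cderive_pow (g : C -> C) (z : C) (n : nat) :
  ex_Cderive g z -> ex_Cderive (fun y => g y ^ n)%C z.
Proof.
intros [l Hl]; destruct n as [|n]; [exact (ex_Cderive_const 1 z)|].
eexists; exact (is_Cderive_pow n Hl).
Qed.

(** Reduces explicit curves to their real coordinates, where [auto_derive] applies. *)
Lemma is_RCderive_pair (g : R -> C) (t : R) (l : C) :
  is_derive (fun s => fst (g s)) t (fst l) ->
  is_derive (fun s => snd (g s)) t (snd l) -> is_RCderive g t l.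
Proof.
intros H1 H2; apply is_RCderive_iff; intros e He.
assert (He2 : (0 < e / 2)%R) by lra.
destruct H1 as [_ H1]; destruct H2 as [_ H2].
destruct (H1 t (fun P HP => HP) (mkposreal _ He2)) as [d1 D1].
destruct (H2 t (fun P HP => HP) (mkposreal _ He2)) as [d2 D2].
exists (Rmin d1 d2); split; [apply Rmin_glb_lt; apply cond_pos|].
intros y Hy.
specialize (D1 y (Rlt_le_trans _ _ _ Hy (Rmin_l _ _))).
specialize (D2 y (Rlt_le_trans _ _ _ Hy (Rmin_r _ _))).
cbn in D1, D2; unfold norm, minus, plus, opp, scal, mult in D1, D2;
  cbn in D1, D2.
unfold abs, mult in D1, D2; cbn in D1, D2.
set (z := g y - g t - l * RtoC (y - t)).
assert (Hz : (Cmod z <= Rabs (fst z) + Rabs (snd z))%R).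
{ replace z with (RtoC (fst z) + Ci * RtoC (snd z)) at 1
    by (unfold RtoC, Ci; apply injective_projections; cbn; ring).
  eapply Rle_trans; [apply Cmod_triangle|].
  rewrite Cmod_mult, !Cmod_R, Cmod_Ci; lra. }
replace (fst z) with (fst (g y) + - fst (g t) + - ((y + - t) * fst l))%R in Hz
  by (unfold z; cbn; ring).
replace (snd z) with (snd (g y) + - snd (g t) + - ((y + - t) * snd l))%R in Hz
  by (unfold z; cbn; ring).
unfold Rminus. lra.
Qed.

(** * Bisection and path integrals *)

(** [P n s t] speaks of the rectangle with lower corner [(s, t)] and sides [a / 2 ^ n], [b / 2 ^ n].
    If the whole rectangle fails, some quarter fails, and the nested failing rectangles close in on
    a point that contradicts the local hypothesis. Sides of length 0 are allowed: with [b = 0] this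
    is bisection of a segment. *)
Lemma rectangle_bisection (P : nat -> R -> R -> Prop) (a b s0 t0 : R) :
  (0 <= a)%R -> (0 <= b)%R ->
  (forall n s t,
     (s0 <= s)%R -> (s + a / 2 ^ n <= s0 + a)%R ->
     (t0 <= t)%R -> (t + b / 2 ^ n <= t0 + b)%R ->
     P (S n) s t -> P (S n) (s + a / 2 ^ S n)%R t ->
     P (S n) s (t + b / 2 ^ S n)%R ->
     P (S n) (s + a / 2 ^ S n)%R (t + b / 2 ^ S n)%R -> P n s t) ->
  (forall x y, (s0 <= x <= s0 + a)%R -> (t0 <= y <= t0 + b)%R ->
     exists N, forall n s t, (N <= n)%nat ->
     (s0 <= s)%R -> (s + a / 2 ^ n <= s0 + a)%R ->
     (t0 <= t)%R -> (t + b / 2 ^ n <= t0 + b)%R ->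
     (s <= x <= s + a / 2 ^ n)%R -> (t <= y <= t + b / 2 ^ n)%R -> P n s t) ->
  P 0%nat s0 t0.
Proof.
intros Ha Hb Hq Hloc.
apply NNPP; intros H0.
set (bad := fun n (p : R * R) =>
  (s0 <= fst p)%R /\ (fst p + a / 2 ^ n <= s0 + a)%R /\
  (t0 <= snd p)%R /\ (snd p + b / 2 ^ n <= t0 + b)%R /\
  ~ P n (fst p) (snd p)).
assert (half : forall (c : R) n, (c / 2 ^ n = 2 * (c / 2 ^ S n))%R).
{ intros c n; cbn; field; apply pow_nonzero; lra. }
assert (pos : forall (c : R) n, (0 <= c)%R -> (0 <= c / 2 ^ n)%R).
{ intros c n Hc; apply Rmult_le_pos; [exact Hc|].
  apply Rlt_le, Rinv_0_lt_compat, pow_lt; lra. }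
assert (step : forall n p, bad n p -> exists q, bad (S n) q /\
  (fst p <= fst q <= fst p + a / 2 ^ S n)%R /\
  (snd p <= snd q <= snd p + b / 2 ^ S n)%R).
{ intros n [s t] (B1 & B2 & B3 & B4 & B5); unfold bad; cbn [fst snd] in *.
  assert (Ea := half a n); assert (Eb := half b n).
  assert (Pa := pos a (S n) Ha); assert (Pb := pos b (S n) Hb).
  set (u := (a / 2 ^ S n)%R) in *; set (w := (b / 2 ^ S n)%R) in *.
  apply NNPP; intros N; apply B5, Hq; try lra; fold u w; apply NNPP; intros Q;
    apply N.
  - exists (s, t); cbn [fst snd]; repeat split; try assumption; lra.
  - exists (s + u, t)%R; cbn [fst snd]; repeat split; try assumption; lra.
  - exists (s, t + w)%R; cbn [fst snd]; repeat split; try assumption; lra.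
  - exists (s + u, t + w)%R; cbn [fst snd]; repeat split; try assumption; lra. }
assert (start : bad 0%nat (s0, t0)).
{ unfold bad; cbn; repeat split; try assumption; lra. }
(* Dependent choice: a corner travels with the proof that it is bad, so that the recursion can
   select a bad quarter. *)
pose (next := fun n (p : {p | bad n p}) =>
  let c := constructive_indefinite_description _ (step n _ (proj2_sig p)) in
  exist (bad (S n)) (proj1_sig c) (proj1 (proj2_sig c))).
pose (sq := fix sq n : {p | bad n p} :=
  match n
    with O => exist (bad 0%nat) (s0, t0) start | S m => next m (sq m) end).
pose (x := fun n => fst (proj1_sig (sq n))).
pose (y := fun n => snd (proj1_sig (sq n))).
assert (Hbad : forall n, bad n (x n, y n)).
{ intros n; unfold x, y; rewrite <- surjective_pairing; apply proj2_sig. }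
assert (Hstep : forall n, (x n <= x (S n) <= x n + a / 2 ^ S n)%R /\
                          (y n <= y (S n) <= y n + b / 2 ^ S n)%R).
{ intros n; unfold x, y; cbn [sq]; unfold next; cbn [proj1_sig].
  exact (proj2 (proj2_sig (constructive_indefinite_description _
    (step n _ (proj2_sig (sq n)))))). }
(* Nested intervals in one dimension, applied to each coordinate: left ends increase, right ends
   decrease. *)
assert (lim : forall (c z0 : R) (z : nat -> R), (0 <= c)%R ->
  (forall n, (z0 <= z n)%R /\ (z n + c / 2 ^ n <= z0 + c)%R) ->
  (forall n, (z n <= z (S n) <= z n + c / 2 ^ S n)%R) ->
  exists l, (z0 <= l <= z0 + c)%R /\ forall n, (z n <= l <= z n + c / 2 ^ n)%R).
{ intros c z0 z Hc Hz Hs.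
  destruct (ex_finite_lim_seq_incr z (z0 + c)) as [l Hl].
  - intros n; apply Hs.
  - intros n; generalize (proj2 (Hz n)) (pos c n Hc); lra.
  - assert (M : forall n k, (z (n + k)%nat + c / 2 ^ (n + k) <=
      z n + c / 2 ^ n)%R).
    { intros n k; induction k as [|k IH].
      - rewrite Nat.add_0_r; lra.
      - rewrite Nat.add_succ_r.
        generalize (Hs (n + k)%nat) (half c (n + k)%nat); lra. }
    assert (U : forall n, (z n <= l <= z n + c / 2 ^ n)%R).
    { intros n; split.
      - apply (is_lim_seq_incr_compare z l Hl); intros; apply Hs.
      - apply (is_lim_seq_le_loc z (fun _ => (z n + c / 2 ^ n)%R) l (z n + c / 2 ^ n)%R);
          [| exact Hl | apply is_lim_seq_const].
        exists n; intros m Hm.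
        replace m with (n + (m - n))%nat by lia.
        generalize (M n (m - n)%nat) (pos c (n + (m - n))%nat Hc); lra. }
    exists l; split; [|exact U].
    generalize (U 0%nat) (Hz 0%nat); cbn; lra. }
destruct (lim a s0 x Ha) as [lx [Lx1 Lx2]].
{ intros n; destruct (Hbad n) as (B1 & B2 & _); cbn in B1, B2; lra. }
{ intros n; apply Hstep. }
destruct (lim b t0 y Hb) as [ly [Ly1 Ly2]].
{ intros n; destruct (Hbad n) as (_ & _ & B1 & B2 & _); cbn in B1, B2; lra. }
{ intros n; apply Hstep. }
destruct (Hloc lx ly Lx1 Ly1) as [N HN].
destruct (Hbad N) as (B1 & B2 & B3 & B4 & B5); apply B5.
apply HN; [apply le_n | assumption.. | apply Lx2 | apply Ly2].
Qed.

Lemma is_RCderive_affine (a c : C) (t : R) :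
  is_RCderive (fun x => a + RtoC x * c) t c.
Proof.
apply is_RCderive_pair; cbn; auto_derive; auto; ring.
Qed.

Lemma is_RCderive_scal_const (g : R -> C) (a : C) (s t : R) (l : C) :
  is_RCderive g t l ->
  is_RCderive (fun y => a + RtoC s * g y)%C t (RtoC s * l)%C.
Proof.
intros H; apply (is_RCderive_comp (f := fun z => a + RtoC s * z)); [|exact H].
apply is_Cderive_affine.
Qed.

Lemma is_RCderive_continuous (g : R -> C) (t : R) (l : C) :
  is_RCderive g t l -> Ccontinuous g t.
Proof.
intros H;
  exact (ex_derive_continuous (V := C_R_NormedModule) g t (ex_intro _ l H)).
Qed.

Definition path_int (f : C -> C) (c dc : R -> C) (a b : R) : C :=
  CRInt (fun t => f (c t) * dc t) a b.

Lemma ex_path_int (f : C -> C) (c dc : R -> C) (a b : R) :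
  (a <= b)%R ->
  (forall t, (a <= t <= b)%R -> Ccontinuous c t) ->
  (forall t, (a <= t <= b)%R -> Ccontinuous dc t) ->
  (forall t, (a <= t <= b)%R -> ex_Cderive f (c t)) ->
  ex_CRInt (fun t => f (c t) * dc t) a b.
Proof.
intros Hab Hc Hd Hf.
apply (ex_RInt_continuous (V := C_R_CompleteNormedModule)).
rewrite Rmin_left, Rmax_right by lra; intros t Ht.
apply Ccontinuous_mult; [apply Ccontinuous_comp|]; auto.
Qed.

Lemma is_path_int_primitive (F f : C -> C) (c dc : R -> C) (a b : R) :
  (a <= b)%R ->
  (forall t, (a <= t <= b)%R -> is_RCderive c t (dc t)) ->
  (forall t, (a <= t <= b)%R -> Ccontinuous dc t) ->
  (forall t, (a <= t <= b)%R -> ex_Cderive f (c t)) ->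
  (forall t, (a <= t <= b)%R -> is_Cderive F (c t) (f (c t))) ->
  is_CRInt (fun t => f (c t) * dc t) a b (F (c b) - F (c a)).
Proof.
intros Hab Hc Hd Hf HF.
apply (is_RInt_derive (V := C_R_CompleteNormedModule) (fun t => F (c t))).
- rewrite Rmin_left, Rmax_right by lra; intros t Ht.
  apply is_RCderive_comp; auto.
- rewrite Rmin_left, Rmax_right by lra; intros t Ht.
  apply Ccontinuous_mult; [apply Ccontinuous_comp|]; auto.
  eapply is_RCderive_continuous; eauto.
Qed.

(** The integral of [g] is the increment of its primitive, so only [f - g] is left to estimate. *)
Lemma path_int_approx (F g f : C -> C) (c dc : R -> C) (a b M K : R) :
  (a <= b)%R ->
  (forall t, (a <= t <= b)%R -> is_RCderive c t (dc t)) ->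
  (forall t, (a <= t <= b)%R -> Ccontinuous dc t) ->
  (forall t, (a <= t <= b)%R -> Cmod (dc t) <= K)%R ->
  (forall t, (a <= t <= b)%R -> ex_Cderive f (c t)) ->
  (forall z, ex_Cderive g z) -> (forall z, is_Cderive F z (g z)) ->
  (forall t, (a <= t <= b)%R -> Cmod (f (c t) - g (c t)) <= M)%R ->
  (Cmod (path_int f c dc a b - (F (c b) - F (c a))) <= (b - a) * (M * K))%R.
Proof.
intros Hab Hc Hd HK Hf Hg HF HM.
assert (I1 : is_CRInt (fun t => f (c t) * dc t) a b (path_int f c dc a b)).
{ apply (RInt_correct (V := C_R_CompleteNormedModule)).
  apply ex_path_int; auto; intros; eapply is_RCderive_continuous; eauto. }
assert (I2 := @is_path_int_primitive F g c dc a b Hab Hc Hd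
   (fun t _ => Hg (c t)) (fun t _ => HF (c t))).
assert (I := is_RInt_minus (V := C_R_NormedModule) _ _ _ _ _ _ I1 I2).
assert (N := fun H => norm_RInt_le_const (V :=
  C_R_NormedModule) _ a b _ (M * K)%R Hab H I).
rewrite Cnorm_Cmod in N; apply N.
intros t Ht; rewrite Cnorm_Cmod.
change (Cmod (f (c t) * dc t - g (c t) * dc t) <= M * K)%R.
replace (f (c t) * dc t - g (c t) * dc t)
  with ((f (c t) - g (c t)) * dc t) by ring.
rewrite Cmod_mult; apply Rmult_le_compat; auto using Cmod_ge_0.
Qed.

Lemma path_int_Chasles (f : C -> C) (c dc : R -> C) (a b d : R) :
  (a <= b <= d)%R ->
  (forall t, (a <= t <= d)%R -> Ccontinuous c t) ->
  (forall t, (a <= t <= d)%R -> Ccontinuous dc t) ->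
  (forall t, (a <= t <= d)%R -> ex_Cderive f (c t)) ->
  path_int f c dc a d = path_int f c dc a b + path_int f c dc b d.
Proof.
intros Habd Hc Hd Hf; symmetry.
apply (RInt_Chasles (V := C_R_CompleteNormedModule));
  apply ex_path_int; try lra; intros;
    [apply Hc | apply Hd | apply Hf | apply Hc | apply Hd | apply Hf]; lra.
Qed.

(** * Goursat's theorem *)

(** The increment is the integral of the velocity. The endpoints are unordered because later uses
    compare two arbitrary parameters. *)
Lemma Cmean_value (c dc : R -> C) (a b K : R) :
  (forall t, (Rmin a b <= t <= Rmax a b)%R -> is_RCderive c t (dc t)) ->
  (forall t, (Rmin a b <= t <= Rmax a b)%R -> Ccontinuous dc t) ->
  (forall t, (Rmin a b <= t <= Rmax a b)%R -> Cmod (dc t) <= K)%R ->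
  (Cmod (c b - c a)%C <= K * Rabs (b - a))%R.
Proof.
assert (W : forall x y, (x <= y)%R ->
  (forall t, (x <= t <= y)%R -> is_RCderive c t (dc t)) ->
  (forall t, (x <= t <= y)%R -> Ccontinuous dc t) ->
  (forall t, (x <= t <= y)%R -> Cmod (dc t) <= K)%R ->
  (Cmod (c y - c x)%C <= K * (y - x))%R).
{ intros x y Hxy H1 H2 H3.
  rewrite <- Cnorm_Cmod, Rmult_comm.
  apply (norm_RInt_le_const (V := C_R_NormedModule) dc x y); [exact Hxy | |].
  - intros t Ht; rewrite Cnorm_Cmod; now apply H3.
  - apply (is_RInt_derive (V := C_R_CompleteNormedModule) c);
      rewrite Rmin_left, Rmax_right by exact Hxy; assumption. }
intros H1 H2 H3; destruct (Rle_or_lt a b) as [Hab | Hab].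
- rewrite Rmin_left, Rmax_right in H1, H2, H3 by lra.
  rewrite Rabs_pos_eq by lra; auto.
- rewrite Rmin_right, Rmax_left in H1, H2, H3 by lra.
  replace (c b - c a) with (- (c a - c b)) by ring.
  rewrite Cmod_opp, Rabs_left1 by lra.
  replace (- (b - a))%R with (a - b)%R by ring; apply W; auto; lra.
Qed.

(** Integral of [f] along the boundary of the image of [[s, s'] * [t, t']] under
    [(x, y) |-> w + x v(y)]. *)
Definition cone_circuit (f : C -> C) (w : C) (v dv : R -> C)
    (s s' t t' : R) : C :=
  path_int f (fun x => w + RtoC x * v t) (fun _ => v t) s s'
  + path_int f (fun y => w + RtoC s' * v y) (fun y => RtoC s' * dv y) t t'
  - path_int f (fun x => w + RtoC x * v t') (fun _ => v t') s s'
  - path_int f (fun y => w + RtoC s * v y) (fun y => RtoC s * dv y) t t'.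

Section Goursat.

Variables (f : C -> C) (w : C) (v dv : R -> C) (s0 s1 t0 t1 : R).
Hypothesis Hs : (s0 <= s1)%R.
Hypothesis Ht : (t0 <= t1)%R.
Hypothesis v_derive : forall t, is_RCderive v t (dv t).
Hypothesis dv_continuous : forall t, Ccontinuous dv t.
Hypothesis f_derive : forall s t, (s0 <= s <= s1)%R -> (t0 <= t <= t1)%R ->
  ex_Cderive f (w + RtoC s * v t).

Let radial (t s : R) : Ccontinuous (fun x => w + RtoC x * v t) s.
Proof. exact (is_RCderive_continuous (is_RCderive_affine w (v t) s)). Qed.

Let lateral (s t : R) : Ccontinuous (fun y => w + RtoC s * v y) t.
Proof.
exact (is_RCderive_continuous (is_RCderive_scal_const w s (v_derive t))).
Qed.

Let lateral_velocity (s t : R) : Ccontinuous (fun y => RtoC s * dv y) t.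
Proof.
apply Ccontinuous_mult; [apply Ccontinuous_const | apply dv_continuous].
Qed.

Lemma cone_circuit_split_s (s s' s'' t t' : R) :
  (s0 <= s <= s')%R -> (s' <= s'' <= s1)%R -> (t0 <= t)%R -> (t <= t' <=
    t1)%R ->
  cone_circuit f w v dv s s'' t t' =
  cone_circuit f w v dv s s' t t' + cone_circuit f w v dv s' s'' t t'.
Proof.
intros I1 I2 I3 I4; unfold cone_circuit.
assert (E : forall u, (t0 <= u <= t1)%R ->
  path_int f (fun x => w + RtoC x * v u) (fun _ => v u) s s'' =
  path_int f (fun x => w + RtoC x * v u) (fun _ => v u) s s' +
  path_int f (fun x => w + RtoC x * v u) (fun _ => v u) s' s'').
{ intros u Hu; apply path_int_Chasles; [lra | | |].
  - intros; apply radial.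
  - intros; apply Ccontinuous_const.
  - intros; apply f_derive; lra. }
rewrite (E t), (E t') by lra; ring.
Qed.

Lemma cone_circuit_split_t (s s' t t' t'' : R) :
  (s0 <= s <= s')%R -> (s' <= s1)%R -> (t0 <= t <= t')%R -> (t' <= t'' <=
    t1)%R ->
  cone_circuit f w v dv s s' t t'' =
  cone_circuit f w v dv s s' t t' + cone_circuit f w v dv s s' t' t''.
Proof.
intros I1 I2 I3 I4; unfold cone_circuit.
assert (E : forall u, (s0 <= u <= s1)%R ->
  path_int f (fun y => w + RtoC u * v y) (fun y => RtoC u * dv y) t t'' =
  path_int f (fun y => w + RtoC u * v y) (fun y => RtoC u * dv y) t t' +
  path_int f (fun y => w + RtoC u * v y) (fun y => RtoC u * dv y) t' t'').
{ intros u Hu; apply path_int_Chasles; [lra | | |].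
  - intros; apply lateral.
  - intros; apply lateral_velocity.
  - intros; apply f_derive; lra. }
rewrite (E s), (E s') by lra; ring.
Qed.

(** [rho] bounds the diameter and half the perimeter of the image of a rectangle
    of sides [a] and [b]; the affine part of [f] has a primitive. *)
Lemma cone_circuit_small (x y s t a b S V D eta : R) (l : C) :
  (0 <= a)%R -> (0 <= b)%R -> (0 <= eta)%R ->
  (s0 <= s)%R -> (s + a <= s1)%R -> (t0 <= t)%R -> (t + b <= t1)%R ->
  (s <= x <= s + a)%R -> (t <= y <= t + b)%R ->
  (forall s, (s0 <= s <= s1)%R -> (Rabs s <= S)%R) ->
  (forall t, (t0 <= t <= t1)%R -> (Cmod (v t) <= V)%R) ->
  (forall t, (t0 <= t <= t1)%R -> (Cmod (dv t) <= D)%R) ->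
  let z0 := w + RtoC x * v y in
  let rho := (V * a + S * D * b)%R in
  (forall z, (Cmod (z - z0)%C <= rho)%R ->
     (Cmod (f z - f z0 - l * (z - z0))%C <= eta * Cmod (z - z0)%C)%R) ->
  (Cmod (cone_circuit f w v dv s (s + a) t (t + b)) <= 2 * eta * (rho * rho))%R.
Proof.
intros Ha Hb Heta I1 I2 I3 I4 Hx Hy HS HV HD z0 rho Hf.
assert (S0 : (0 <= S)%R).
{ eapply Rle_trans; [apply Rabs_pos | apply (HS s); lra]. }
assert (V0 : (0 <= V)%R).
{ eapply Rle_trans; [apply Cmod_ge_0 | apply (HV t); lra]. }
assert (D0 : (0 <= D)%R).
{ eapply Rle_trans; [apply Cmod_ge_0 | apply (HD t); lra]. }
assert (SD : (0 <= S * D)%R) by now apply Rmult_le_pos.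
assert (rho0 : (0 <= rho)%R).
{ unfold rho; apply Rplus_le_le_0_compat; now apply Rmult_le_pos. }
assert (near : forall s' t', (s <= s' <= s + a)%R -> (t <= t' <= t + b)%R ->
  (Cmod (w + RtoC s' * v t' - z0)%C <= rho)%R).
{ intros s' t' Hs' Ht'; unfold z0.
  (* A radial move costs at most [V * a], a lateral one at most [S * D * b]. *)
  replace (w + RtoC s' * v t' - (w + RtoC x * v y)) with
    (RtoC (s' - x) * v t' + RtoC x * (v t' - v y)) by (rewrite RtoC_minus;
      ring).
  eapply Rle_trans; [apply Cmod_triangle|].
  rewrite !Cmod_mult, !Cmod_R; unfold rho.
  apply Rplus_le_compat.
  - rewrite Rmult_comm; apply Rmult_le_compat; auto using Cmod_ge_0, Rabs_pos.
    + apply HV; lra.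
    + apply Rabs_le; lra.
  - rewrite Rmult_assoc; apply Rmult_le_compat; auto using Cmod_ge_0, Rabs_pos.
    { apply HS; lra. }
    apply Rle_trans with (D * Rabs (t' - y))%R.
    + apply Cmean_value with dv; auto.
      intros u Hu; apply HD; destruct Hu as [Hu1 Hu2]; split.
      * eapply Rle_trans; [|exact Hu1]; apply Rmin_glb; lra.
      * eapply Rle_trans; [exact Hu2|]; apply Rmax_lub; lra.
    + apply Rmult_le_compat_l; [exact D0|]; apply Rabs_le; lra. }
pose (g := fun z => f z0 + l * (z - z0)).
pose (G := fun z => f z0 * z + l * / 2 * ((z - z0) * (z - z0))).
assert (dsub : forall z, is_Cderive (fun z => z - z0) z (RtoC 1)).
{ intros z; apply is_Cderive_minus_const. }
assert (dg : forall z, ex_Cderive g z).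
{ intros z; eexists; apply is_Cderive_plus; [apply is_Cderive_const|].
  apply is_Cderive_mult; [apply is_Cderive_const | apply dsub]. }
assert (dG : forall z, is_Cderive G z (g z)).
{ intros z.
  assert (H := is_Cderive_plus
    (is_Cderive_mult (is_Cderive_const (f z0) z) (is_Cderive_id z))
    (is_Cderive_mult (is_Cderive_const (l * / 2) z)
       (is_Cderive_mult (dsub z) (dsub z)))).
  cbv beta in H.
  replace (g z)
    with (RtoC 0 * z + f z0 * RtoC 1 + (RtoC 0 * ((z - z0) * (z - z0)) +
    l * / 2 * (RtoC 1 * (z - z0) + (z - z0) * RtoC 1))); [exact H|].
  unfold g; field. }
assert (close : forall s' t', (s <= s' <= s + a)%R -> (t <= t' <= t + b)%R ->
  (Cmod (f (w + RtoC s' * v t') - g (w + RtoC s' * v t'))%C <= eta * rho)%R).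
{ intros s' t' Hs' Ht'; unfold g.
  replace (f (w + RtoC s' * v t') - (f z0 + l * (w + RtoC s' * v t' - z0)))
    with (f (w + RtoC s' * v t') - f z0 - l * (w + RtoC s' * v t' - z0)) by ring.
  eapply Rle_trans; [apply Hf, near; assumption|].
  apply Rmult_le_compat_l; [exact Heta | apply near; assumption]. }
assert (Rad : forall u, (t <= u <= t + b)%R ->
  (Cmod (path_int f (fun x => w + RtoC x * v u) (fun _ => v u) s (s + a)
     - (G (w + RtoC (s + a) * v u) - G (w + RtoC s * v u)))%C
   <= a * (eta * rho * V))%R).
{ intros u Hu.
  replace a with (s + a - s)%R at 3 by ring.
  apply (@path_int_approx G g f (fun x => w + RtoC x * v u) (fun _ => v u));
    auto; try lra.
  - intros; apply is_RCderive_affine.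
  - intros; apply Ccontinuous_const.
  - intros; apply HV; lra.
  - intros; apply f_derive; lra. }
assert (Lat : forall u, (s <= u <= s + a)%R ->
  (Cmod (path_int f (fun y => w + RtoC u * v y)
    (fun y => RtoC u * dv y) t (t + b)
     - (G (w + RtoC u * v (t + b)) - G (w + RtoC u * v t)))%C
   <= b * (eta * rho * (S * D)))%R).
{ intros u Hu.
  replace b with (t + b - t)%R at 3 by ring.
  apply (path_int_approx (F := G) (g := g) (c := fun y => w + RtoC u * v y));
    auto; try lra.
  - intros; apply is_RCderive_scal_const, v_derive.
  - intros; rewrite Cmod_mult, Cmod_R; apply Rmult_le_compat;
      auto using Cmod_ge_0, Rabs_pos; [apply HS | apply HD]; lra.
  - intros; apply f_derive; lra. }
assert (R1 := Rad t ltac:(lra)); assert (R2 := Rad (t + b)%R ltac:(lra)).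
assert (L1 := Lat s ltac:(lra)); assert (L2 := Lat (s + a)%R ltac:(lra)).
unfold cone_circuit.
match type of R1 with (Cmod (?p - _)%C <= _)%R => set (P1 := p) in * end.
match type of R2 with (Cmod (?p - _)%C <= _)%R => set (P2 := p) in * end.
match type of L1 with (Cmod (?p - _)%C <= _)%R => set (Q1 := p) in * end.
match type of L2 with (Cmod (?p - _)%C <= _)%R => set (Q2 := p) in * end.
set (G1 := G (w + RtoC s * v t)) in *.
set (G2 := G (w + RtoC (s + a) * v t)) in *.
set (G3 := G (w + RtoC s * v (t + b)%R)) in *.
set (G4 := G (w + RtoC (s + a) * v (t + b)%R)) in *.
(* The increments of the primitive [G] cancel around the circuit; four approximation errors
   remain. *)
replace (P1 + Q2 - P2 - Q1) with
  ((P1 - (G2 - G1)) + (Q2 - (G4 - G2)) + (- (P2 - (G4 - G3))) + (- (Q1 - (G3 - G1)))) by ring.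
eapply Rle_trans; [apply Cmod_triangle|].
eapply Rle_trans; [apply Rplus_le_compat_r, Cmod_triangle|].
eapply Rle_trans; [apply Rplus_le_compat_r, Rplus_le_compat_r, Cmod_triangle|].
rewrite !Cmod_opp.
replace (2 * eta * (rho * rho))%R with
 (2 * (a * (eta * rho * V)) + 2 * (b * (eta * rho * (S * D))))%R
 by (unfold rho; ring).
lra.
Qed.

Theorem cone_circuit_holomorphic : cone_circuit f w v dv s0 s1 t0 t1 = 0.
Proof.
destruct (bounded_continuity (V := C_R_NormedModule) v t0 t1) as [V HV].
{ intros t _; exact (is_RCderive_continuous (v_derive t)). }
destruct (bounded_continuity (V := C_R_NormedModule) dv t0 t1) as [D HD].
{ intros t _; apply dv_continuous. }
set (S := Rmax (Rabs s0) (Rabs s1)).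
assert (HS : forall s, (s0 <= s <= s1)%R -> (Rabs s <= S)%R).
{ intros s Hs'; apply RmaxAbs; apply Hs'. }
assert (S0 : (0 <= S)%R).
{ eapply Rle_trans; [apply Rabs_pos | apply (HS s0); lra]. }
assert (HV' : forall t, (t0 <= t <= t1)%R -> (Cmod (v t) <= V)%R).
{ intros t Ht'; rewrite <- Cnorm_Cmod; now apply Rlt_le, HV. }
assert (HD' : forall t, (t0 <= t <= t1)%R -> (Cmod (dv t) <= D)%R).
{ intros t Ht'; rewrite <- Cnorm_Cmod; now apply Rlt_le, HD. }
assert (V0 : (0 <= V)%R).
{ eapply Rle_trans; [apply Cmod_ge_0 | apply (HV' t0); lra]. }
assert (D0 : (0 <= D)%R).
{ eapply Rle_trans; [apply Cmod_ge_0 | apply (HD' t0); lra]. }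
set (rho := (V * (s1 - s0) + S * D * (t1 - t0))%R).
assert (rho0 : (0 <= rho)%R).
{ unfold rho; apply Rplus_le_le_0_compat; repeat apply Rmult_le_pos; lra. }
apply Cmod_eq_0, Rle_antisym; [|apply Cmod_ge_0].
apply le_epsilon; intros e He; rewrite Rplus_0_l.
cut (Cmod (cone_circuit f w v dv s0 (s0 + (s1 - s0) / 2 ^ 0) t0 (t0 + (t1 - t0) / 2 ^ 0))
  <= e / 4 ^ 0)%R.
{ cbn; replace (s0 + (s1 - s0) / 1)%R with s1 by field.
  replace (t0 + (t1 - t0) / 1)%R with t1 by field; lra. }
apply (rectangle_bisection (fun n s t =>
  (Cmod (cone_circuit f w v dv s (s + (s1 - s0) / 2 ^ n) t (t + (t1 - t0) / 2 ^ n))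
   <= e / 4 ^ n)%R) (a := (s1 - s0)%R) (b := (t1 - t0)%R)); try lra.
- intros n s t I1 I2 I3 I4 A1 A2 A3 A4.
  assert (Es : ((s1 - s0) / 2 ^ n = 2 * ((s1 - s0) / 2 ^ Datatypes.S n))%R).
  { cbn; field; apply pow_nonzero; lra. }
  assert (Et : ((t1 - t0) / 2 ^ n = 2 * ((t1 - t0) / 2 ^ Datatypes.S n))%R).
  { cbn; field; apply pow_nonzero; lra. }
  assert (Ee : (e / 4 ^ n = 4 * (e / 4 ^ Datatypes.S n))%R).
  { cbn; field; apply pow_nonzero; lra. }
  assert (Pa : (0 <= (s1 - s0) / 2 ^ Datatypes.S n)%R).
  { apply Rmult_le_pos; [lra|]; apply Rlt_le, Rinv_0_lt_compat, pow_lt; lra. }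
  assert (Pb : (0 <= (t1 - t0) / 2 ^ Datatypes.S n)%R).
  { apply Rmult_le_pos; [lra|]; apply Rlt_le, Rinv_0_lt_compat, pow_lt; lra. }
  rewrite Es, Et, Ee in *; clear Es Et Ee.
  set (a := ((s1 - s0) / 2 ^ Datatypes.S n)%R) in *.
  set (b := ((t1 - t0) / 2 ^ Datatypes.S n)%R) in *.
  set (e' := (e / 4 ^ Datatypes.S n)%R) in *.
  rewrite (@cone_circuit_split_s s (s + a) (s + 2 * a)) by lra.
  rewrite (@cone_circuit_split_t s (s + a) t (t + b) (t + 2 * b)) by lra.
  rewrite (@cone_circuit_split_t (s + a) (s + 2 * a) t (t + b)
    (t + 2 * b)) by lra.
  replace (s + 2 * a)%R with (s + a + a)%R by ring.
  replace (t + 2 * b)%R with (t + b + b)%R by ring.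
  eapply Rle_trans; [apply Cmod_triangle|].
  eapply Rle_trans; [apply Rplus_le_compat; apply Cmod_triangle|].
  lra.
- intros x y Hx Hy.
  destruct (f_derive (s := x) (t := y)) as [l Hl]; try lra.
  rewrite is_Cderive_iff in Hl.
  assert (He' : (0 < e / (2 * (rho * rho) + 1))%R).
  { apply Rdiv_lt_0_compat; nra. }
  (* Chosen so that [2 * eta * rho ^ 2 <= e]; the summand 1 covers [rho = 0]. *)
  set (eta := (e / (2 * (rho * rho) + 1))%R) in *.
  destruct (Hl eta He') as [d [Hd H]].
  destruct (pow_lt_1_zero (/ 2) ltac:(rewrite Rabs_pos_eq;
    lra) (d / (rho + 1))%R)
    as [N HN].
  { apply Rdiv_lt_0_compat; lra. }
  exists N; intros n s t Hn I1 I2 I3 I4 Hs' Ht'.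
  assert (P2 : (0 < 2 ^ n)%R) by (apply pow_lt; lra).
  assert (rhon : (V * ((s1 - s0) / 2 ^ n) + S * D * ((t1 - t0) / 2 ^ n) =
    rho / 2 ^ n)%R).
  { unfold rho; field; lra. }
  assert (small : (rho / 2 ^ n < d)%R).
  { specialize (HN n Hn).
    rewrite <- RPow_abs, Rabs_pos_eq, pow_inv in HN by lra.
    apply (Rmult_lt_compat_r (rho + 1)) in HN; [|lra].
    replace (d / (rho + 1) * (rho + 1))%R with d in HN by (field; lra).
    assert (0 < / 2 ^ n)%R by now apply Rinv_0_lt_compat.
    unfold Rdiv; nra. }
  eapply Rle_trans.
  + apply (@cone_circuit_small x y s t ((s1 - s0) / 2 ^ n) ((t1 - t0) / 2 ^ n)
      S V D eta l); auto; try lra.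
    rewrite rhon; intros z Hz; apply H; lra.
  + rewrite rhon.
    replace (4 ^ n)%R with (2 ^ n * 2 ^ n)%R
      by (rewrite <- Rpow_mult_distr; f_equal; ring).
    replace (2 * eta * (rho / 2 ^ n * (rho / 2 ^ n)))%R
      with (eta * (2 * (rho * rho)) / (2 ^ n * 2 ^ n))%R by (field; lra).
    apply Rmult_le_compat_r; [apply Rlt_le, Rinv_0_lt_compat; nra|].
    replace e with (eta * (2 * (rho * rho) + 1))%R by (unfold eta; field; nra).
    nra.
Qed.

End Goursat.

(** * Cauchy's formula *)

Lemma is_CRInt_mult_l (g : R -> C) (a b : R) (k l : C) :
  is_CRInt g a b l -> is_CRInt (fun t => k * g t) a b (k * l)%C.
Proof.
intros H.
assert (H1 := is_RInt_fct_extend_fst (U := R_NormedModule) (V :=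
  R_NormedModule) _ _ _ _ H).
assert (H2 := is_RInt_fct_extend_snd (U := R_NormedModule) (V :=
  R_NormedModule) _ _ _ _ H).
apply (is_RInt_fct_extend_pair (U := R_NormedModule) (V := R_NormedModule)).
- apply (is_RInt_minus (V := R_NormedModule));
    apply (is_RInt_scal (V := R_NormedModule)); assumption.
- apply (is_RInt_plus (V := R_NormedModule));
    apply (is_RInt_scal (V := R_NormedModule)); assumption.
Qed.

Lemma is_CRInt_ext (f g : R -> C) (a b : R) (l : C) :
  (a <= b)%R -> (forall t, (a < t < b)%R -> f t = g t) ->
  is_CRInt f a b l -> is_CRInt g a b l.
Proof.
intros Hab H; apply is_RInt_ext.
now rewrite Rmin_left, Rmax_right by exact Hab.
Qed.

Lemma is_CRInt_const (c : C) (a b : R) :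
  is_CRInt (fun _ => c) a b (RtoC (b - a) * c).
Proof.
rewrite <- scal_R_Cmult; exact (is_RInt_const (V := C_R_NormedModule) a b c).
Qed.

Lemma is_CRInt_unique (f : R -> C) (a b : R) (l : C) :
  is_CRInt f a b l -> CRInt f a b = l.
Proof. exact (is_RInt_unique (V := C_R_CompleteNormedModule) f a b l). Qed.

Lemma is_CRInt_uniq (f : R -> C) (a b : R) (l l' : C) :
  is_CRInt f a b l -> is_CRInt f a b l' -> l = l'.
Proof. intros H H';
  now rewrite <- (is_CRInt_unique H), (is_CRInt_unique H'). Qed.

Lemma CRInt_correct (f : R -> C) (a b : R) :
  ex_CRInt f a b -> is_CRInt f a b (CRInt f a b).
Proof. exact (RInt_correct (V := C_R_CompleteNormedModule) f a b). Qed.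

(** * The unit circle and loops around a centre *)

Definition eit (t : R) : C := (cos t, sin t).

Lemma Cmod_eit (t : R) : Cmod (eit t) = 1%R.
Proof.
unfold Cmod, eit; cbn [fst snd].
replace (cos t ^ 2 + sin t ^ 2)%R with 1%R; [apply sqrt_1|].
generalize (sin2_cos2 t); unfold Rsqr; lra.
Qed.

Lemma eit_neq0 (t : R) : eit t <> 0.
Proof. apply Cmod_gt_0; rewrite Cmod_eit; lra. Qed.

Lemma eit_plus (s t : R) : eit (s + t) = eit s * eit t.
Proof.
unfold eit; rewrite cos_plus, sin_plus.
apply injective_projections; cbn; ring.
Qed.

Lemma eit_2PI : eit (2 * PI) = eit 0.
Proof. unfold eit; now rewrite cos_2PI, sin_2PI, cos_0, sin_0. Qed.

Lemma eit_0 : eit 0 = 1.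
Proof. unfold eit; now rewrite cos_0, sin_0. Qed.

Lemma eit_opp (t : R) : eit t * eit (- t) = 1.
Proof. now rewrite <- eit_plus, Rplus_opp_r, eit_0. Qed.

Lemma is_RCderive_eit (t : R) : is_RCderive eit t (Ci * eit t)%C.
Proof. apply is_RCderive_pair; unfold eit; cbn; auto_derive; auto; ring. Qed.

Lemma Ccontinuous_eit (t : R) : Ccontinuous eit t.
Proof. exact (is_RCderive_continuous (is_RCderive_eit t)). Qed.

(** For a closed [v] the two radial sides of the circuit coincide and cancel. *)
Lemma cone_loop_homotopy (f : C -> C) (w : C) (v dv : R -> C)
  (s0 s1 t0 t1 : R) :
  (s0 <= s1)%R -> (t0 <= t1)%R ->
  (forall t, is_RCderive v t (dv t)) -> (forall t, Ccontinuous dv t) ->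
  v t1 = v t0 ->
  (forall s t, (s0 <= s <= s1)%R -> (t0 <= t <= t1)%R ->
     ex_Cderive f (w + RtoC s * v t)) ->
  path_int f (fun y => w + RtoC s1 * v y) (fun y => RtoC s1 * dv y) t0 t1 =
  path_int f (fun y => w + RtoC s0 * v y) (fun y => RtoC s0 * dv y) t0 t1.
Proof.
intros Hs Ht Hv Hdv E Hf.
assert (H := @cone_circuit_holomorphic f w v dv s0 s1 t0 t1 Hs Ht Hv Hdv Hf).
unfold cone_circuit in H; rewrite E in H.
apply Ceq_minus; rewrite <- H; ring.
Qed.

Lemma Cplus_neq0 (a b : C) : (Cmod a < Cmod b)%R -> a + b <> 0.
Proof.
intros H E.
assert (Ea : a = a + b - b) by ring.
rewrite E in Ea; rewrite Ea in H.
replace (0 - b) with (- b) in H by ring.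
rewrite Cmod_opp in H; lra.
Qed.

Lemma Cmod_circle (r t : R) : (0 <= r)%R -> Cmod (RtoC r * eit t) = r.
Proof.
intros Hr; rewrite Cmod_mult, Cmod_eit, Cmod_R, Rabs_pos_eq; lra.
Qed.

Lemma PI2_pos : (0 <= 2 * PI)%R.
Proof. generalize PI_RGT_0; lra. Qed.

(** Up to the factor [Ci] this is the integral of dz / (z + r) along z = A e^(-it). That function is
    holomorphic on the disk |z| <= |A|, so the loop can be contracted to [s = 0], where the velocity
    vanishes. *)
Lemma circle_kernel_zero (A : C) (r : R) :
  (Cmod A < r)%R ->
  is_CRInt (fun t => A / (A + RtoC r * eit t)) 0 (2 * PI) (RtoC 0).
Proof.
intros HA; assert (HA0 := Cmod_ge_0 A).
assert (Hr : Cmod (RtoC r) = r) by (rewrite Cmod_R, Rabs_pos_eq; lra).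
pose (v := fun t => A * eit (- t));
  pose (dv := fun t => A * (- Ci * eit (- t))).
assert (Hv : forall t, is_RCderive v t (dv t)).
{ intros t; apply is_RCderive_pair; unfold v, dv, eit, Ci; cbn; auto_derive;
    auto; ring. }
assert (Hdv : forall t, Ccontinuous dv t).
{ intros t; apply Ccontinuous_mult; [apply Ccontinuous_const|].
  apply Ccontinuous_mult; [apply Ccontinuous_const|].
  apply (is_RCderive_continuous (l := - Ci * eit (- t))).
  apply is_RCderive_pair; unfold eit, Ci; cbn; auto_derive; auto; ring. }
assert (nz : forall s t, (0 <= s <= 1)%R ->
  (RtoC 0 + RtoC s * v t) <> - RtoC r).
{ intros s t Hs E.
  assert (E2 : Cmod (RtoC 0 + RtoC s * v t) = r) by (rewrite E, Cmod_opp;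
    exact Hr).
  unfold v in E2;
    rewrite Cplus_0_l, !Cmod_mult, Cmod_eit, Cmod_R, Rabs_pos_eq in E2 by lra.
  nra. }
assert (H :=
  @cone_loop_homotopy (fun z => / (z - - RtoC r)) 0 v dv 0 1 0 (2 * PI)
  Rle_0_1 PI2_pos Hv Hdv).
assert (Hex : forall t, (0 <= t <= 2 * PI)%R ->
   ex_Cderive (fun z => / (z - - RtoC r)) (0 + RtoC 1 * v t)).
{ intros t _; apply ex_Cderive_inv_minus, nz; lra. }
assert (I : ex_CRInt (fun t => / (RtoC 0 + RtoC 1 * v t - - RtoC r) *
  (RtoC 1 * dv t)) 0 (2 * PI)).
{ apply (@ex_path_int (fun z => / (z - - RtoC r)) (fun y => 0 + RtoC 1 * v y)
    (fun y => RtoC 1 * dv y)); [exact PI2_pos | | | exact Hex].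
  - intros t _.
    exact (is_RCderive_continuous (is_RCderive_scal_const 0 1 (Hv t))).
  - intros t _; apply Ccontinuous_mult; [apply Ccontinuous_const | apply Hdv]. }
apply CRInt_correct in I; cbv beta in I.
unfold path_int in H; rewrite H in I; clear H.
- rewrite (is_CRInt_unique (l := RtoC 0)) in I.
  + apply is_CRInt_mult_l with (k := Ci) in I; rewrite Cmult_0_r in I.
    revert I; apply is_CRInt_ext; [exact PI2_pos|]; intros t _.
    assert (E := eit_opp t); unfold v, dv.
    assert (N := @eit_neq0 t).
    assert (E' : eit (- t) = / eit t).
    { rewrite <- (Cmult_1_l (eit (- t))), <- (Cinv_l (eit t)), <- Cmult_assoc,
        E by exact N; ring. }
    assert (N2 : A + RtoC r * eit t <> 0).
    { apply Cplus_neq0; rewrite Cmod_mult, Cmod_eit, Hr; lra. }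
    rewrite E'.
    replace (RtoC 0 + RtoC 1 * (A * / eit t) - - RtoC r)
      with ((A + RtoC r * eit t) / eit t) by (field; exact N).
    replace (Ci * (/ ((A + RtoC r * eit t) / eit t) * (RtoC 1 * (A * (- Ci * / eit t)))))
      with (- (Ci * Ci) * (A / (A + RtoC r * eit t))) by (field; split;
        assumption).
    replace (- (Ci * Ci)) with (RtoC 1)
      by (unfold Ci; apply injective_projections; cbn; ring).
    ring.
  + assert (Z := @is_CRInt_const 0 0 (2 * PI)); rewrite Cmult_0_r in Z.
    revert Z; apply is_CRInt_ext; [exact PI2_pos | intros; ring].
- unfold v; rewrite Ropp_0; f_equal.
  generalize (eit_opp (2 * PI)); rewrite eit_2PI, eit_0; intros E.
  now rewrite Cmult_1_l in E.
- intros s t Hs _; now apply ex_Cderive_inv_minus, nz.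
Qed.

(** The circle of radius [r] winds once around -A: the integrand is 1 minus the kernel of mean zero.
    The factor i of dz is left out. *)
Lemma circle_kernel (A : C) (r : R) :
  (Cmod A < r)%R ->
  is_CRInt (fun t => RtoC r * eit t / (A + RtoC r * eit t)) 0 (2 * PI)
    (RtoC (2 * PI)).
Proof.
intros HA; assert (HA0 := Cmod_ge_0 A).
assert (H := is_RInt_minus (V := C_R_NormedModule) _ _ _ _ _ _
  (@is_CRInt_const 1 0 (2 * PI)) (@circle_kernel_zero A r HA)).
replace (RtoC (2 * PI)) with
  (minus (G := C_R_NormedModule) (RtoC (2 * PI - 0) * 1) (RtoC 0)).
- revert H; apply is_CRInt_ext; [exact PI2_pos|]; intros t _.
  change (1 - A / (A + RtoC r * eit t) = RtoC r * eit t / (A + RtoC r * eit t)).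
  field; apply Cplus_neq0; rewrite Cmod_circle; lra.
- change (RtoC (2 * PI - 0) * 1 - 0 = RtoC (2 * PI)).
  rewrite Rminus_0_r; ring.
Qed.

Lemma Ccontinuous_locally (f : C -> C) (z : C) (e : R) :
  continuous (T := C_UniformSpace) (U := C_UniformSpace) f z -> (0 < e)%R ->
  exists d : R, (0 < d)%R /\
    forall y, (Cmod (y - z)%C < d)%R -> (Cmod (f y - f z)%C < e)%R.
Proof.
intros Hc He.
assert (H : Clocally z (fun y => (Cmod (f y - f z)%C < e)%R)).
{ apply (Hc (fun y => (Cmod (y - f z)%C < e)%R)).
  apply (proj2 (Clocally_iff (f z) (fun y => (Cmod (y - f z)%C < e)%R))).
  exists e; auto. }
exact (proj1 (Clocally_iff _ _) H).
Qed.

Lemma Cmod_CRInt_le (f : R -> C) (a b M : R) (l : C) :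
  (a <= b)%R -> (forall t, (a <= t <= b)%R -> (Cmod (f t) <= M)%R) ->
  is_CRInt f a b l -> (Cmod l <= (b - a) * M)%R.
Proof.
intros Hab H Hl; rewrite <- Cnorm_Cmod.
apply (norm_RInt_le_const (V := C_R_NormedModule) f a b);
  [exact Hab | | exact Hl].
intros t Ht; rewrite Cnorm_Cmod; now apply H.
Qed.

Lemma is_CRInt_minus (f g : R -> C) (a b : R) (k l : C) :
  is_CRInt f a b k -> is_CRInt g a b l ->
  is_CRInt (fun t => f t - g t) a b (k - l)%C.
Proof. exact (is_RInt_minus (V := C_R_NormedModule) f g a b k l). Qed.

Lemma is_CRInt_plus (f g : R -> C) (a b : R) (k l : C) :
  is_CRInt f a b k -> is_CRInt g a b l ->
  is_CRInt (fun t => f t + g t) a b (k + l)%C.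
Proof. exact (is_RInt_plus (V := C_R_NormedModule) f g a b k l). Qed.

Lemma ex_CRInt_continuous (f : R -> C) (a b : R) :
  (a <= b)%R -> (forall t, (a <= t <= b)%R -> Ccontinuous f t) ->
    ex_CRInt f a b.
Proof.
intros Hab H; apply (ex_RInt_continuous (V := C_R_CompleteNormedModule)).
now rewrite Rmin_left, Rmax_right by exact Hab.
Qed.

Lemma Ccontinuous_div (T : UniformSpace) (f g : T -> C) (x : T) :
  Ccontinuous f x -> Ccontinuous g x -> g x <> 0 ->
  Ccontinuous (fun t => f t / g t) x.
Proof.
intros Hf Hg N; apply Ccontinuous_mult; [exact Hf|].
apply Ccontinuous_comp; [exact Hg|]; eexists; now apply is_Cderive_inv.
Qed.

Lemma Ccontinuous_circle (A : C) (r t : R) :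
  Ccontinuous (fun t => A + RtoC r * eit t) t.
Proof.
apply Ccontinuous_plus; [apply Ccontinuous_const|].
apply Ccontinuous_mult; [apply Ccontinuous_const | apply Ccontinuous_eit].
Qed.

Lemma Ccontinuous_pow (T : UniformSpace) (f : T -> C) (x : T) (n : nat) :
  Ccontinuous f x -> Ccontinuous (fun t => f t ^ n) x.
Proof.
intros H; induction n as [|n IH]; cbn.
- apply Ccontinuous_const.
- now apply Ccontinuous_mult.
Qed.

Lemma Cmod_kernel_lower (A : C) (r t : R) :
  (0 <= r)%R -> (r - Cmod A <= Cmod (A + RtoC r * eit t))%R.
Proof.
intros Hr; assert (H := Cmod_triangle (A + RtoC r * eit t) (- A)).
replace (A + RtoC r * eit t + - A) with (RtoC r * eit t) in H by ring.
rewrite Cmod_opp, Cmod_circle in H by exact Hr; lra.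
Qed.

(** Contracting the circle towards [w] by the homotheties of centre [w] does not
    change the integral of [f z / (z - w)], which tends to [2 pi i f(w)]. *)
Theorem cauchy_formula (f : C -> C) (c : C) (r : R) (w : C) :
  (forall z, (Cmod (z - c) <= r)%R -> ex_Cderive f z) ->
  (Cmod (w - c) < r)%R ->
  is_CRInt (fun t => f (c + RtoC r * eit t) *
     (RtoC r * eit t / (c - w + RtoC r * eit t))) 0 (2 * PI)
     (RtoC (2 * PI) * f w)%C.
Proof.
intros Hf Hw.
set (A := c - w).
assert (HA : (Cmod A < r)%R).
{ unfold A; now rewrite <- Copp_minus_distr, Cmod_opp. }
assert (HA0 := Cmod_ge_0 A).
(* The circle as seen from [w]: w + v(t) = c + r e^(it). *)
pose (v := fun t => A + RtoC r * eit t).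
pose (dv := fun t => RtoC r * (Ci * eit t)).
assert (v_derive : forall t, is_RCderive v t (dv t)).
{ intros t; apply is_RCderive_scal_const, is_RCderive_eit. }
assert (dv_cont : forall t, Ccontinuous dv t).
{ intros t; apply Ccontinuous_mult; [apply Ccontinuous_const|].
  apply Ccontinuous_mult; [apply Ccontinuous_const | apply Ccontinuous_eit]. }
assert (v_low : forall t, (r - Cmod A <= Cmod (v t))%R).
{ intros t; apply Cmod_kernel_lower; lra. }
assert (v_nz : forall t, v t <> 0).
{ intros t; apply Cmod_gt_0; generalize (v_low t); lra. }
assert (v_up : forall t, (Cmod (v t) <= 2 * r)%R).
{ intros t; eapply Rle_trans; [apply Cmod_triangle|].
  rewrite Cmod_circle by lra; lra. }
assert (disk : forall s t, (0 <= s <= 1)%R -> ex_Cderive f (w + RtoC s * v t)).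
{ intros s t Hs; apply Hf; unfold v, A.
  replace (w + RtoC s * (c - w + RtoC r * eit t) - c)
    with (RtoC (1 - s) * (w - c) + RtoC s * (RtoC r * eit t))
    by (rewrite RtoC_minus; ring).
  eapply Rle_trans; [apply Cmod_triangle|].
  rewrite !Cmod_mult, Cmod_eit, !Cmod_R, !Rabs_pos_eq by lra.
  nra. }
pose (k := fun t => RtoC r * eit t / v t).
assert (k_cont : forall t, Ccontinuous k t).
{ intros t; apply Ccontinuous_div; [| apply Ccontinuous_circle | apply v_nz].
  apply Ccontinuous_mult; [apply Ccontinuous_const | apply Ccontinuous_eit]. }
assert (J_ex : forall s, (0 <= s <= 1)%R ->
  ex_CRInt (fun t => f (w + RtoC s * v t) * k t) 0 (2 * PI)).
{ intros s Hs; apply ex_CRInt_continuous; [exact PI2_pos|]; intros t _.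
  apply Ccontinuous_mult; [|apply k_cont].
  apply Ccontinuous_comp; [|now apply disk].
  exact (is_RCderive_continuous (is_RCderive_scal_const w s (v_derive t))). }
pose (J := fun s => CRInt (fun t => f (w + RtoC s * v t) * k t) 0 (2 * PI)).
assert (JI : forall s, (0 <= s <= 1)%R ->
  is_CRInt (fun t => f (w + RtoC s * v t) * k t) 0 (2 * PI) (J s)).
{ intros s Hs; apply CRInt_correct; auto. }
(* Along z = w + s v(t) the factor [s] cancels in dz / (z - w), which is i k(t) dt for every [s]. *)
assert (L : forall s, (0 < s <= 1)%R ->
  path_int (fun z => f z * / (z - w)) (fun y => w + RtoC s * v y)
    (fun y => RtoC s * dv y) 0 (2 * PI) = Ci * J s).
{ intros s Hs; unfold path_int; apply is_CRInt_unique.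
  apply is_CRInt_ext with (fun t => Ci * (f (w + RtoC s * v t) * k t));
    [exact PI2_pos | | apply is_CRInt_mult_l, JI; lra].
  intros t _; unfold k, dv.
  assert (N : RtoC s <> 0) by (intros E; apply RtoC_inj in E; lra).
  assert (N' := v_nz t).
  replace (w + RtoC s * v t - w) with (RtoC s * v t) by ring.
  field; split; assumption. }
assert (J_const : forall s, (0 < s <= 1)%R -> J 1%R = J s).
{ intros s Hs.
  assert (E : Ci * J 1%R = Ci * J s).
  { rewrite <- !L by lra; apply cone_loop_homotopy; auto using PI2_pos; try lra.
    - unfold v; now rewrite eit_2PI.
    - intros x t Hx _; apply ex_Cderive_mult; [apply disk; lra|].
      apply ex_Cderive_inv_minus; intros E.
      assert (N : RtoC x <> 0) by (intros E'; apply RtoC_inj in E'; lra).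
      apply (Cmult_neq_0 _ _ N (v_nz t)).
      replace (RtoC x * v t) with (w + RtoC x * v t - w) by ring.
      rewrite E; ring. }
  apply (f_equal (Cmult (/ Ci))) in E.
  rewrite !Cmult_assoc, Cinv_l, !Cmult_1_l in E by apply Ci_nz; exact E. }
assert (J1 : J 1%R = RtoC (2 * PI) * f w).
{ apply Ceq_minus, Cmod_eq_0, Rle_antisym; [|apply Cmod_ge_0].
  apply le_epsilon; intros e He; rewrite Rplus_0_l.
  assert (Hpi := PI_RGT_0).
  set (m := (r - Cmod A)%R) in *; assert (Hm : (0 < m)%R) by (unfold m; lra).
  (* The kernel [k] is at most [r / m] and the interval has length [2 * PI], so this oscillation of
     [f] yields [e]. *)
  assert (He' : (0 < e * m / (2 * PI * r))%R).
  { apply Rdiv_lt_0_compat; apply Rmult_lt_0_compat; lra. }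
  assert (Cw : exists d : R, (0 < d)%R /\ forall y, (Cmod (y - w)%C < d)%R ->
     (Cmod (f y - f w)%C < e * m / (2 * PI * r))%R).
  { apply Ccontinuous_locally; [|exact He'].
    apply ex_Cderive_continuous, Hf; lra. }
  destruct Cw as [d [Hd Hc]].
  set (s := Rmin 1 (d / (2 * r + 1))).
  assert (Hs : (0 < s <= 1)%R).
  { split; [|apply Rmin_l]; apply Rmin_glb_lt; [lra|].
    apply Rdiv_lt_0_compat; lra. }
  assert (Hsd : (s * (2 * r) < d)%R).
  { assert (s * (2 * r + 1) <= d)%R; [|lra].
    replace d with (d / (2 * r + 1) * (2 * r + 1))%R by (field; lra).
    apply Rmult_le_compat_r; [lra | apply Rmin_r]. }
  rewrite (J_const s Hs).
  assert (I1 := JI s ltac:(lra)).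
  assert (I2 := @is_CRInt_mult_l _ _ _ (f w) _ (@circle_kernel A r HA)).
  assert (I := is_CRInt_minus I1 I2).
  rewrite (Cmult_comm (RtoC (2 * PI))).
  apply Cmod_CRInt_le with (M := (e / (2 * PI))%R) in I; [| exact PI2_pos |].
  - eapply Rle_trans; [exact I|]; right; field; lra.
  - intros t _; fold (v t); fold (k t).
    replace (f (w + RtoC s * v t) * k t - f w * k t)
      with ((f (w + RtoC s * v t) - f w) * k t) by ring.
    rewrite Cmod_mult; unfold k.
    rewrite Cmod_div, Cmod_circle by (auto; lra).
    apply Rle_trans with (e * m / (2 * PI * r) * (r / m))%R.
    + apply Rmult_le_compat.
      * apply Cmod_ge_0.
      * apply Rmult_le_pos; [lra|]; apply Rlt_le, Rinv_0_lt_compat.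
        now apply Cmod_gt_0.
      * apply Rlt_le, Hc.
        replace (w + RtoC s * v t - w) with (RtoC s * v t) by ring.
        rewrite Cmod_mult, Cmod_R, Rabs_pos_eq by lra.
        apply Rle_lt_trans with (2 := Hsd).
        apply Rmult_le_compat_l; [lra | apply v_up].
      * apply Rmult_le_compat_l; [lra|].
        apply Rinv_le_contravar; [exact Hm | apply v_low].
    + right; field; repeat split; lra. }
rewrite <- J1.
generalize (JI 1%R ltac:(lra)); apply is_CRInt_ext; [exact PI2_pos|].
intros t _; unfold k, v, A; do 2 f_equal; ring.
Qed.

(** * Taylor expansions *)

Lemma pow_n_Cpow (x : C) (n : nat) : pow_n (K := C_Ring) x n = x ^ n.
Proof. induction n as [|n IH]; [reflexivity|]; cbn; now rewrite IH. Qed.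

(** The partial sum of [n] terms, indices 0 to n - 1, in Horner form. Shifting the coefficients is
    also the recursion of Taylor remainders and of principal parts. *)
Fixpoint Cpoly (a : nat -> C) (n : nat) (x : C) : C :=
  match n with
  | O => 0
  | S m => a O + x * Cpoly (fun j => a (S j)) m x
  end.

Lemma Cpoly_S_last (n : nat) (a : nat -> C) (x : C) :
  Cpoly a (S n) x = Cpoly a n x + x ^ n * a n.
Proof.
revert a; induction n as [|n IH]; intros a; [cbn; ring|].
change (a O + x * Cpoly (fun j => a (S j)) (S n) x =
  a O + x * Cpoly (fun j => a (S j)) n x + x ^ S n * a (S n)).
rewrite IH; cbn [Cpow]; ring.
Qed.

Lemma is_Cpseries_iff (a : nat -> C) (x l : C) :
  is_Cpseries a x l <->
  forall e : R, (0 < e)%R ->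
    exists N, forall n, (N <= n)%nat -> (Cmod (Cpoly a n x - l)%C < e)%R.
Proof.
assert (E : forall n, sum_n (G := C_NormedModule)
  (fun k => scal (pow_n (K := C_AbsRing) x k) (a k)) n = Cpoly a (S n) x).
{ intros n; induction n as [|n IH].
  - rewrite sum_O; cbn; unfold scal; cbn; unfold one; cbn; unfold mult; cbn;
      ring.
  - rewrite sum_Sn, IH, (Cpoly_S_last (S n)).
    change (pow_n (K := C_AbsRing) x (S n)) with (pow_n (K := C_Ring) x (S n)).
    now rewrite pow_n_Cpow. }
unfold is_pseries, is_series; split.
- intros H e He.
  assert (HP : Clocally l (fun y => (Cmod (y - l)%C < e)%R)).
  { apply Clocally_iff; exists e; auto. }
  destruct (H _ HP) as [N HN]; exists (S N); intros n Hn.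
  destruct n as [|n]; [lia|].
  rewrite <- E; apply HN; lia.
- intros H P HP; apply (proj1 (Clocally_iff l P)) in HP.
  destruct HP as [e [He HP]]; destruct (H e He) as [N HN].
  exists N; intros n Hn; apply HP; rewrite E; apply HN; lia.
Qed.

(** Cauchy's integral of f(zeta) / (zeta - c)^(n+1), divided by 2 pi i; dzeta = i (zeta - c) dt
    absorbs i and one power. *)
Definition taylor_coef (f : C -> C) (c : C) (r : R) (n : nat) : C :=
  RtoC (/ (2 * PI)) * CRInt (fun t => f (c + RtoC r * eit t) *
    / (RtoC r * eit t) ^ n) 0 (2 * PI).

(** The Taylor remainder of order [n] divided by (z - c)^n: the integral of f(zeta) / ((zeta - c)^n
    (zeta - z)), divided by 2 pi i. *)
Definition taylor_rem (f : C -> C) (c : C) (r : R) (n : nat) (z : C) : C :=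
  RtoC (/ (2 * PI)) * CRInt (fun t => f (c + RtoC r * eit t) *
    / (RtoC r * eit t) ^ n *
    (RtoC r * eit t / (c - z + RtoC r * eit t))) 0 (2 * PI).

Section Taylor.

Variables (f : C -> C) (c : C) (r : R).
Hypothesis Hr : (0 < r)%R.
Hypothesis Hf : forall z, (Cmod (z - c) <= r)%R -> ex_Cderive f z.

Let circle_nz (t : R) : RtoC r * eit t <> 0.
Proof. apply Cmod_gt_0; rewrite Cmod_circle; lra. Qed.

Let kernel_nz (z : C) (t : R) :
  (Cmod (z - c) < r)%R -> c - z + RtoC r * eit t <> 0.
Proof.
intros Hz; apply Cplus_neq0.
rewrite <- Copp_minus_distr, Cmod_opp, Cmod_circle; lra.
Qed.

Let coef_continuous (n : nat) (t : R) :
  Ccontinuous (fun t => f (c + RtoC r * eit t) * / (RtoC r * eit t) ^ n) t.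
Proof.
apply (Ccontinuous_div (f := fun t => f (c + RtoC r * eit t))).
- apply Ccontinuous_comp; [apply Ccontinuous_circle | apply Hf].
  replace (c + RtoC r * eit t - c) with (RtoC r * eit t) by ring.
  rewrite Cmod_circle; lra.
- apply Ccontinuous_pow, Ccontinuous_mult;
    [apply Ccontinuous_const | apply Ccontinuous_eit].
- apply Cpow_nz, circle_nz.
Qed.

Let is_coef (n : nat) : is_CRInt (fun t => f (c + RtoC r * eit t) *
    / (RtoC r * eit t) ^ n) 0 (2 * PI) (RtoC (2 * PI) * taylor_coef f c r n)%C.
Proof.
unfold taylor_coef; rewrite Cmult_assoc, <- RtoC_mult, Rinv_r, Cmult_1_l
  by (generalize PI_RGT_0; lra).
apply CRInt_correct, ex_CRInt_continuous; [apply PI2_pos | auto].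
Qed.

Let is_rem (n : nat) (z : C) : (Cmod (z - c) < r)%R ->
  is_CRInt (fun t => f (c + RtoC r * eit t) *
    / (RtoC r * eit t) ^ n *
    (RtoC r * eit t / (c - z + RtoC r * eit t))) 0 (2 * PI)
  (RtoC (2 * PI) * taylor_rem f c r n z)%C.
Proof.
intros Hz; unfold taylor_rem;
  rewrite Cmult_assoc, <- RtoC_mult, Rinv_r, Cmult_1_l
  by (generalize PI_RGT_0; lra).
apply CRInt_correct, ex_CRInt_continuous; [apply PI2_pos |]; intros t _.
apply Ccontinuous_mult; [apply coef_continuous|].
apply Ccontinuous_div; [| apply Ccontinuous_circle | now apply kernel_nz].
apply Ccontinuous_mult; [apply Ccontinuous_const | apply Ccontinuous_eit].
Qed.

Let mult_2PI_inj (a b : C) : RtoC (2 * PI) * a = RtoC (2 * PI) * b -> a = b.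
Proof.
intros E; apply (f_equal (Cmult (RtoC (/ (2 * PI))))) in E.
rewrite !Cmult_assoc, <- RtoC_mult, Rinv_l, !Cmult_1_l in E
  by (generalize PI_RGT_0; lra).
exact E.
Qed.

Lemma taylor_rem_0 (z : C) : (Cmod (z - c) < r)%R -> taylor_rem f c r 0 z = f z.
Proof.
intros Hz; apply mult_2PI_inj, (is_CRInt_uniq (@is_rem 0%nat z Hz)).
generalize (@cauchy_formula f c r z Hf Hz); apply is_CRInt_ext;
  [apply PI2_pos|].
intros t _; cbn [Cpow]; field; now apply kernel_nz.
Qed.

(** One step of the geometric series: with u = r e^(it) and x = z - c, u / (u - x) = 1 + (x / u) (u
    / (u - x)), integrated against f / u^n. *)
Lemma taylor_rem_S (n : nat) (z : C) : (Cmod (z - c) < r)%R ->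
  taylor_rem f c r n z =
    taylor_coef f c r n + (z - c) * taylor_rem f c r (S n) z.
Proof.
intros Hz; apply mult_2PI_inj, (is_CRInt_uniq (@is_rem n z Hz)).
replace (RtoC (2 * PI) * (taylor_coef f c r n + (z - c) * taylor_rem f c r (S n) z))
  with (RtoC (2 * PI) * taylor_coef f c r n +
        (z - c) * (RtoC (2 * PI) * taylor_rem f c r (S n) z)) by ring.
assert (H := is_CRInt_plus (@is_coef n)
  (@is_CRInt_mult_l _ _ _ (z - c) _ (@is_rem (S n) z Hz))).
revert H; apply is_CRInt_ext; [apply PI2_pos|]; intros t _.
assert (N1 := circle_nz (t := t)); assert (N2 := @kernel_nz z t Hz).
assert (N3 := Cpow_nz _ n N1).
set (u := RtoC r * eit t) in *; clearbody u.
cbn [Cpow]; field; repeat split; assumption.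
Qed.

Lemma taylor_rem_bound : exists M : R, (0 <= M)%R /\
  forall n z, (Cmod (z - c) <= r / 2)%R ->
    (Cmod (taylor_rem f c r n z) <= M / r ^ n)%R.
Proof.
destruct (bounded_continuity (V := C_R_NormedModule)
  (fun t => f (c + RtoC r * eit t)) 0 (2 * PI)) as [M HM].
{ intros t _; apply Ccontinuous_comp; [apply Ccontinuous_circle | apply Hf].
  replace (c + RtoC r * eit t - c) with (RtoC r * eit t) by ring.
  rewrite Cmod_circle; lra. }
assert (HM' : forall t, (0 <= t <= 2 * PI)%R ->
  (Cmod (f (c + RtoC r * eit t)) <= M)%R).
{ intros t Ht; rewrite <- Cnorm_Cmod; now apply Rlt_le, HM. }
assert (M0 : (0 <= M)%R).
{ eapply Rle_trans; [apply Cmod_ge_0 | apply (HM' 0%R)].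
  generalize PI2_pos; lra. }
(* On the half disk |zeta - z| >= r / 2, so the kernel is at most 2. *)
exists (2 * M)%R; split; [lra|]; intros n z Hz.
assert (rn : (0 < r ^ n)%R) by now apply pow_lt.
assert (Hpi := PI_RGT_0).
assert (Hz' : (Cmod (z - c) < r)%R) by lra.
assert (H := fun B => @Cmod_CRInt_le _ 0 (2 * PI) (2 * M / r ^ n)%R _ PI2_pos B
  (@is_rem n z Hz')).
rewrite Cmod_mult, Cmod_R, Rabs_pos_eq, Rminus_0_r in H by lra.
apply Rmult_le_reg_l with (2 * PI)%R; [lra|]; apply H.
intros t Ht.
rewrite !Cmod_mult, Cmod_inv, Cmod_pow, Cmod_div by
  (try apply Cpow_nz; auto; now apply kernel_nz).
rewrite Cmod_circle by lra.
assert (L := Cmod_kernel_lower (c - z) (r := r) t (Rlt_le _ _ Hr)).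
rewrite <- (Copp_minus_distr z c), Cmod_opp in L.
rewrite <- (Copp_minus_distr z c).
replace (2 * M / r ^ n)%R with (M * / r ^ n * (r / (r / 2)))%R by (field; lra).
assert (0 < / r ^ n)%R by now apply Rinv_0_lt_compat.
apply Rmult_le_compat.
- apply Rmult_le_pos; [apply Cmod_ge_0 | lra].
- apply Rmult_le_pos; [lra|]; apply Rlt_le, Rinv_0_lt_compat; lra.
- apply Rmult_le_compat_r; [lra | now apply HM'].
- apply Rmult_le_compat_l; [lra|]; apply Rinv_le_contravar; lra.
Qed.

Lemma taylor_rem_Cpoly (n k : nat) (z : C) : (Cmod (z - c) < r)%R ->
  taylor_rem f c r k z =
  Cpoly (fun j => taylor_coef f c r (k + j)) n (z - c)
  + (z - c) ^ n * taylor_rem f c r (k + n) z.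
Proof.
intros Hz; revert k; induction n as [|n IH]; intros k.
- cbn; rewrite Nat.add_0_r; ring.
- rewrite taylor_rem_S, (IH (S k)) by exact Hz; cbn [Cpoly Cpow].
  rewrite Nat.add_0_r, <- Nat.add_succ_comm.
  replace (Cpoly (fun j => taylor_coef f c r (S k + j)) n (z - c))
    with (Cpoly (fun j => taylor_coef f c r (k + S j)) n (z - c)); [ring|].
  f_equal; apply functional_extensionality.
  intros j; f_equal; lia.
Qed.

Lemma taylor_pseries (z : C) : (Cmod (z - c) <= r / 2)%R ->
  is_Cpseries (taylor_coef f c r) (z - c) (f z).
Proof.
intros Hz; apply is_Cpseries_iff; intros e He.
destruct taylor_rem_bound as [M [M0 HM]].
destruct (pow_lt_1_zero (/ 2) ltac:(rewrite Rabs_pos_eq; lra) (e / (M + 1))%R)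
  as [N HN]; [apply Rdiv_lt_0_compat; lra|].
exists N; intros n Hn; specialize (HN n Hn).
assert (Hz' : (Cmod (z - c) < r)%R) by lra.
rewrite <- (taylor_rem_0 z Hz'), (@taylor_rem_Cpoly n 0 z Hz').
cbn [Nat.add].
replace (Cpoly (taylor_coef f c r) n (z - c) -
   (Cpoly (fun j => taylor_coef f c r j) n (z - c) + (z - c) ^ n * taylor_rem f c r n z))
  with (- ((z - c) ^ n * taylor_rem f c r n z)).
2:{ change (fun j => taylor_coef f c r j) with (taylor_coef f c r); ring. }
rewrite Cmod_opp, Cmod_mult, Cmod_pow.
assert (0 < r ^ n)%R by now apply pow_lt.
assert (P2 : (0 < (/ 2) ^ n)%R) by (apply pow_lt; lra).
rewrite Rabs_pos_eq in HN by lra.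
apply Rle_lt_trans with ((r / 2) ^ n * (M / r ^ n))%R.
- apply Rmult_le_compat; auto using Cmod_ge_0, pow_le.
  apply pow_incr; auto using Cmod_ge_0.
- unfold Rdiv at 1; rewrite Rpow_mult_distr.
  replace (r ^ n * (/ 2) ^ n * (M / r ^ n))%R with ((/ 2) ^ n * M)%R
    by (field; lra).
  apply Rmult_lt_compat_r with (r := (M + 1)%R) in HN; [|lra].
  replace (e / (M + 1) * (M + 1))%R with e in HN by (field; lra).
  lra.
Qed.

(** Two steps of the recursion leave an error (z - c)^2 times a bounded remainder, so nothing has to
    be differentiated under the integral sign. *)
Lemma taylor_rem_derive (n : nat) :
  is_Cderive (taylor_rem f c r n) c (taylor_coef f c r (S n)).
Proof.
apply is_Cderive_iff; intros e He.
destruct taylor_rem_bound as [M [M0 HM]].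
assert (K0 : (0 <= M / r ^ S (S n))%R).
{ apply Rmult_le_pos; [lra|]; now apply Rlt_le, Rinv_0_lt_compat, pow_lt. }
specialize (HM (S (S n))); set (K := (M / r ^ S (S n))%R) in *.
exists (Rmin (r / 2) (e / (K + 1))); split.
{ apply Rmin_glb_lt; [|apply Rdiv_lt_0_compat]; lra. }
intros z Hz.
assert (L1 := Rlt_le_trans _ _ _ Hz (Rmin_l _ _)).
assert (L2 := Rlt_le_trans _ _ _ Hz (Rmin_r _ _)).
assert (Hc : (Cmod (c - c) < r)%R).
{ replace (c - c) with (RtoC 0) by ring; now rewrite Cmod_0. }
rewrite (@taylor_rem_S n c Hc), (@taylor_rem_S n z),
  (@taylor_rem_S (S n) z) by lra.
replace (_ - _ - _)
  with ((z - c) * ((z - c) * taylor_rem f c r (S (S n)) z)) by ring.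
rewrite !Cmod_mult, Rmult_comm.
assert (Hm := Cmod_ge_0 (z - c)).
apply Rmult_le_compat_r; [exact Hm|].
apply Rle_trans with (Cmod (z - c) * K)%R.
- apply Rmult_le_compat_l; [exact Hm | apply HM; lra].
- apply Rmult_lt_compat_r with (r := (K + 1)%R) in L2; [|lra].
  replace (e / (K + 1) * (K + 1))%R with e in L2 by (field; lra).
  lra.
Qed.

End Taylor.

(** The same coefficients serve the series, which determines the residue, and the finite expansions,
    which determine the principal part. *)
Lemma holomorphic_at_taylor (g : C -> C) (p : C) :
  holomorphic_at g p ->
  exists a : nat -> C,
    Clocally p (fun z => is_Cpseries a (z - p) (g z)) /\
    forall n, exists h : C -> C, ex_Cderive h p /\
      Clocally p (fun z => g z = Cpoly a n (z - p) + (z - p) ^ n * h z).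
Proof.
intros H; apply (proj1 (Clocally_iff _ _)) in H; destruct H as [d [Hd H]].
assert (Hr : (0 < d / 2)%R) by lra.
assert (Hf : forall z, (Cmod (z - p) <= d / 2)%R -> ex_Cderive g z).
{ intros z Hz; apply H; lra. }
exists (taylor_coef g p (d / 2)); split.
- apply Clocally_iff; exists (d / 2 / 2)%R; split; [lra|].
  intros z Hz; apply taylor_pseries; auto; lra.
- intros n; exists (taylor_rem g p (d / 2) n); split.
  + eexists; now apply taylor_rem_derive.
  + apply Clocally_iff; exists (d / 2)%R; split; [lra|]; intros z Hz.
    rewrite <- (@taylor_rem_0 _ _ _ Hr Hf z Hz);
      now apply (@taylor_rem_Cpoly _ _ _ Hr Hf n 0%nat).
Qed.

(** * Residues *)

(** A geometric series of ratio at most 1/2; the shift of coefficients replaces [K] by [K / rho],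
    which makes the induction close. *)
Lemma Cpoly_bound (n : nat) (b : nat -> C) (K rho : R) (x : C) :
  (0 < rho)%R -> (0 <= K)%R -> (Cmod x <= rho / 2)%R ->
  (forall j, (Cmod (b j) <= K / rho ^ j)%R) -> (Cmod (Cpoly b n x) <= 2 * K)%R.
Proof.
intros Hr; revert b K; induction n as [|n IH]; intros b K HK Hx Hb.
- cbn; rewrite Cmod_0; lra.
- cbn [Cpoly]; eapply Rle_trans; [apply Cmod_triangle|]; rewrite Cmod_mult.
  assert (H0 := Hb 0%nat); cbn in H0.
  assert (HK' : (0 <= K / rho)%R).
  { apply Rmult_le_pos; [exact HK | now apply Rlt_le, Rinv_0_lt_compat]. }
  assert (H1 : (Cmod (Cpoly (fun j => b (S j)) n x) <= 2 * (K / rho))%R).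
  { apply IH; [exact HK' | exact Hx |].
    intros j; eapply Rle_trans; [apply Hb|]; right; cbn; field.
    repeat split; try apply pow_nonzero; lra. }
  apply Rle_trans with (K + rho / 2 * (2 * (K / rho)))%R; [|right; field; lra].
  apply Rplus_le_compat; [lra|].
  apply Rmult_le_compat; auto using Cmod_ge_0.
Qed.

Lemma Cpseries_coef_bound (a : nat -> C) (rho : R) (l : C) :
  (0 < rho)%R -> is_Cpseries a (RtoC rho) l ->
  exists K, (0 <= K)%R /\ forall j, (Cmod (a j) <= K / rho ^ j)%R.
Proof.
intros Hr H.
destruct (filterlim_bounded (K := C_AbsRing) (V := C_NormedModule)
  (fun n => Cpoly a n (RtoC rho))) as [M HM].
{ exists l; intros P HP; apply (proj1 (Clocally_iff _ _)) in HP.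
  destruct HP as [e [He HP]].
  destruct (proj1 (is_Cpseries_iff _ _ _) H e He) as [N HN].
  exists N; intros m Hm; apply HP; auto. }
assert (HM' : forall n, (Cmod (Cpoly a n (RtoC rho)) <= M)%R) by exact HM.
assert (M0 : (0 <= M)%R).
{ eapply Rle_trans; [apply Cmod_ge_0 | apply (HM' 0%nat)]. }
exists (2 * M)%R; split; [lra|]; intros j.
assert (Hj : (0 < rho ^ j)%R) by now apply pow_lt.
assert (T := Cmod_triangle (Cpoly a (S j) (RtoC rho)) (- Cpoly a j (RtoC rho))).
rewrite Cpoly_S_last in T at 1.
replace (Cpoly a j (RtoC rho) + RtoC rho ^ j * a j + - Cpoly a j (RtoC rho))
  with (RtoC rho ^ j * a j) in T by ring.
rewrite Cmod_opp, Cmod_mult, Cmod_pow, Cmod_R, Rabs_pos_eq in T by lra.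
assert (T1 := HM' j); assert (T2 := HM' (S j)).
apply Rmult_le_reg_l with (rho ^ j)%R; [exact Hj|].
replace (rho ^ j * (2 * M / rho ^ j))%R with (2 * M)%R by (field; lra).
lra.
Qed.

(** At a small s the partial sums are a(0) plus s times a quantity bounded uniformly in the number
    of terms; their limit is 0, and s is arbitrary. *)
Lemma Cpseries_zero_coef_0 (a : nat -> C) (d : R) :
  (0 < d)%R ->
  (forall x, (Cmod x < d)%R -> x <> 0 -> is_Cpseries a x (RtoC 0)) ->
  a 0%nat = 0.
Proof.
intros Hd H.
assert (Hd2 : RtoC (d / 2) <> 0) by (intros E; apply RtoC_inj in E; lra).
destruct (@Cpseries_coef_bound a (d / 2) 0) as (K0 & HK0 & Ha); [lra | |].
{ apply H; [|exact Hd2]; rewrite Cmod_R, Rabs_pos_eq; lra. }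
set (K := (K0 / (d / 2))%R).
assert (HK : (0 <= K)%R).
{ unfold K; apply Rmult_le_pos; [lra | apply Rlt_le, Rinv_0_lt_compat; lra]. }
assert (Hb : forall j, (Cmod (a (S j)) <= K / (d / 2) ^ j)%R).
{ intros j; eapply Rle_trans; [apply Ha|]; right; unfold K; cbn; field.
  repeat split; try apply pow_nonzero; lra. }
apply Cmod_eq_0, Rle_antisym; [|apply Cmod_ge_0].
apply le_epsilon; intros e He; rewrite Rplus_0_l.
(* [d / 4] is half of the radius [d / 2] at which the coefficients are bounded; the other entry
   gives [s * (2 * K) <= e / 2]. *)
set (s := Rmin (d / 4) (e / 2 / (2 * K + 1))).
assert (s0 : (0 < s)%R).
{ apply Rmin_glb_lt; [lra|]; apply Rdiv_lt_0_compat; lra. }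
assert (s1 : (s <= d / 4)%R) by apply Rmin_l.
assert (s2 : (s * (2 * K + 1) <= e / 2)%R).
{ replace (e / 2)%R with (e / 2 / (2 * K + 1) * (2 * K + 1))%R by (field; lra).
  apply Rmult_le_compat_r; [lra | apply Rmin_r]. }
clearbody s.
assert (Hs : Cmod (RtoC s) = s) by (rewrite Cmod_R, Rabs_pos_eq; lra).
assert (Hs0 : RtoC s <> 0) by (intros E; apply RtoC_inj in E; lra).
assert (H2 : is_Cpseries a (RtoC s) (RtoC 0)) by (apply H; [lra | exact Hs0]).
destruct (proj1 (is_Cpseries_iff _ _ _) H2 (e / 2)%R) as [N HN]; [lra|].
specialize (HN (S N) (Nat.le_succ_diag_r N)); cbn [Cpoly] in HN.
assert (B : (Cmod (Cpoly (fun j => a (S j)) N (RtoC s)) <= 2 * K)%R).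
{ apply Cpoly_bound with (d / 2)%R; auto; lra. }
replace (a 0%nat)
  with ((a 0%nat + RtoC s * Cpoly (fun j => a (S j)) N (RtoC s) - 0)
  + - (RtoC s * Cpoly (fun j => a (S j)) N (RtoC s))) by ring.
eapply Rle_trans; [apply Cmod_triangle|].
rewrite Cmod_opp, Cmod_mult, Hs.
assert (s * Cmod (Cpoly (fun j => a (S j)) N (RtoC s)) <= s * (2 * K))%R
  by (apply Rmult_le_compat_l; lra).
lra.
Qed.

(** Once a(0) = 0, division by [x] turns the series into its shift. This is why only nonzero [x] are
    considered. *)
Lemma Cpseries_zero_coef (a : nat -> C) (d : R) :
  (0 < d)%R ->
  (forall x, (Cmod x < d)%R -> x <> 0 -> is_Cpseries a x (RtoC 0)) ->
  forall n, a n = 0.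
Proof.
intros Hd H n; revert a H; induction n as [|n IH]; intros a H;
  assert (a0 := @Cpseries_zero_coef_0 a d Hd H); [exact a0|].
apply (IH (fun j => a (S j))); intros x Hx Nx.
apply is_Cpseries_iff; intros e He.
assert (Hm : (0 < Cmod x)%R) by now apply Cmod_gt_0.
destruct (proj1 (is_Cpseries_iff _ _ _) (H x Hx Nx) (e * Cmod x)%R) as [N HN];
  [now apply Rmult_lt_0_compat|].
exists N; intros m Hn.
specialize (HN (S m) (Nat.le_trans _ _ _ Hn (Nat.le_succ_diag_r m))).
cbn [Cpoly] in HN; rewrite a0 in HN.
replace (0 + x * Cpoly (fun j => a (S j)) m x - 0)
  with (x * (Cpoly (fun j => a (S j)) m x - 0)) in HN by ring.
rewrite Cmod_mult, Rmult_comm in HN.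
now apply Rmult_lt_reg_r in HN.
Qed.

Lemma Cpoly_minus (n : nat) (a b : nat -> C) (x : C) :
  Cpoly (fun j => a j - b j) n x = Cpoly a n x - Cpoly b n x.
Proof.
revert a b; induction n as [|n IH]; intros a b; cbn; [ring|].
rewrite (IH (fun j => a (S j)) (fun j => b (S j))); ring.
Qed.

Lemma Cpseries_unique (a b : nat -> C) (d : R) (s : C -> C) :
  (0 < d)%R ->
  (forall x, (Cmod x < d)%R -> x <> 0 -> is_Cpseries a x (s x)) ->
  (forall x, (Cmod x < d)%R -> x <> 0 -> is_Cpseries b x (s x)) ->
  forall n, a n = b n.
Proof.
intros Hd Ha Hb n; apply Ceq_minus.
apply (@Cpseries_zero_coef (fun j => a j - b j) d Hd); intros x Hx Nx.
apply is_Cpseries_iff; intros e He.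
assert (He2 : (0 < e / 2)%R) by lra.
destruct (proj1 (is_Cpseries_iff _ _ _) (Ha x Hx Nx) _ He2) as [N1 H1].
destruct (proj1 (is_Cpseries_iff _ _ _) (Hb x Hx Nx) _ He2) as [N2 H2].
exists (N1 + N2)%nat; intros m Hm.
specialize (H1 m ltac:(lia)); specialize (H2 m ltac:(lia)).
rewrite Cpoly_minus.
replace (Cpoly a m x - Cpoly b m x - 0)
  with ((Cpoly a m x - s x) + - (Cpoly b m x - s x)) by ring.
eapply Rle_lt_trans; [apply Cmod_triangle|]; rewrite Cmod_opp; lra.
Qed.

(** Padding with a zero coefficient brings two expansions of one function to the same order
    bound. *)
Lemma is_laurent_S (f : C -> C) (p : C) (n : nat) (a : Z -> C) :
  is_laurent f p n a -> is_laurent f p (S n) a.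
Proof.
intros [Ha H]; split; [intros m Hm; apply Ha; lia|].
apply Clocally'_iff in H; destruct H as [d [Hd H]].
apply Clocally'_iff; exists d; split; [exact Hd|]; intros z Hz Nz.
assert (Nx : z - p <> 0) by now apply Cminus_eq_contra.
specialize (H z Hz Nz); apply is_Cpseries_iff; intros e He.
assert (Hm : (0 < Cmod (z - p))%R) by now apply Cmod_gt_0.
destruct (proj1 (is_Cpseries_iff _ _ _) H (e / Cmod (z - p))%R) as [N HN];
  [now apply Rdiv_lt_0_compat|].
exists (S N); intros [|m] Hn; [lia|].
specialize (HN m (le_S_n _ _ Hn)); cbn [Cpoly Cpow].
rewrite (Ha (Z.of_nat 0 - Z.of_nat (S n))%Z) by lia.
replace (fun j => a (Z.of_nat (S j) - Z.of_nat (S n))%Z)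
  with (fun j => a (Z.of_nat j - Z.of_nat n)%Z).
2:{ apply functional_extensionality; intros j.
    f_equal; lia. }
set (P := Cpoly _ m _) in *.
replace (0 + (z - p) * P - (z - p) * (z - p) ^ n * f z)
  with ((z - p) * (P - (z - p) ^ n * f z)) by ring.
rewrite Cmod_mult; apply Rmult_lt_compat_l with (r := Cmod (z - p)) in HN;
  [|exact Hm].
replace (Cmod (z - p) * (e / Cmod (z - p)))%R with e in HN by (field; lra).
exact HN.
Qed.

Lemma is_laurent_add (f : C -> C) (p : C) (k n : nat) (a : Z -> C) :
  is_laurent f p n a -> is_laurent f p (k + n) a.
Proof. intros H; induction k as [|k IH];
  [exact H | now apply is_laurent_S]. Qed.

Lemma is_residue_unique (f : C -> C) (p r r' : C) :
  is_residue f p r -> is_residue f p r' -> r = r'.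
Proof.
intros (n & a & Ha & ->) (n' & a' & Ha' & ->).
(* The common bound N = n + n' + 1 exceeds both; the extra 1 ensures that the index -1 has a
   position, namely n' + n, even when both bounds are 0. *)
assert (La := is_laurent_add (S n') Ha);
  assert (La' := is_laurent_add (S n) Ha').
replace (S n + n')%nat with (S n' + n)%nat in La' by lia.
destruct La as [_ La], La' as [_ La'].
set (N := (S n' + n)%nat) in *.
apply Clocally'_iff in La; destruct La as [d [Hd La]].
apply Clocally'_iff in La'; destruct La' as [d' [Hd' La']].
assert (M : (0 < Rmin d d')%R) by now apply Rmin_glb_lt.
assert (U := @Cpseries_unique (fun j => a (Z.of_nat j - Z.of_nat N)%Z)
  (fun j => a' (Z.of_nat j - Z.of_nat N)%Z) (Rmin d d')
  (fun x => x ^ N * f (p + x)) M).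
replace (-1)%Z with (Z.of_nat (n' + n) - Z.of_nat N)%Z by (unfold N; lia).
apply U; intros x Hx Nx.
- specialize (La (p + x)); replace (p + x - p) with x in La by ring.
  apply La; [eapply Rlt_le_trans; [exact Hx | apply Rmin_l]|].
  intros E; apply Nx; replace x with (p + x - p) by ring; rewrite E; ring.
- specialize (La' (p + x)); replace (p + x - p) with x in La' by ring.
  apply La'; [eapply Rlt_le_trans; [exact Hx | apply Rmin_r]|].
  intros E; apply Nx; replace x with (p + x - p) by ring; rewrite E; ring.
Qed.

Lemma Residue_unique (f : C -> C) (p r : C) : is_residue f p r ->
  Residue f p = r.
Proof.
intros H; apply (iota_unique (V := C_CompleteNormedModule)); [|exact H].
intros r' Hr'; now apply is_residue_unique with f p.
Qed.

(** The coefficients start at the most singular term, so for order [S m] the residue is [a m].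
    Differentiability of [h] at [p] alone is enough to fill the gap at [p] after subtraction. *)
Definition has_principal_part (f : C -> C) (p : C) (a : nat -> C) (n : nat) :=
  exists h : C -> C, ex_Cderive h p /\
    Clocally' p (fun z => f z = Cpoly a n (z - p) / (z - p) ^ n + h z).

Lemma pole_principal_part (f g : C -> C) (p : C) (n : nat) :
  holomorphic_at g p ->
  Clocally' p (fun z => f z = g z / (z - p) ^ S n) ->
  exists a, has_principal_part f p a (S n) /\ Residue f p = a n.
Proof.
intros Hg Hf; destruct (holomorphic_at_taylor Hg) as (a & Ha & Hn).
exists a; split.
- destruct (Hn (S n)) as (h & Hh & Hgh); exists h; split; [exact Hh|].
  apply (proj1 (Clocally_iff _ _)) in Hgh; destruct Hgh as [d [Hd Hgh]].
  apply Clocally'_iff in Hf; destruct Hf as [d' [Hd' Hf]].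
  apply Clocally'_iff; exists (Rmin d d'); split; [now apply Rmin_glb_lt|].
  intros z Hz Nz.
  rewrite (Hf z), (Hgh z); [| | | exact Nz].
  + assert (N := Cpow_nz _ (S n) (Cminus_eq_contra _ _ Nz)).
    field; exact N.
  + eapply Rlt_le_trans; [exact Hz | apply Rmin_l].
  + eapply Rlt_le_trans; [exact Hz | apply Rmin_r].
- apply Residue_unique.
  (* Multiplication by (z - p)^(n+1) shifts indices by n + 1. The test is needed because [Z.to_nat]
     sends negative numbers to 0, which would repeat [a 0]. *)
  exists (S n), (fun m : Z => if (m + Z.of_nat (S n) <? 0)%Z then RtoC 0
    else a (Z.to_nat (m + Z.of_nat (S n)))); split.
  + split.
    * intros m Hm; replace (m + Z.of_nat (S n) <? 0)%Z with true;
        [reflexivity|].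
      symmetry; apply Z.ltb_lt; lia.
    * replace (fun j : nat => if (Z.of_nat j - Z.of_nat (S n) + Z.of_nat (S n) <? 0)%Z
        then RtoC 0 else a (Z.to_nat (Z.of_nat j - Z.of_nat (S n) + Z.of_nat (S n)))) with a.
      2:{ apply functional_extensionality; intros j.
          replace (Z.of_nat j - Z.of_nat (S n) + Z.of_nat (S n))%Z
            with (Z.of_nat j) by lia.
          replace (Z.of_nat j <? 0)%Z with false by (symmetry; apply Z.ltb_ge;
            lia).
          now rewrite Nat2Z.id. }
      apply (proj1 (Clocally_iff _ _)) in Ha; destruct Ha as [d [Hd Ha]].
      apply Clocally'_iff in Hf; destruct Hf as [d' [Hd' Hf]].
      apply Clocally'_iff; exists (Rmin d d'); split; [now apply Rmin_glb_lt|].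
      intros z Hz Nz.
      rewrite (Hf z); [| | exact Nz].
      2:{ eapply Rlt_le_trans; [exact Hz | apply Rmin_r]. }
      assert (N := Cpow_nz _ (S n) (Cminus_eq_contra _ _ Nz)).
      replace ((z - p) ^ S n * (g z / (z - p) ^ S n)) with (g z) by (field;
        exact N).
      apply Ha; eapply Rlt_le_trans; [exact Hz | apply Rmin_l].
  + replace (-1 + Z.of_nat (S n))%Z with (Z.of_nat n) by lia.
    replace (Z.of_nat n <? 0)%Z with false by (symmetry; apply Z.ltb_ge; lia).
    now rewrite Nat2Z.id.
Qed.

(** * Residue theorem on sectors *)

Definition sector (r al be : R) (z : C) : Prop :=
  exists s t : R, (0 <= s <= r)%R /\ (al <= t <= be)%R /\ z = RtoC s * eit t.

(** Out along the ray [al], along the arc, back along the ray [be]. A relation carries the existence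
    of the three integrals; [al <= be] is not imposed, so that sectors can be reversed. *)
Definition is_sector_integral (f : C -> C) (r al be : R) (l : C) : Prop :=
  exists l1 l2 l3 : C,
    is_CRInt (fun s => f (RtoC s * eit al) * eit al) 0 r l1 /\
    is_CRInt (fun t => f (RtoC r * eit t) * (RtoC r * (Ci * eit t))) al be l2 /\
    is_CRInt (fun s => f (RtoC s * eit be) * eit be) 0 r l3 /\
    l = l1 + l2 - l3.

(** Agreement is asked on the boundary only, so the functions may differ at a pole inside. *)
Lemma is_sector_integral_ext (f g : C -> C) (r al be : R) (l : C) :
  (0 <= r)%R -> (al <= be)%R ->
  (forall s, (0 <= s <= r)%R -> f (RtoC s * eit al) = g (RtoC s * eit al)) ->
  (forall s, (0 <= s <= r)%R -> f (RtoC s * eit be) = g (RtoC s * eit be)) ->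
  (forall t, (al <= t <= be)%R -> f (RtoC r * eit t) = g (RtoC r * eit t)) ->
  is_sector_integral f r al be l -> is_sector_integral g r al be l.
Proof.
intros Hr Hab E1 E2 E3 (l1 & l2 & l3 & I1 & I2 & I3 & ->).
exists l1, l2, l3; repeat split.
- revert I1; apply is_CRInt_ext; [exact Hr|]; intros s Hs; rewrite E1; auto;
    lra.
- revert I2; apply is_CRInt_ext; [exact Hab|]; intros s Hs; rewrite E3; auto;
    lra.
- revert I3; apply is_CRInt_ext; [exact Hr|]; intros s Hs; rewrite E2; auto;
    lra.
Qed.

Lemma is_sector_integral_plus (f g : C -> C) (r al be : R) (k l : C) :
  is_sector_integral f r al be k -> is_sector_integral g r al be l ->
  is_sector_integral (fun z => f z + g z) r al be (k + l).
Proof.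
intros (k1 & k2 & k3 & I1 & I2 & I3 & ->) (l1 & l2 & l3 & J1 & J2 & J3 & ->).
exists (k1 + l1), (k2 + l2), (k3 + l3); repeat split; [..|ring].
- eapply is_RInt_ext; [|exact (is_CRInt_plus I1 J1)].
  intros; symmetry; apply Cmult_plus_distr_r.
- eapply is_RInt_ext; [|exact (is_CRInt_plus I2 J2)].
  intros; symmetry; apply Cmult_plus_distr_r.
- eapply is_RInt_ext; [|exact (is_CRInt_plus I3 J3)].
  intros; symmetry; apply Cmult_plus_distr_r.
Qed.

Lemma is_sector_integral_scal (f : C -> C) (r al be : R) (k l : C) :
  is_sector_integral f r al be l ->
  is_sector_integral (fun z => k * f z) r al be (k * l).
Proof.
intros (l1 & l2 & l3 & I1 & I2 & I3 & ->).
exists (k * l1), (k * l2), (k * l3); repeat split; [..|ring].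
- eapply is_RInt_ext; [|exact (@is_CRInt_mult_l _ _ _ k _ I1)].
  intros; apply Cmult_assoc.
- eapply is_RInt_ext; [|exact (@is_CRInt_mult_l _ _ _ k _ I2)].
  intros; apply Cmult_assoc.
- eapply is_RInt_ext; [|exact (@is_CRInt_mult_l _ _ _ k _ I3)].
  intros; apply Cmult_assoc.
Qed.

(** The common ray is run through in both directions and cancels, whatever the order of the three
    angles. *)
Lemma is_sector_integral_Chasles (f : C -> C) (r al be ga : R) (k l : C) :
  is_sector_integral f r al be k -> is_sector_integral f r be ga l ->
  is_sector_integral f r al ga (k + l).
Proof.
intros (k1 & k2 & k3 & I1 & I2 & I3 & ->) (l1 & l2 & l3 & J1 & J2 & J3 & ->).
exists k1, (k2 + l2), l3; repeat split; try assumption.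
- exact (is_RInt_Chasles (V := C_R_NormedModule) _ _ _ _ _ _ I2 J2).
- rewrite (is_CRInt_uniq I3 J1); ring.
Qed.

Lemma is_sector_integral_swap (f : C -> C) (r al be : R) (l : C) :
  is_sector_integral f r al be l -> is_sector_integral f r be al (- l).
Proof.
intros (l1 & l2 & l3 & I1 & I2 & I3 & ->).
exists l3, (- l2), l1; repeat split; try assumption; [|ring].
exact (is_RInt_swap (V := C_R_NormedModule) _ _ _ _ I2).
Qed.

Lemma is_RCderive_circle (r t : R) :
  is_RCderive (fun y => RtoC r * eit y) t (RtoC r * (Ci * eit t))%C.
Proof.
apply (is_RCderive_comp (f := fun z => RtoC r * z)); [|apply is_RCderive_eit].
apply is_Cderive_ext with (fun z => RtoC 0 + RtoC r * z).
- intros z; change (RtoC 0 + RtoC r * z = RtoC r * z :> C); ring.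
- apply is_Cderive_affine.
Qed.

Lemma is_RCderive_ray (c : C) (s : R) :
  is_RCderive (fun x => RtoC x * c) s c.
Proof. apply is_RCderive_pair; cbn; auto_derive; auto; ring. Qed.

Lemma Ccontinuous_circle_velocity (r t : R) :
  Ccontinuous (fun y => RtoC r * (Ci * eit y)) t.
Proof.
apply Ccontinuous_mult; [apply Ccontinuous_const|].
apply Ccontinuous_mult; [apply Ccontinuous_const | apply Ccontinuous_eit].
Qed.

Lemma ex_radial_integral (f : C -> C) (r t : R) : (0 <= r)%R ->
  (forall s, (0 <= s <= r)%R -> ex_Cderive f (RtoC s * eit t)) ->
  ex_CRInt (fun s => f (RtoC s * eit t) * eit t) 0 r.
Proof.
intros Hr Hf.
apply (@ex_path_int f (fun s => RtoC s * eit t) (fun _ => eit t)); auto.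
- intros s _; exact (is_RCderive_continuous (is_RCderive_ray (eit t) s)).
- intros; apply Ccontinuous_const.
Qed.

Lemma ex_arc_integral (f : C -> C) (r al be : R) : (al <= be)%R ->
  (forall t, (al <= t <= be)%R -> ex_Cderive f (RtoC r * eit t)) ->
  ex_CRInt (fun t => f (RtoC r * eit t) * (RtoC r * (Ci * eit t))) al be.
Proof.
intros Hr Hf.
apply (@ex_path_int f (fun t => RtoC r * eit t)); auto.
- intros t _; exact (is_RCderive_continuous (is_RCderive_circle r t)).
- intros; apply Ccontinuous_circle_velocity.
Qed.

Lemma is_sector_integral_holomorphic (f : C -> C) (r al be : R) :
  (0 <= r)%R -> (al <= be)%R ->
  (forall z, sector r al be z -> ex_Cderive f z) ->
  is_sector_integral f r al be 0.
Proof.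
intros Hr Hab Hf.
assert (Hf' : forall s t, (0 <= s <= r)%R -> (al <= t <= be)%R ->
  ex_Cderive f (RtoC s * eit t)).
{ intros s t Hs Ht; apply Hf; exists s, t; auto. }
eexists; eexists; eexists; repeat split.
- apply CRInt_correct, ex_radial_integral; auto with real.
- apply CRInt_correct, ex_arc_integral; auto with real.
- apply CRInt_correct, ex_radial_integral; auto with real.
- assert (H := @cone_circuit_holomorphic f 0 eit (fun t => Ci * eit t) 0 r al be
    Hr Hab is_RCderive_eit).
  unfold cone_circuit, path_int in H.
  (* The side [s = 0] of the parameter rectangle collapses to the apex and contributes nothing. *)
  assert (Z : is_CRInt (fun t => f (RtoC 0 + RtoC 0 * eit t) *
     (RtoC 0 * (Ci * eit t))) al be (RtoC 0)).
  { assert (Z := @is_CRInt_const 0 al be); rewrite Cmult_0_r in Z.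
    revert Z; apply is_CRInt_ext; [exact Hab | intros; ring]. }
  rewrite (is_CRInt_unique Z) in H.
  rewrite <- H.
  + replace (fun s => f (RtoC 0 + RtoC s * eit al) * eit al)
      with (fun s => f (RtoC s * eit al) * eit al).
    2:{ apply functional_extensionality; intros s.
        now rewrite Cplus_0_l. }
    replace (fun s => f (RtoC 0 + RtoC s * eit be) * eit be)
      with (fun s => f (RtoC s * eit be) * eit be).
    2:{ apply functional_extensionality; intros s.
        now rewrite Cplus_0_l. }
    replace (fun t => f (RtoC 0 + RtoC r * eit t) * (RtoC r * (Ci * eit t)))
      with (fun t => f (RtoC r * eit t) * (RtoC r * (Ci * eit t))).
    2:{ apply functional_extensionality; intros s.
        now rewrite Cplus_0_l. }
    ring.
  + intros t; apply Ccontinuous_mult;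
      [apply Ccontinuous_const | apply Ccontinuous_eit].
  + intros s t Hs Ht; rewrite Cplus_0_l; auto.
Qed.

(** The boundary is a closed path, so the increments of [F] telescope. The primitive is needed on
    the boundary only and may be singular inside. *)
Lemma is_sector_integral_primitive (F f : C -> C) (r al be : R) :
  (0 <= r)%R -> (al <= be)%R ->
  (forall z, (exists s, (0 <= s <= r)%R /\ z = RtoC s * eit al) \/
     (exists s, (0 <= s <= r)%R /\ z = RtoC s * eit be) \/
     (exists t, (al <= t <= be)%R /\ z = RtoC r * eit t) ->
     is_Cderive F z (f z) /\ ex_Cderive f z) ->
  is_sector_integral f r al be 0.
Proof.
intros Hr Hab HF; eexists; eexists; eexists; repeat split.
- apply (@is_path_int_primitive F f (fun s => RtoC s * eit al)
    (fun _ => eit al));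
    [exact Hr | | | |]; intros s Hs.
  + apply is_RCderive_ray.
  + apply Ccontinuous_const.
  + apply HF; left; eauto.
  + apply HF; left; eauto.
- apply (@is_path_int_primitive F f (fun t => RtoC r * eit t)
    (fun t => RtoC r * (Ci * eit t))); [exact Hab | | | |]; intros t Ht.
  + apply is_RCderive_circle.
  + apply Ccontinuous_circle_velocity.
  + apply HF; eauto.
  + apply HF; eauto.
- apply (@is_path_int_primitive F f (fun s => RtoC s * eit be)
    (fun _ => eit be));
    [exact Hr | | | |]; intros s Hs.
  + apply is_RCderive_ray.
  + apply Ccontinuous_const.
  + apply HF; right; left; eauto.
  + apply HF; right; left; eauto.
- rewrite !Cmult_0_l; ring.
Qed.

(** Equality would force equal moduli and e^(ix) = 1 with x = t - theta; then cos x = 1 - 2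
    sin^2(x/2) excludes 0 < |x| < 2 PI. *)
Lemma polar_neq (s t rho theta : R) :
  (0 <= s)%R -> (0 < rho)%R -> t <> theta -> (Rabs (t - theta) < 2 * PI)%R ->
  RtoC s * eit t <> RtoC rho * eit theta.
Proof.
intros Hs Hrho Nt Ht E.
assert (Es : s = rho).
{ rewrite <- (Cmod_circle t Hs), E; apply Cmod_circle; lra. }
subst s.
assert (N : RtoC rho <> 0) by (intros E'; apply RtoC_inj in E'; lra).
apply (f_equal (Cmult (/ RtoC rho))) in E.
rewrite !Cmult_assoc, Cinv_l, !Cmult_1_l in E by exact N.
apply (f_equal (fun z => z * eit (- theta))) in E.
rewrite eit_opp, <- eit_plus in E.
apply (f_equal fst) in E; cbn in E.
set (x := (t + - theta)%R) in E.
replace (t - theta)%R with x in Ht by (unfold x; ring).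
assert (Nx : x <> 0%R) by (unfold x; lra).
replace x with (2 * (x / 2))%R in E by field.
rewrite cos_2a_sin in E.
assert (S0 : sin (x / 2) = 0%R) by nra.
destruct (Rlt_or_le 0 x) as [Hx | Hx].
- rewrite Rabs_pos_eq in Ht by lra.
  assert (0 < sin (x / 2))%R by (apply sin_gt_0; lra); lra.
- rewrite Rabs_left1 in Ht by lra.
  assert (0 < sin (- (x / 2)))%R by (apply sin_gt_0; lra).
  rewrite sin_neg in H; lra.
Qed.

Section SectorResidue.

Variables (theta al be r : R).
Hypothesis Hal : (theta - 2 * PI < al < theta)%R.
Hypothesis Hbe : (theta < be < theta + 2 * PI)%R.
Hypothesis Hr : (0 <= r)%R.

Let boundary (rho : R) (z : C) : (0 < rho < r)%R ->
  (exists s, (0 <= s <= r)%R /\ z = RtoC s * eit al) \/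
  (exists s, (0 <= s <= r)%R /\ z = RtoC s * eit be) \/
  (exists t, (al <= t <= be)%R /\ z = RtoC r * eit t) ->
  z <> RtoC rho * eit theta.
Proof.
intros Hrho [(s & Hs & ->) | [(s & Hs & ->) | (t & Ht & ->)]].
- apply polar_neq; try lra; rewrite Rabs_left; lra.
- apply polar_neq; try lra; rewrite Rabs_right; lra.
- intros E; apply (f_equal Cmod) in E; rewrite !Cmod_circle in E; lra.
Qed.

Lemma is_sector_integral_inv (rho : R) : (0 < rho < r)%R ->
  is_sector_integral (fun z => / (z - RtoC rho * eit theta)) r al be (2 * PI * Ci).
Proof.
intros Hrho; set (p := RtoC rho * eit theta).
assert (Hpi := PI_RGT_0).
(* Between consecutive representatives of the angle of [p] modulo 2 PI, the sector misses [p]. *)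
assert (free : forall a b, (a <= b)%R ->
  ((theta - 2 * PI < a /\ b < theta) \/ (theta < a /\ b < theta + 2 * PI))%R ->
  is_sector_integral (fun z => / (z - p)) r a b 0).
{ intros a b Hab H; apply is_sector_integral_holomorphic; auto.
  intros z (s & t & Hs & Ht & ->).
  apply ex_Cderive_inv_minus, polar_neq; try lra.
  destruct H as [H | H]; [rewrite Rabs_left | rewrite Rabs_right]; lra. }
assert (full : is_sector_integral (fun z => / (z - p)) r (theta - PI)
  (theta + PI)
   (2 * PI * Ci)).
(* The two rays of the slit disk coincide and cancel; the circle remains. *)
{ assert (Ep : eit (theta + PI) = eit (theta - PI)).
  { replace (theta + PI)%R with (theta - PI + 2 * PI)%R by ring.
    rewrite eit_plus, eit_2PI, eit_0; ring. }
  assert (X : ex_CRInt (fun s => / (RtoC s * eit (theta - PI) - p) * eit (theta - PI)) 0 r).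
  { apply (@ex_radial_integral (fun z => / (z - p))); [exact Hr|]; intros s Hs.
    apply ex_Cderive_inv_minus, polar_neq; try lra; rewrite Rabs_left; lra. }
  apply CRInt_correct in X.
  exists (CRInt (fun s => / (RtoC s * eit (theta - PI) - p) * eit (theta - PI)) 0 r),
    (2 * PI * Ci),
      (CRInt (fun s => / (RtoC s * eit (theta - PI) - p) * eit (theta - PI)) 0 r).
  repeat split; [exact X | | rewrite Ep; exact X | ring].
  set (t0 := (theta - PI)%R).
  (* Turning by [- t0] moves the angles to the range of [circle_kernel]; the pole turned likewise is
     [- A]. *)
  set (A := - p * eit (- t0)).
  assert (HA : (Cmod A < r)%R).
  { unfold A, p; rewrite Cmod_mult, Cmod_opp, Cmod_circle, Cmod_eit; lra. }
  assert (K := @circle_kernel A r HA).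
  assert (K' : is_CRInt (fun t => scal 1%R (RtoC r * eit (1 * t + - t0) /
    (A + RtoC r * eit (1 * t + - t0)))) t0 (theta + PI) (RtoC (2 * PI))).
  { apply (is_RInt_comp_lin (V := C_R_NormedModule)
      (fun t => RtoC r * eit t / (A + RtoC r * eit t))).
    replace (1 * t0 + - t0)%R with 0%R by ring.
    now replace (1 * (theta + PI) + - t0)%R with (2 * PI)%R by (unfold t0;
      ring). }
  apply is_CRInt_mult_l with (k := Ci) in K'.
  replace (2 * PI * Ci) with (Ci * RtoC (2 * PI)) by (rewrite RtoC_mult; ring).
  revert K'; apply is_CRInt_ext; [unfold t0; lra|]; intros t _.
  rewrite scal_R_Cmult; unfold A.
  replace (1 * t + - t0)%R with (t + - t0)%R by ring; rewrite eit_plus.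
  assert (N1 := @eit_neq0 (- t0)).
  assert (N2 : RtoC r * eit t - p <> 0).
  { apply Cminus_eq_contra; intros E; apply (f_equal Cmod) in E.
    unfold p in E; rewrite !Cmod_circle in E; lra. }
  set (u := eit t) in *; set (e := eit (- t0)) in *.
  replace (- p * e + RtoC r * (u * e)) with (e * (RtoC r * u - p)) by ring.
  field; split; assumption. }
(* If [al] lies beyond [theta - PI], the disk has swept too much and the surplus sector enters
   reversed. *)
assert (left : is_sector_integral (fun z => / (z - p)) r al (theta - PI) 0).
{ destruct (Rle_or_lt al (theta - PI)) as [H | H]; [apply free; lra|].
  replace (RtoC 0) with (- 0) by ring; apply is_sector_integral_swap, free;
    lra. }
assert (right : is_sector_integral (fun z => / (z - p)) r (theta + PI) be 0).
{ destruct (Rle_or_lt (theta + PI) be) as [H | H]; [apply free; lra|].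
  replace (RtoC 0) with (- 0) by ring; apply is_sector_integral_swap, free;
    lra. }
assert (H :=
  is_sector_integral_Chasles (is_sector_integral_Chasles left full) right).
replace (2 * PI * Ci) with (0 + 2 * PI * Ci + 0) by ring; exact H.
Qed.

(** Exponents from 2 on have a single-valued primitive off [p], so the opening does not matter. *)
Lemma is_sector_integral_inv_pow (rho : R) (n : nat) : (0 < rho < r)%R ->
  is_sector_integral (fun z => (/ (z - RtoC rho * eit theta)) ^ S (S n)) r al be 0.
Proof.
intros Hrho; set (p := RtoC rho * eit theta).
assert (Nn : RtoC (INR (S n)) <> 0).
{ intros E; apply RtoC_inj in E; revert E; apply not_0_INR; lia. }
apply is_sector_integral_primitive with
  (fun z => - / RtoC (INR (S n)) * (/ (z - p)) ^ S n); [lra | lra |].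
intros z Hz; assert (Nz : z <> p) by now apply (boundary Hrho).
split.
- assert (H := is_Cderive_mult (is_Cderive_const (- / RtoC (INR (S n))) z)
    (is_Cderive_pow n (is_Cderive_inv_minus Nz))).
  cbv beta in H.
  match type of H
    with is_Cderive _ _ ?l => replace ((/ (z - p)) ^ S (S n)) with l end;
    [exact H|].
  cbn [Cpow]; set (u := / (z - p)); field; exact Nn.
- exact (ex_Cderive_pow (S (S n)) (ex_Cderive_inv_minus Nz)).
Qed.

(** Induction on the order: the most singular term splits off with integral 0, and the shifted
    coefficients keep the same last one. *)
Lemma is_sector_integral_principal_part (rho : R) (n : nat) (a : nat -> C) :
  (0 < rho < r)%R ->
  is_sector_integral (fun z => Cpoly a (S n) (z - RtoC rho * eit theta) /
    (z - RtoC rho * eit theta) ^ S n) r al be (2 * PI * Ci * a n).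
Proof.
intros Hrho; set (p := RtoC rho * eit theta).
revert a; induction n as [|n IH]; intros a.
- assert (H :=
    @is_sector_integral_scal _ _ _ _ (a 0%nat) _ (is_sector_integral_inv Hrho)).
  rewrite Cmult_comm; revert H.
  apply is_sector_integral_ext; try lra; intros x Hx; fold p; cbn; field;
    apply Cminus_eq_contra, (boundary Hrho); eauto.
- assert (H := is_sector_integral_plus
    (@is_sector_integral_scal _ _ _ _ (a 0%nat) _ (is_sector_integral_inv_pow n Hrho))
    (IH (fun j => a (S j)))).
  replace (2 * PI * Ci * a (S n))
    with (a 0%nat * 0 + 2 * PI * Ci * a (S n)) by ring.
  assert (E : forall z, z <> p ->
    a 0%nat * (/ (z - p)) ^ S (S n) + Cpoly (fun j => a (S j)) (S n)
      (z - p) / (z - p) ^ S n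
    = Cpoly a (S (S n)) (z - p) / (z - p) ^ S (S n)).
  { intros z Hz; assert (N := Cminus_eq_contra _ _ Hz).
    assert (N' := Cpow_nz _ n N).
    rewrite (Cpow_inv _ (S (S n)) N).
    change (Cpoly a (S (S n)) (z - p)) with
      (a 0%nat + (z - p) * Cpoly (fun j => a (S j)) (S n) (z - p)).
    set (P := Cpoly _ (S n) _); cbn [Cpow]; field; split; assumption. }
  revert H; apply is_sector_integral_ext; try lra; intros x Hx;
    apply E, (boundary Hrho); eauto.
Qed.

Lemma ex_Cderive_Cpoly (a : nat -> C) (n : nat) (p z : C) :
  ex_Cderive (fun y => Cpoly a n (y - p))%C z.
Proof.
revert a; induction n as [|n IH]; intros a; [exact (ex_Cderive_const 0 z)|].
exact (ex_Cderive_plus (ex_Cderive_const (a 0%nat) z)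
  (ex_Cderive_mult (ex_Cderive_minus_const p z) (IH (fun j => a (S j))))).
Qed.

Lemma ex_Cderive_principal_part (a : nat -> C) (n : nat) (p z : C) : z <> p ->
  ex_Cderive (fun y => Cpoly a n (y - p) / (y - p) ^ n)%C z.
Proof.
intros Nz; apply ex_Cderive_mult; [apply ex_Cderive_Cpoly|].
apply ex_Cderive_ext_loc with (fun y => (/ (y - p)) ^ n).
- apply Clocally_iff; exists (Cmod (z - p)); split.
  + apply Cmod_gt_0, Cminus_eq_contra, Nz.
  + intros y Hy; apply Cpow_inv, Cminus_eq_contra; intros ->.
    rewrite <- Copp_minus_distr, Cmod_opp in Hy; lra.
- apply ex_Cderive_pow; now apply ex_Cderive_inv_minus.
Qed.

(** Induction on the poles: subtracting the principal part at the first one leaves a function with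
    the remaining poles and unchanged residues there. *)
Theorem sector_residue_theorem (l : list C) (F : C -> C) (res : C -> C) :
  NoDup l ->
  (forall p, In p l -> exists rho, (0 < rho < r)%R /\ p =
    RtoC rho * eit theta) ->
  (forall p, In p l -> exists a n, has_principal_part F p a (S n) /\ res p =
    a n) ->
  (forall z, sector r al be z -> ~ In z l -> ex_Cderive F z) ->
  is_sector_integral F r al be
    (2 * PI * Ci * fold_right Cplus 0 (map res l)).
Proof.
revert F; induction l as [|p l IH]; intros F Hnd Hpos Hpp HF.
- cbn; rewrite Cmult_0_r; apply is_sector_integral_holomorphic; try lra; auto.
- inversion Hnd as [|p' l' Hp Hl]; subst p' l'.
  destruct (Hpos p) as (rho & Hrho & Ep); [now left|].
  destruct (Hpp p) as (a & n & (h & Hh & Ha) & Hres); [now left|].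
  pose (PP := fun z => Cpoly a (S n) (z - p) / (z - p) ^ S n).
  (* The values of [F] and [PP] at [p] are meaningless; [h p] is the value that removes the
     singularity. *)
  pose (F1 := fun z => if Ceq_dec z p then h p else F z - PP z).
  assert (off : forall z, z <> p -> F1 z = F z - PP z).
  { intros z Nz; unfold F1; destruct (Ceq_dec z p);
      [contradiction | reflexivity]. }
  assert (loc : forall z, z <> p -> Clocally z (fun y => y <> p)).
  { intros z Nz; apply Clocally_iff; exists (Cmod (z - p)); split.
    - apply Cmod_gt_0, Cminus_eq_contra, Nz.
    - intros y Hy ->; rewrite <- Copp_minus_distr, Cmod_opp in Hy; lra. }
  assert (dPP : forall z, z <> p -> ex_Cderive (fun y => - PP y) z).
  { intros z Nz.
    apply ex_Cderive_ext_loc with (fun y => RtoC (-1) * PP y).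
    - apply filter_forall; intros y; change (RtoC (-1) * PP y = - PP y :> C);
        ring.
    - apply ex_Cderive_mult; [apply ex_Cderive_const|].
      now apply ex_Cderive_principal_part. }
  assert (I1 : is_sector_integral F1 r al be
    (2 * PI * Ci * fold_right Cplus 0 (map res l))).
  { apply IH; [exact Hl | intros q Hq; apply Hpos; now right | |].
    - intros q Hq; destruct (Hpp q) as (b & m & (k & Hk & Hb) & Hr');
        [now right|].
      assert (Nq : q <> p) by (intros ->; contradiction).
      exists b, m; split; [|exact Hr'].
      (* [PP] is regular at every other pole [q], so only the regular part changes there. *)
      exists (fun z => k z + - PP z); split.
      + apply ex_Cderive_plus; [exact Hk | now apply dPP].
      + generalize (filter_and _ _ Hb (filter_le_within (fun y => y <> q) _ (loc q Nq))).
        apply filter_imp; intros z [E Nz]; rewrite off, E by exact Nz; ring.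
    - intros z Hz Nz; destruct (Ceq_dec z p) as [-> | Np].
      + apply ex_Cderive_ext_loc with h; [|exact Hh].
        apply Clocally'_iff in Ha; destruct Ha as [d [Hd Ha]].
        apply Clocally_iff; exists d; split; [exact Hd|]; intros y Hy.
        unfold F1; destruct (Ceq_dec y p) as [-> | Ny]; [reflexivity|].
        rewrite (Ha y Hy Ny); unfold PP; ring.
      + apply ex_Cderive_ext_loc with (fun y => F y + - PP y).
        * generalize (loc z Np); apply filter_imp; intros y Ny.
          now rewrite off.
        * apply ex_Cderive_plus; [|now apply dPP].
          apply HF; [exact Hz|]; intros [E | E];
            [now apply Np | contradiction]. }
  assert (I2 := is_sector_integral_principal_part n a Hrho).
  rewrite <- Ep in I2; fold PP in I2.
  assert (I := is_sector_integral_plus I1 I2).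
  cbn [map fold_right]; rewrite Hres.
  replace (2 * PI * Ci * (a n + fold_right Cplus 0 (map res l))) with
    (2 * PI * Ci * fold_right Cplus 0 (map res l) + 2 * PI * Ci * a n) by ring.
  revert I; apply is_sector_integral_ext; try lra; intros x Hx;
    rewrite off; try ring; rewrite Ep; apply (boundary Hrho); eauto.
Qed.

End SectorResidue.

(** * Poles of the Laplace integrand *)

Lemma polar_eit (r t : R) : polar r t = RtoC r * eit t.
Proof.
unfold polar, eit; f_equal; unfold Cexp, Ci, RtoC; cbn.
replace (0 * t - 1 * 0)%R with 0%R by ring.
replace (0 * 0 + 1 * t)%R with t by ring.
rewrite exp_0, !Rmult_1_l; reflexivity.
Qed.

(** * The complex exponential *)

Lemma Cexp_plus (a b : C) : Cexp (a + b) = Cexp a * Cexp b.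
Proof.
unfold Cexp; cbn; rewrite exp_plus, cos_plus, sin_plus.
apply injective_projections; cbn; ring.
Qed.

Lemma Cexp_0 : Cexp 0 = 1.
Proof.
unfold Cexp; cbn; rewrite exp_0, cos_0, sin_0.
apply injective_projections; cbn; ring.
Qed.

Lemma Cmod_Cexp (z : C) : Cmod (Cexp z) = exp (fst z).
Proof.
replace (Cexp z) with (RtoC (exp (fst z)) * eit (snd z))
  by (unfold Cexp, eit; apply injective_projections; cbn; ring).
apply Cmod_circle, Rlt_le, exp_pos.
Qed.

Lemma Cexp_neq0 (z : C) : Cexp z <> 0.
Proof. apply Cmod_gt_0; rewrite Cmod_Cexp; apply exp_pos. Qed.

(** The mean value inequality twice along t |-> e^(th): the modulus is at most e <= 3, hence |e^(th)
    - 1| <= 3 |h|, and this bounds the derivative of e^(th) - th. *)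
Lemma Cexp_taylor_1 (h : C) : (Cmod h <= 1)%R ->
  (Cmod (Cexp h - 1 - h) <= 3 * Cmod h * Cmod h)%R.
Proof.
intros Hh; assert (H0 := Cmod_ge_0 h).
assert (D : forall t, is_RCderive (fun t => Cexp (RtoC t * h)) t
  (h * Cexp (RtoC t * h))%C).
{ intros t; apply is_RCderive_pair; unfold Cexp; cbn; auto_derive; auto;
    unfold Rminus; ring. }
assert (Cc : forall t, Ccontinuous (fun t => Cexp (RtoC t * h)) t).
{ intros t; exact (is_RCderive_continuous (D t)). }
assert (B : forall t, (0 <= t <= 1)%R -> (Cmod (Cexp (RtoC t * h)) <= 3)%R).
{ intros t Ht; rewrite Cmod_Cexp.
  apply Rle_trans with (exp 1); [|apply exp_le_3].
  assert (fst (RtoC t * h)%C <= 1)%R.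
  { eapply Rle_trans; [apply Rle_abs|]; eapply Rle_trans; [apply Rabs_fst_le|].
    rewrite Cmod_mult, Cmod_R, Rabs_pos_eq by lra; nra. }
  destruct (Rle_lt_or_eq_dec _ _ H) as [L | ->]; [|lra].
  now apply Rlt_le, exp_increasing. }
assert (S1 : forall t, (0 <= t <= 1)%R -> (Cmod (Cexp (RtoC t * h) - 1) <=
  3 * Cmod h)%R).
{ intros t Ht.
  assert (M := @Cmean_value (fun t => Cexp (RtoC t * h))
    (fun t => h * Cexp (RtoC t * h))
    0 t (3 * Cmod h)).
  cbv beta in M; rewrite Cmult_0_l, Cexp_0, Rminus_0_r, Rabs_pos_eq in M by lra.
  rewrite Rmin_left, Rmax_right in M by lra.
  eapply Rle_trans; [apply M|].
  - intros; apply D.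
  - intros; apply Ccontinuous_mult; [apply Ccontinuous_const | apply Cc].
  - intros s Hs; rewrite Cmod_mult, Rmult_comm.
    apply Rmult_le_compat_r; [lra | apply B; lra].
  - nra. }
assert (M := @Cmean_value (fun t => Cexp (RtoC t * h) - RtoC t * h)
  (fun t => h * Cexp (RtoC t * h) - h) 0 1 (3 * Cmod h * Cmod h)).
cbv beta in M;
  rewrite Cmult_0_l, Cexp_0, Cmult_1_l, Rminus_0_r, Rabs_R1, Rmult_1_r in M.
replace (Cexp h - 1 - h) with (Cexp h - h - (1 - 0)) by ring; apply M.
- intros t _; apply is_RCderive_pair; unfold Cexp; cbn; auto_derive; auto;
    unfold Rminus; ring.
- intros t _; apply Ccontinuous_minus; [|apply Ccontinuous_const].
  apply Ccontinuous_mult; [apply Ccontinuous_const | apply Cc].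
- rewrite Rmin_left, Rmax_right by lra; intros t Ht.
  replace (h * Cexp (RtoC t * h) - h)
    with ((Cexp (RtoC t * h) - 1) * h) by ring.
  rewrite Cmod_mult; apply Rmult_le_compat_r; [exact H0 | now apply S1].
Qed.

Lemma is_Cderive_Cexp (z : C) : is_Cderive Cexp z (Cexp z).
Proof.
apply is_Cderive_iff; intros e He.
set (E := Cmod (Cexp z)); assert (HE : (0 <= E)%R) by apply Cmod_ge_0.
exists (Rmin 1 (e / (3 * E + 1))); split.
{ apply Rmin_glb_lt; [lra|]; apply Rdiv_lt_0_compat; lra. }
intros y Hy.
assert (L1 := Rlt_le_trans _ _ _ Hy (Rmin_l _ _)).
assert (L2 := Rlt_le_trans _ _ _ Hy (Rmin_r _ _)).
assert (Ey : Cexp y = Cexp z * Cexp (y - z)).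
{ rewrite <- Cexp_plus; f_equal; ring. }
rewrite Ey.
replace (Cexp z * Cexp (y - z) - Cexp z - Cexp z * (y - z))
  with (Cexp z * (Cexp (y - z) - 1 - (y - z))) by ring.
rewrite Cmod_mult; fold E.
assert (T := @Cexp_taylor_1 (y - z) (Rlt_le _ _ L1)).
set (m := Cmod (y - z)) in *; assert (Hm : (0 <= m)%R) by apply Cmod_ge_0.
apply Rle_trans with (E * (3 * m * m))%R; [now apply Rmult_le_compat_l|].
replace (E * (3 * m * m))%R with (3 * E * m * m)%R by ring.
apply Rmult_le_compat_r; [exact Hm|].
apply Rmult_lt_compat_r with (r := (3 * E + 1)%R) in L2; [|lra].
replace (e / (3 * E + 1) * (3 * E + 1))%R with e in L2 by (field; lra).
lra.
Qed.

Lemma ex_Cderive_exp_factor (gamma z : C) :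
  ex_Cderive (fun xi => Cexp (- xi / gamma)) z.
Proof.
eexists; apply (is_Cderive_comp (f := Cexp) (g := fun xi => - xi / gamma)).
- apply is_Cderive_Cexp.
- apply is_Cderive_ext with (fun xi => RtoC 0 + (- / gamma) * xi).
  + intros y; change (RtoC 0 + - / gamma * y = - y / gamma :> C); unfold Cdiv;
      ring.
  + apply is_Cderive_affine.
Qed.

Lemma ex_Cderive_Laplace_integrand (gamma : C) (B : C -> C) (z : C) :
  ex_Cderive B z -> ex_Cderive (Laplace_integrand gamma B) z.
Proof.
intros H; exact (ex_Cderive_mult (ex_Cderive_exp_factor gamma z) H).
Qed.

Lemma is_pole_Laplace_integrand (gamma : C) (B : C -> C) (p : C) :
  is_pole B p -> is_pole (Laplace_integrand gamma B) p.
Proof.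
intros (n & Hn & g & Hg & Hgp & H); exists n; split; [exact Hn|].
exists (Laplace_integrand gamma g); split; [|split].
- revert Hg; unfold holomorphic_at; apply filter_imp; intros z.
  apply ex_Cderive_Laplace_integrand.
- destruct Hgp as [E | Hgp]; [now left | right].
  apply Cmult_neq_0; [apply Cexp_neq0 | exact Hgp].
- revert H; apply filter_imp; intros z Hz.
  unfold Laplace_integrand; rewrite Hz; unfold Cdiv; ring.
Qed.

Lemma holomorphic_at_continuous (f : C -> C) (p : C) :
  holomorphic_at f p ->
  continuous (T := C_UniformSpace) (U := C_UniformSpace) f p.
Proof.
intros H; apply ex_Cderive_continuous; exact (locally_singleton _ _ H).
Qed.

(** * Growth, isolation and finiteness of poles *)

Lemma pole_unbounded (f : C -> C) (p : C) (M : R) : is_pole f p ->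
  exists d, (0 < d)%R /\
    forall z, (Cmod (z - p) < d)%R -> z <> p -> (M < Cmod (f z))%R.
Proof.
intros (n & Hn & g & Hg & Hgp & H).
destruct n as [|n]; [lia|]; destruct Hgp as [E | Hgp]; [discriminate|].
assert (Hm : (0 < Cmod (g p) / 2)%R) by (apply Cmod_gt_0 in Hgp; lra).
destruct (Ccontinuous_locally (holomorphic_at_continuous Hg) Hm) as [d1 [Hd1 H1]].
apply Clocally'_iff in H; destruct H as [d2 [Hd2 H2]].
set (m := (Cmod (g p) / 2)%R) in *.
set (K := (Rabs M + 1)%R); assert (HK : (0 < K)%R).
{ unfold K; generalize (Rabs_pos M); lra. }
(* With x = |z - p| < 1, x^(n+1) <= x < m / K, while |g z| > m; [K] is positive whatever the sign of
   [M]. *)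
exists (Rmin (Rmin d1 d2) (Rmin 1 (m / K))); split.
{ repeat apply Rmin_glb_lt; try lra; now apply Rdiv_lt_0_compat. }
intros z Hz Nz.
assert (L1 := Rlt_le_trans _ _ _ Hz (Rmin_l _ _)).
assert (L2 := Rlt_le_trans _ _ _ Hz (Rmin_r _ _)).
assert (L3 := Rlt_le_trans _ _ _ L1 (Rmin_l _ _)).
assert (L4 := Rlt_le_trans _ _ _ L1 (Rmin_r _ _)).
assert (L5 := Rlt_le_trans _ _ _ L2 (Rmin_l _ _)).
assert (L6 := Rlt_le_trans _ _ _ L2 (Rmin_r _ _)).
assert (N := Cminus_eq_contra _ _ Nz).
rewrite (H2 z L4 Nz), Cmod_div, Cmod_pow by now apply Cpow_nz.
assert (Hg2 : (m < Cmod (g z))%R).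
{ assert (T := Cmod_triangle (g z) (- (g z - g p))).
  replace (g z + - (g z - g p)) with (g p) in T by ring.
  rewrite Cmod_opp in T; specialize (H1 z L3); unfold m in *; lra. }
set (x := Cmod (z - p)) in *; assert (Hx : (0 < x)%R) by now apply Cmod_gt_0.
assert (Hxn : (x ^ S n <= x)%R).
{ cbn; rewrite <- (Rmult_1_r x) at 3; apply Rmult_le_compat_l; [lra|].
  rewrite <- (pow1 n); apply pow_incr; lra. }
assert (Hxp : (0 < x ^ S n)%R) by now apply pow_lt.
apply Rle_lt_trans with K; [unfold K; generalize (Rle_abs M); lra|].
apply Rmult_lt_reg_r with (x ^ S n)%R; [exact Hxp|].
unfold Rdiv; rewrite Rmult_assoc, Rinv_l, Rmult_1_r by lra.
apply Rmult_lt_compat_r with (r := K) in L6; [|exact HK].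
replace (m / K * K)%R with m in L6 by (field; lra).
apply Rle_lt_trans with (K * x)%R; [apply Rmult_le_compat_l|]; lra.
Qed.

Lemma not_pole_of_bounded (f : C -> C) (p : C) (d M : R) : (0 < d)%R ->
  (forall z, (Cmod (z - p) < d)%R -> (Cmod (f z) <= M)%R) -> ~ is_pole f p.
Proof.
intros Hd H Hp; destruct (pole_unbounded M Hp) as [d' [Hd' H']].
assert (Hm : (0 < Rmin d d')%R) by now apply Rmin_glb_lt.
set (z := p + RtoC (Rmin d d' / 2)).
assert (E : z - p = RtoC (Rmin d d' / 2)) by (unfold z; ring).
assert (Hz : (Cmod (z - p) < Rmin d d')%R).
{ rewrite E, Cmod_R, Rabs_pos_eq; lra. }
specialize (H z (Rlt_le_trans _ _ _ Hz (Rmin_l _ _))).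
specialize (H' z (Rlt_le_trans _ _ _ Hz (Rmin_r _ _))).
assert (Nz : z <> p).
{ intros Ez; rewrite Ez in E; replace (p - p) with (RtoC 0) in E by ring.
  apply RtoC_inj in E; lra. }
specialize (H' Nz); lra.
Qed.

Lemma holomorphic_at_not_pole (f : C -> C) (p : C) :
  holomorphic_at f p -> ~ is_pole f p.
Proof.
intros H.
destruct (Ccontinuous_locally (holomorphic_at_continuous H) Rlt_0_1) as [d [Hd Hf]].
apply (@not_pole_of_bounded f p d (Cmod (f p) + 1)); [exact Hd|].
intros z Hz; specialize (Hf z Hz).
assert (T := Cmod_triangle (f z - f p) (f p)).
replace (f z - f p + f p) with (f z) in T by ring; lra.
Qed.

(** Boundedness is enough: on a quarter of the disk all partial sums are at most [2 * K], so the sum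
    need not be differentiated. *)
Lemma pseries_not_pole (f : C -> C) (a : nat -> C) :
  Clocally (RtoC 0) (fun x =>
    is_pseries (K := C_AbsRing) (V := C_NormedModule) a x (f x)) ->
  ~ is_pole f 0.
Proof.
intros H; apply (proj1 (Clocally_iff _ _)) in H; destruct H as [d [Hd H]].
assert (H1 := H (RtoC (d / 2))).
destruct (@Cpseries_coef_bound a (d / 2) (f (RtoC (d / 2)))) as (K & HK & Ha);
  [lra | |].
{ apply H1; replace (RtoC (d / 2) - RtoC 0) with (RtoC (d / 2)) by ring.
  rewrite Cmod_R, Rabs_pos_eq; lra. }
apply (@not_pole_of_bounded f 0 (d / 4) (2 * K + 1)); [lra|].
intros z Hz.
destruct (proj1 (is_Cpseries_iff _ _ _) (H z ltac:(lra)) 1%R Rlt_0_1) as [N HN].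
specialize (HN N (le_n N)).
replace (z - 0) with z in Hz by ring.
assert (Bd : (Cmod (Cpoly a N z) <= 2 * K)%R).
{ apply Cpoly_bound with (d / 2)%R; auto; lra. }
assert (T := Cmod_triangle (Cpoly a N z) (- (Cpoly a N z - f z))).
replace (Cpoly a N z + - (Cpoly a N z - f z)) with (f z) in T by ring.
rewrite Cmod_opp in T; lra.
Qed.

Lemma poles_isolated (D : C -> Prop) (f : C -> C) (p : C) :
  meromorphic_on D f -> D p ->
  exists d, (0 < d)%R /\
    forall z, (Cmod (z - p) < d)%R -> is_pole f z -> z = p.
Proof.
intros Hf Hp.
assert (H : Clocally' p (fun z => holomorphic_at f z)).
{ destruct (Hf p Hp) as [H | (n & Hn & g & Hg & _ & H)].
  - apply filter_le_within.
    generalize (locally_locally _ _ H); apply filter_imp; auto.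
  - apply Clocally'_iff in H; destruct H as [d [Hd H]].
    apply (proj1 (Clocally_iff _ _)) in Hg; destruct Hg as [d' [Hd' Hg]].
    apply Clocally'_iff; exists (Rmin d d'); split; [now apply Rmin_glb_lt|].
    intros z Hz Nz; assert (N := Cminus_eq_contra _ _ Nz).
    assert (Hzp : (0 < Cmod (z - p))%R) by now apply Cmod_gt_0.
    apply Clocally_iff.
    (* A disk around [z] that avoids [p] and stays where the quotient formula holds. Each [y] in it
       needs such a disk again, since differentiability at [y] uses the formula near [y]. *)
    exists (Rmin (Rmin d d' - Cmod (z - p)) (Cmod (z - p))); split.
    { apply Rmin_glb_lt; lra. }
    intros y Hy.
    assert (L1 := Rlt_le_trans _ _ _ Hy (Rmin_l _ _)).
    assert (L2 := Rlt_le_trans _ _ _ Hy (Rmin_r _ _)).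
    assert (Hyp : (Cmod (y - p) < Rmin d d')%R).
    { replace (y - p) with ((y - z) + (z - p)) by ring.
      eapply Rle_lt_trans; [apply Cmod_triangle | lra]. }
    assert (Ny : y <> p).
    { intros ->; rewrite <- Copp_minus_distr, Cmod_opp in L2; lra. }
    apply ex_Cderive_ext_loc with (fun y => g y * (/ (y - p)) ^ n).
    + apply Clocally_iff.
      exists (Rmin (Rmin d d' - Cmod (y - p)) (Cmod (y - p))); split.
      { apply Rmin_glb_lt; [lra|]; apply Cmod_gt_0, Cminus_eq_contra, Ny. }
      intros x Hx.
      assert (M1 := Rlt_le_trans _ _ _ Hx (Rmin_l _ _)).
      assert (M2 := Rlt_le_trans _ _ _ Hx (Rmin_r _ _)).
      assert (Nx : x <> p).
      { intros ->; rewrite <- Copp_minus_distr, Cmod_opp in M2; lra. }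
      rewrite (H x); [| | exact Nx].
      * rewrite Cpow_inv by now apply Cminus_eq_contra. reflexivity.
      * apply Rlt_le_trans with (2 := Rmin_l d d').
        replace (x - p) with ((x - y) + (y - p)) by ring.
        eapply Rle_lt_trans; [apply Cmod_triangle | lra].
    + apply ex_Cderive_mult.
      * apply Hg; eapply Rlt_le_trans; [exact Hyp | apply Rmin_r].
      * apply ex_Cderive_pow; now apply ex_Cderive_inv_minus. }
apply Clocally'_iff in H; destruct H as [d [Hd H]].
exists d; split; [exact Hd|]; intros z Hz Pz.
apply NNPP; intros Nz; exact (holomorphic_at_not_pole (H z Hz Nz) Pz).
Qed.

(** Compactness by bisection with a degenerate second side: lists of the two halves are
    concatenated, and near each point isolation leaves at most one pole. *)
Lemma finitely_many_poles_on_segment (D : C -> Prop) (f : C -> C)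
  (r theta : R) :
  (0 <= r)%R -> meromorphic_on D f ->
  (forall x, (0 <= x <= r)%R -> D (polar x theta)) ->
  exists l : list C, NoDup l /\
    forall p, In p l <-> (is_pole f p /\ ray theta p) /\ (Cmod p < r)%R.
Proof.
intros Hr Hf HD.
assert (H : exists l : list C, forall p x, (0 <= x <= 0 + r / 2 ^ 0)%R ->
  p = polar x theta -> is_pole f p -> In p l).
{ apply (rectangle_bisection (fun n s _ => exists l : list C,
    forall p x, (s <= x <= s + r / 2 ^ n)%R -> p = polar x theta ->
    is_pole f p -> In p l) (a := r) (b := 0%R) (s0 := 0%R) (t0 := 0%R));
      try lra.
  - intros n s t _ _ _ _ [l1 H1] [l2 H2] _ _; exists (l1 ++ l2).
    intros p x Hx Ep Hp; apply in_or_app.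
    assert (E : (r / 2 ^ n = r / 2 ^ S n + r / 2 ^ S n)%R).
    { cbn; field; apply pow_nonzero; lra. }
    destruct (Rle_or_lt x (s + r / 2 ^ S n)).
    + left; apply (H1 p x); auto; lra.
    + right; apply (H2 p x); auto; lra.
  - intros x y Hx _.
    destruct (@poles_isolated D f (polar x theta) Hf (HD x ltac:(lra))) as [d [Hd Hiso]].
    destruct (pow_lt_1_zero (/ 2) ltac:(rewrite Rabs_pos_eq;
      lra) (d / (r + 1))%R)
      as [N HN]; [apply Rdiv_lt_0_compat; lra|].
    exists N; intros n s t Hn _ _ _ _ Hs _.
    exists (polar x theta :: nil); intros p u Hu -> Hp; left; symmetry.
    apply Hiso; [|exact Hp].
    rewrite !polar_eit.
    replace (RtoC u * eit theta - RtoC x * eit theta)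
      with (RtoC (u - x) * eit theta) by (rewrite RtoC_minus; ring).
    rewrite Cmod_mult, Cmod_eit, Cmod_R, Rmult_1_r.
    assert (P2 : (0 < (/ 2) ^ n)%R) by (apply pow_lt; lra).
    specialize (HN n Hn); rewrite Rabs_pos_eq in HN by lra.
    apply Rle_lt_trans with (r * (/ 2) ^ n)%R.
    + rewrite pow_inv by lra; apply Rabs_le; unfold Rdiv in Hs, Hu; lra.
    + apply Rmult_lt_compat_r with (r := (r + 1)%R) in HN; [|lra].
      replace (d / (r + 1) * (r + 1))%R with d in HN by (field; lra).
      lra. }
destruct H as [l Hl].
(* The list found may contain other points and repetitions; it is trimmed to the required poles. *)
exists (nodup Ceq_dec (filter (fun p => if excluded_middle_informative
  ((is_pole f p /\ ray theta p) /\ (Cmod p < r)%R) then true else false) l)).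
split; [apply NoDup_nodup|]; intros p; rewrite nodup_In, filter_In.
destruct excluded_middle_informative as [H | H]; [|split;
  [easy | contradiction]].
split; [easy|]; intros _; split; [|reflexivity].
destruct H as [[Hp (x & Hx & E)] Hm]; apply (Hl p x); auto.
rewrite E, polar_eit, Cmod_circle in Hm by exact Hx; cbn; lra.
Qed.

(** * The jump of the Laplace transform *)

Lemma Laplace_ray_integrand_eit (theta : R) (gamma : C) (B : C -> C) :
  Laplace_ray_integrand theta gamma B =
  fun s => Laplace_integrand gamma B (RtoC s * eit theta) * eit theta.
Proof.
apply functional_extensionality; intros s.
unfold Laplace_ray_integrand; rewrite !polar_eit, Cmult_1_l; reflexivity.
Qed.

Lemma is_RInt_gen_p_infty (f : R -> C) (a : R) (L : C) (e : R) :
  is_RInt_gen (V := C_R_NormedModule) f (at_point a) (Rbar_locally p_infty) L ->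
  (0 < e)%R ->
  exists M, forall b, (M < b)%R ->
    exists y, is_CRInt f a b y /\ (Cmod (y - L) < e)%R.
Proof.
intros H He.
assert (HP : Clocally L (fun y => (Cmod (y - L)%C < e)%R)).
{ apply Clocally_iff; exists e; auto. }
destruct (H _ HP) as [Q P HQ [M HM] HQP].
exists M; intros b Hb.
destruct (HQP a b HQ (HM b Hb)) as [y [Hy1 Hy2]]; exists y; auto.
Qed.

(** A pole on the ray would make the integrand unbounded on a segment. *)
Lemma ex_Laplace_no_pole (theta : R) (B : C -> C) (gamma : C) (rho : R) :
  (0 < rho)%R -> ex_Laplace theta B gamma -> ~ is_pole B (polar rho theta).
Proof.
intros Hrho [L HL] Hp.
destruct (is_RInt_gen_p_infty HL Rlt_0_1) as [M HM].
(* Far enough for integrability on [[0, b]], and with room beyond [rho] for a test point next to the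
   pole. *)
set (b := (Rmax M rho + 1)%R).
assert (Hb : (M < b /\ rho < b)%R).
{ unfold b; generalize (Rmax_l M rho) (Rmax_r M rho); lra. }
destruct (HM b) as [y [Hy _]]; [lra|].
destruct (ex_RInt_ub (V := C_R_NormedModule) _ _ _ (ex_intro _ y Hy)) as [K HK].
rewrite Rmin_left, Rmax_right, Laplace_ray_integrand_eit in HK by lra.
destruct (pole_unbounded K (is_pole_Laplace_integrand gamma Hp)) as [d [Hd H]].
set (m := Rmin d (b - rho)).
assert (Hm : (0 < m)%R) by (apply Rmin_glb_lt; lra).
assert (Hm1 : (m <= d)%R) by apply Rmin_l.
assert (Hm2 : (m <= b - rho)%R) by apply Rmin_r.
clearbody m b.
assert (D : RtoC (rho + m / 2) * eit theta - polar rho theta =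
  RtoC (m / 2) * eit theta).
{ rewrite polar_eit, RtoC_plus; ring. }
specialize (HK (rho + m / 2)%R ltac:(lra)).
rewrite Cnorm_Cmod, Cmod_mult, Cmod_eit, Rmult_1_r in HK.
assert (K' : (K < Cmod (Laplace_integrand gamma B (RtoC (rho + m / 2) * eit theta)))%R).
{ apply H.
  - rewrite D, Cmod_circle; lra.
  - intros E; rewrite E in D.
    replace (polar rho theta - polar rho theta) with (RtoC 0) in D by ring.
    apply (f_equal Cmod) in D; rewrite Cmod_0, Cmod_circle in D; lra. }
lra.
Qed.

(** The two excluded points, the apex and the end of the ray on the arc, are where poles of the ray
    could meet the boundary. *)
Lemma sector_residue_sum (B : C -> C) (gamma : C) (U : C -> Prop)
    (theta eps al be r : R) (l : list C) :
  (eps < 2 * PI)%R -> (theta - eps <= al < theta)%R ->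
  (theta < be <= theta + eps)%R -> (0 <= r)%R ->
  meromorphic_on U B ->
  (forall xi, closed_sector (theta - eps) (theta + eps) xi -> U xi) ->
  (forall p, closed_sector (theta - eps) (theta + eps) p -> is_pole B p ->
     ray theta p) ->
  ~ is_pole B 0 -> ~ is_pole B (polar r theta) ->
  NoDup l ->
  (forall p, In p l <-> (is_pole B p /\ ray theta p) /\ (Cmod p < r)%R) ->
  is_sector_integral (Laplace_integrand gamma B) r al be
    (2 * PI * Ci *
     fold_right Cplus 0 (map (Residue (Laplace_integrand gamma B)) l)).
Proof.
intros Heps Hal Hbe Hr HB HU Hray N0 Nr Hnd Hl.
apply (@sector_residue_theorem theta al be r); try lra; auto.
- intros p Hp; apply Hl in Hp; destruct Hp as [[Hp (x & Hx & ->)] Hm].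
  rewrite polar_eit, Cmod_circle in Hm by exact Hx.
  exists x; rewrite polar_eit; split; [split; [|exact Hm] | reflexivity].
  destruct Hx as [Hx | <-]; [exact Hx|]; exfalso; apply N0.
  now rewrite polar_eit, Cmult_0_l in Hp.
- intros p Hp; apply Hl in Hp; destruct Hp as [[Hp _] _].
  destruct (is_pole_Laplace_integrand gamma Hp) as (n & Hn & g & Hg & _ & H).
  destruct n as [|n]; [lia|].
  destruct (@pole_principal_part _ g p n Hg H) as (a & Ha & Hres);
    now exists a, n.
- intros z (s & t & Hs & Ht & ->) Nz.
  assert (Hc : closed_sector (theta - eps) (theta + eps) (RtoC s * eit t)).
  { exists s, t; rewrite polar_eit; repeat split; lra. }
  destruct (HB _ (HU _ Hc)) as [H | H].
  + apply ex_Cderive_Laplace_integrand; exact (locally_singleton _ _ H).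
  + exfalso; apply Nz, Hl; split; [split; [exact H | now apply Hray]|].
    destruct (Hray _ Hc H) as (x & Hx & E).
    assert (Es := f_equal Cmod E).
    rewrite polar_eit, !Cmod_circle in Es by lra; subst x.
    rewrite Cmod_circle by lra.
    (* A pole of modulus exactly [r] would be the point of the ray on the arc. *)
    destruct (proj2 Hs) as [L | ->]; [exact L|].
    rewrite E in H; contradiction.
Qed.
Theorem theorem3
  (W : C -> Prop)
  (W_open : open (T := C_UniformSpace) W)
  (W_connected : connected_set W)
  (K : C2 -> C)
  (K_meromorphic : meromorphic2_on (fun q => W (fst q)) K)
  (K_polar : forall w : C, W w -> exists z : C, ~ polar_set2 K (w, z))
  (Gam : C -> R -> C)
  (Gam_family : continuous_family_of_curves W Gam)
  (Gam_avoids : forall (w : C) (t : R), W w ->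
     ~ is_pole (fun z => K (w, z)) (Gam w t))
  (k0 : nat)
  (k0_order : forall w : C, W w -> has_pole_order (fun z => K (w, z)) 0 k0)
  (h : nat -> C -> C)
  (h_integral : forall (m : nat) (w : C), (k0 <= m)%nat -> W w ->
     is_curve_integral (fun z => (K (w, z) * z ^ m)%C) (Gam w) (h m w))
  (h_holomorphic : forall (m : nat) (w : C), (k0 <= m)%nat -> W w ->
     holomorphic_at (h m) w)
  (f : C -> C)
  (f_meromorphic : meromorphic_on (fun _ => True) f)
  (n0 : nat) (a : Z -> C)
  (f_laurent : is_laurent f 0 n0 a)
  (w : C) (Ww : W w)
  (gamma : C) (gamma_neq0 : gamma <> 0)
  (thetaj eps : R) (eps_gt0 : (0 < eps)%R)
  (B : C -> C)
  (B_series : locally (T := C_UniformSpace) (RtoC 0) (fun xi =>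
     is_pseries (K := C_AbsRing) (V := C_NormedModule)
       (formal_Borel (gplus a h k0 w)) xi (B xi)))
  (U : C -> Prop)
  (U_open : open (T := C_UniformSpace) U)
  (U_sector : forall xi : C,
     closed_sector (thetaj - eps) (thetaj + eps) xi -> U xi)
  (B_meromorphic : meromorphic_on U B)
  (ray_meets_poles : exists p : C, ray thetaj p /\ is_pole B p)
  (Laplace_defined : forall theta : R,
     (thetaj - eps <= theta < thetaj)%R \/ (thetaj < theta <= thetaj + eps)%R ->
     ex_Laplace theta B gamma)
  (poles_on_ray : forall p : C,
     closed_sector (thetaj - eps) (thetaj + eps) p -> is_pole B p ->
     ray thetaj p)
  (Rn : nat -> R)
  (Rn_ge0 : forall n : nat, (0 <= Rn n)%R)
  (Rn_infty : is_lim_seq Rn p_infty)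
  (Rn_not_pole : forall n : nat, ~ is_pole B (polar (Rn n) thetaj))
  (arc_decay : exists M : nat -> R,
     (forall n : nat, is_arc_sup (Laplace_integrand gamma B)
        (Rn n) (thetaj - eps) (thetaj + eps) (M n)) /\
     is_lim_seq (fun n => (Rn n * M n)%R) 0%R) :
  exists Delta S : C,
    is_Laplace_jump B gamma thetaj eps Delta /\
    is_residue_sum (Laplace_integrand gamma B)
      (fun p => is_pole B p /\ ray thetaj p) Rn S /\
    Delta = (2 * PI * Ci * S)%C.
Proof.
assert (Hpi := PI_RGT_0).
set (F := Laplace_integrand gamma B).
assert (N0 : ~ is_pole B 0) by exact (pseries_not_pole B_series).
assert (Heps : (eps < 2 * PI)%R).
{ apply Rnot_le_lt; intros Hge.
  destruct ray_meets_poles as (p & (x & Hx & ->) & Hp).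
  assert (Hx0 : (0 < x)%R).
  { destruct Hx as [Hx | <-]; [exact Hx|]; exfalso; apply N0.
    now rewrite polar_eit, Cmult_0_l in Hp. }
  apply (@ex_Laplace_no_pole (thetaj - 2 * PI) B gamma x Hx0);
    [apply Laplace_defined; left; lra|].
  rewrite polar_eit in *.
  replace (eit (thetaj - 2 * PI)) with (eit thetaj); [exact Hp|].
  replace thetaj with (thetaj - 2 * PI + 2 * PI)%R at 1 by ring.
  rewrite eit_plus, eit_2PI, eit_0; ring. }
assert (poles : forall n, exists l, NoDup l /\
  forall p, In p l <-> (is_pole B p /\ ray thetaj p) /\ (Cmod p < Rn n)%R).
{ intros n; apply (@finitely_many_poles_on_segment U); auto.
  intros x Hx; apply U_sector; exists x, thetaj; repeat split; lra. }
pose (l :=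
  fun n => proj1_sig (constructive_indefinite_description _ (poles n))).
assert (Hl : forall n, NoDup (l n) /\
  forall p, In p (l n) <-> (is_pole B p /\ ray thetaj p) /\ (Cmod p < Rn n)%R).
{ intros n;
    exact (proj2_sig (constructive_indefinite_description _ (poles n))). }
clearbody l.
pose (Sum := fun n => fold_right Cplus 0 (map (Residue F) (l n))).
(* [Sum] does not involve [al] and [be]: two pairs of directions share one limit, and a single pair
   already gives convergence. *)
assert (lim : forall al be : R, (thetaj - eps <= al < thetaj)%R ->
  (thetaj < be <= thetaj + eps)%R -> forall e, (0 < e)%R ->
  exists N, forall n, (N <= n)%nat ->
    (Cmod (2 * PI * Ci * Sum n - (Laplace al B gamma - Laplace be B gamma)) < e)%R).
{ intros al be Hal Hbe e He.
  assert (He3 : (0 < e / 3)%R) by lra.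
  assert (La := RInt_gen_correct (V := C_R_CompleteNormedModule) _
    (Laplace_defined al (or_introl Hal))).
  assert (Lb := RInt_gen_correct (V := C_R_CompleteNormedModule) _
    (Laplace_defined be (or_intror Hbe))).
  fold (Laplace al B gamma) in La; fold (Laplace be B gamma) in Lb.
  rewrite Laplace_ray_integrand_eit in La, Lb; fold F in La, Lb.
  destruct (is_RInt_gen_p_infty La He3) as [Ma HMa].
  destruct (is_RInt_gen_p_infty Lb He3) as [Mb HMb].
  destruct arc_decay as (M & HM & HlimM).
  apply is_lim_seq_spec in HlimM; apply is_lim_seq_spec in Rn_infty.
  destruct (Rn_infty Ma) as [Na HNa]; destruct (Rn_infty Mb) as [Nb HNb].
  (* The arc has angle at most [2 * eps], so it contributes less than [e / 3]; the two truncated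
     rays take the other thirds. *)
  assert (He9 : (0 < e / (3 * (2 * eps + 1)))%R) by (apply Rdiv_lt_0_compat;
    lra).
  destruct (HlimM (mkposreal _ He9)) as [Nc HNc]; cbn in HNc.
  exists (Na + Nb + Nc)%nat; intros n Hn.
  specialize (HNa n ltac:(lia)); specialize (HNb n ltac:(lia)).
  specialize (HNc n ltac:(lia)); rewrite Rminus_0_r in HNc.
  destruct (HMa _ HNa) as (ya & Iya & Hya);
    destruct (HMb _ HNb) as (yb & Iyb & Hyb).
  destruct (Hl n) as [Hnd HIn].
  destruct (@sector_residue_sum B gamma U thetaj eps al be (Rn n) (l n))
    as (l1 & l2 & l3 & I1 & I2 & I3 & E); auto; fold F in I1, I2, I3, E.
  fold (Sum n) in E; rewrite E.
  rewrite (is_CRInt_uniq I1 Iya), (is_CRInt_uniq I3 Iyb).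
  assert (B2 : (Cmod l2 < e / 3)%R).
  { apply Rle_lt_trans with ((be - al) * (Rn n * M n))%R.
    - apply (Cmod_CRInt_le (a := al) (b := be) ltac:(lra) (M := (Rn n * M n)%R)
        (f := fun t => F (RtoC (Rn n) * eit t) * (RtoC (Rn n) * (Ci * eit t))));
        [|exact I2].
      intros t Ht.
      replace (F (RtoC (Rn n) * eit t) * (RtoC (Rn n) * (Ci * eit t)))
        with (RtoC (Rn n) * eit t * Ci * F (RtoC (Rn n) * eit t)) by ring.
      rewrite !Cmod_mult, Cmod_R, Cmod_eit, Cmod_Ci, Rabs_pos_eq by auto.
      rewrite !Rmult_1_r; apply Rmult_le_compat_l; [apply Rn_ge0|].
      apply (proj1 (HM n)); exists t; split; [lra|].
      now rewrite polar_eit.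
    - apply Rabs_def2 in HNc; destruct HNc as [HNc _].
      assert (Hw : (0 < be - al <= 2 * eps)%R) by lra.
      apply Rle_lt_trans with ((be - al) * (e / (3 * (2 * eps + 1))))%R.
      + apply Rmult_le_compat_l; lra.
      + apply Rle_lt_trans with (2 * eps * (e / (3 * (2 * eps + 1))))%R.
        * apply Rmult_le_compat_r; lra.
        * replace (e / 3)%R with ((2 * eps + 1) * (e / (3 * (2 * eps + 1))))%R
            by (field; lra).
          apply Rmult_lt_compat_r; lra. }
  replace (ya + l2 - yb - (Laplace al B gamma - Laplace be B gamma))
    with ((ya - Laplace al B gamma) + l2 + - (yb - Laplace be B gamma)) by ring.
  eapply Rle_lt_trans; [apply Cmod_triangle|].
  eapply Rle_lt_trans; [apply Rplus_le_compat_r, Cmod_triangle|].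
  rewrite Cmod_opp; lra. }
set (Delta := Laplace (thetaj - eps) B gamma - Laplace (thetaj + eps) B gamma).
assert (N : (2 * PI * Ci)%C <> 0).
{ apply Cmult_neq_0; [|apply Ci_nz].
  rewrite <- RtoC_mult; intros E; apply RtoC_inj in E; lra. }
set (c := (2 * PI * Ci)%C) in *; clearbody c.
(* The extreme directions serve as reference for the jump, and the residue sum is read off from the
   limit by dividing by 2 pi i. *)
exists Delta, (Delta / (c)); split; [|split].
- intros al be Hal Hbe.
  apply Ceq_minus, Cmod_eq_0, Rle_antisym; [|apply Cmod_ge_0].
  apply le_epsilon; intros e He; rewrite Rplus_0_l.
  assert (He2 : (0 < e / 2)%R) by lra.
  destruct (lim al be Hal Hbe _ He2) as [N1 H1].
  destruct (lim (thetaj - eps)%R (thetaj + eps)%R ltac:(lra) ltac:(lra) _ He2)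
    as [N2 H2].
  specialize (H1 (N1 + N2)%nat ltac:(lia));
    specialize (H2 (N1 + N2)%nat ltac:(lia)).
  fold Delta in H2.
  set (s := c * Sum (N1 + N2)%nat) in *.
  set (D := Laplace al B gamma - Laplace be B gamma) in *.
  replace (D - Delta) with (- (s - D) + (s - Delta)) by ring.
  eapply Rle_trans; [apply Cmod_triangle|]; rewrite Cmod_opp; lra.
- exists l; split; [exact Hl|].
  intros P HP; apply (proj1 (Clocally_iff _ _)) in HP;
    destruct HP as [e [He HP]].
  assert (Hm : (0 < Cmod (c))%R) by now apply Cmod_gt_0.
  destruct (lim (thetaj - eps)%R (thetaj + eps)%R ltac:(lra) ltac:(lra)
    (e * Cmod (c))%R) as [N1 H1]; [now apply Rmult_lt_0_compat|].
  exists N1; intros n Hn; apply HP; specialize (H1 n Hn).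
  fold F; fold (Sum n); fold Delta in H1.
  replace (c * Sum n - Delta) with
    ((Sum n - Delta / (c)) * (c)) in H1 by (field; exact N).
  rewrite Cmod_mult in H1; now apply Rmult_lt_reg_r in H1.
- field; exact N.
Qed.
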